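(* Let $n\geq 3$ and let $\Gamma_n$ be the countable homogeneous universal generalized $n$-gon, i.e. the Fraïssé limit of the class $\mathcal{C}_n$. Then $\operatorname{Aut}(\Gamma_n)$ is universal for the class of all automorphism groups of generalized $n$-gons that are free over a finite subset; that is, for every generalized $n$-gon $\Delta$ which is the free $n$-completion of a finite subset, there is a continuous injective group homomorphism $\operatorname{Aut}(\Delta)\to\operatorname{Aut}(\Gamma_n)$.
   Context: Graphs. A subgraph means an induced subgraph. The graph metric $d^G(x,y)$ is the length of a shortest path from $x$ to $y$ in $G$. The diameter of $G$ is the least $m\in\mathbb{N}$ such that any two vertices are at distance at most $m$; the girth is the length of a shortest cycle. A generalized $n$-gon is a bipartite graph of diameter $n$ and girth $2n$. Language. Generalized $n$-gons (and bipartite graphs) $\Gamma$ are considered in the language $L_n=\{P,f_k\mid k=0,\dots,n\}$, where $P$ is a predicate for the sort of the bipartition of the vertex set and the $f_k$ are binary functions with $f_k(x,y)=x_k$ if $d^\Gamma(x,y)=l\geq k$ and there is a unique shortest path $(x=x_0,\dots,x_k,\dots,x_l=y)$ from $x$ to $y$, and $f_k(x,y)=x$ if there is no such unique path or $d^\Gamma(x,y)<k$. Automorphisms are automorphisms of $L_n$-structures. Free $n$-completion. For a connected bipartite graph $G$ without cycles of length less than $2n$, put $\mathcal{F}_0(G)=G$; given $\mathcal{F}_i(G)$, let $\mathcal{F}_{i+1}(G)$ be obtained by adding, for every pair $x,y\in\mathcal{F}_i(G)$ with $d^{\mathcal{F}_i(G)}(x,y)=n+1$, a new path $(x=x_0,x_1,\dots,x_{n-2},x_{n-1}=y)$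 of length $n-1$ with $x_1,\dots,x_{n-2}$ new vertices. The free $n$-completion is $\mathcal{F}(G)=\bigcup_{i}\mathcal{F}_i(G)$. $\mathcal{C}_n$ is the class of all free $n$-completions of finite connected bipartite graphs without cycles of length less than $2n$, together with their $L_n$-substructures. By a theorem of Tent, $\mathcal{C}_n$ is a Fraïssé class; its countable homogeneous Fraïssé limit is denoted $\Gamma_n$. ''Free over a finite subset'' means: equal to $\mathcal{F}(G)$ for some finite connected bipartite graph $G$ without cycles of length less than $2n$. Automorphism groups of countable structures carry the topology of pointwise convergence.
   Formalization: In C_n only free n-completions that are generalized n-gons (and their substructures) are kept: a path of length n is its own completion, with f_n(x_0,x_n)=x_n, and cannot be jointly embedded with a 2n-cycle, so otherwise C_n would not be a Fraïssé class. *)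

(* Defs.v *)
From HB Require Import structures.
From mathcomp Require Import all_boot.
From mathcomp Require Import boolp classical_sets functions cardinality.
From mathcomp Require Import topology function_spaces.

Set Implicit Arguments.
Unset Strict Implicit.
Unset Printing Implicit Defensive.

Local Open Scope classical_set_scope.

(** * Graph metric, cycles, induced subgraphs *)

(* A graph is given by its adjacency relation [e] on a vertex type [V].
   As in path.v, a path from [x] is written [x :: p]; its length is [size p]. *)
Section Graph.
Variables (V : choiceType) (e : rel V).

Definition path_from_to (x y : V) (p : seq V) : Prop :=
  path e x p /\ last x p = y.

Definition shortest_path (x y : V) (p : seq V) : Prop :=
  path_from_to x y p /\ forall q, path_from_to x y q -> size p <= size q.

(* [has_dist x y m] is false for every [m] when [x] and [y] lie in different
   components. *)
Definition has_dist (x y : V) (m : nat) : Prop :=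
  exists2 p, shortest_path x y p & size p = m.

Definition unique_shortest_path (x y : V) (p : seq V) : Prop :=
  shortest_path x y p /\ forall q, shortest_path x y q -> q = p.

(* [2 < size c] excludes the degenerate [ucycle]s of path.v, in particular an
   edge traversed back and forth. *)
Definition is_cycle (c : seq V) : Prop := ucycle e c /\ 2 < size c.

Definition diam_le (m : nat) : Prop :=
  forall x y, exists2 l, l <= m & has_dist x y l.

Definition has_diameter (m : nat) : Prop :=
  diam_le m /\ forall m', diam_le m' -> m <= m'.

Definition has_girth (g : nat) : Prop :=
  (exists2 c, is_cycle c & size c = g) /\
  forall c, is_cycle c -> g <= size c.

Definition no_cycle_shorter_than (m : nat) : Prop :=
  forall c, is_cycle c -> m <= size c.

(* Edges of the subgraph induced on [S]; the vertices outside [S] stay in the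
   type as isolated points, so vertex quantifiers must be restricted to [S]. *)
Definition induced (S : set V) : rel V :=
  fun x y => [&& x \in S, y \in S & e x y].

End Graph.

Definition connected_on (V : choiceType) (e : rel V) (S : set V) : Prop :=
  forall x y, S x -> S y -> exists p, path_from_to (induced e S) x y p.

Record bigraph := BiGraph {
  vertex :> choiceType;
  adj : rel vertex;
  side : pred vertex;
  adj_sym : symmetric adj;
  adj_side : forall x y, adj x y -> side x != side y
}.

Definition generalized_gon (n : nat) (D : bigraph) : Prop :=
  has_diameter (@adj D) n /\ has_girth (@adj D) n.*2.

(** * Free completions *)

(* For vertex sets [S] and [S'] of one graph: the subgraph induced on [S'] is
   obtained from the one induced on [S] by adding, for every pair {x, y} at
   distance n + 1 in [S], one new path of length n - 1.  The path added for
   {x, y} is [q x y 0, ..., q x y n.-1]; since pairs are unordered, [q y x] is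
   the same path read backwards. *)
Definition free_step (n : nat) (V : choiceType) (e : rel V) (S S' : set V) :
    Prop :=
  let far x y := [/\ S x, S y & has_dist (induced e S) x y n.+1] in
  let new x y k := far x y /\ 0 < k < n.-1 in
  exists q : V -> V -> nat -> V,
  [/\ [/\ forall x y, far x y -> q x y 0 = x /\ q x y n.-1 = y,
          forall x y k, far x y -> k <= n.-1 -> q y x k = q x y (n.-1 - k),
          forall x y k, new x y k -> ~ S (q x y k)
        & forall x y k x' y' k', new x y k -> new x' y' k' ->
            q x y k = q x' y' k' ->
            (x', y', k') = (x, y, k) \/ (x', y', k') = (y, x, n.-1 - k)],
      S' = S `|` [set z | exists x y k, new x y k /\ z = q x y k]
    & forall u v, S' u -> S' v ->
        (e u v <->
         [/\ S u, S v & e u v] \/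
         exists x y k, [/\ far x y, k < n.-1, u = q x y k & v = q x y k.+1])].

(* [D] is the free n-completion of its subgraph induced on [G]: the stages F_i
   are realized as an increasing chain of vertex sets of [D], which determines
   [D] up to isomorphism over [G]. *)
Definition is_free_completion (n : nat) (D : bigraph) (G : set D) : Prop :=
  exists F : nat -> set D,
  [/\ F 0 = G,
      forall i, free_step n (@adj D) (F i) (F i.+1)
    & \bigcup_i F i = [set: D]].

Definition free_over_finite (n : nat) (D : bigraph) : Prop :=
  exists G : set D,
  [/\ finite_set G,
      connected_on (@adj D) G,
      no_cycle_shorter_than (induced (@adj D) G) n.*2
    & is_free_completion n G].

(** * L_n-structures *)

Record Ln_struct (n : nat) := LnStruct {
  Ln_sort :> choiceType;
  Ln_P : pred Ln_sort;
  Ln_f : 'I_n.+1 -> Ln_sort -> Ln_sort -> Ln_sort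
}.

(* [xget x A] is [x] when [A] is empty; otherwise the set below is the
   singleton of the k-th vertex of the unique shortest path. *)
Definition Ln_of (n : nat) (D : bigraph) : Ln_struct n :=
  @LnStruct n (vertex D) (@side D) (fun k x y =>
    xget x [set z | exists p, [/\ unique_shortest_path (@adj D) x y p,
                                  k <= size p & z = nth x (x :: p) k]]).

Definition Ln_iso (n : nat) (A B : Ln_struct n) (h : A -> B) : Prop :=
  [/\ bijective h,
      forall x, Ln_P (h x) = Ln_P x
    & forall k x y, h (Ln_f k x y) = Ln_f k (h x) (h y)].

Definition isomorphic (n : nat) (A B : Ln_struct n) : Prop :=
  exists h : A -> B, Ln_iso h.

Definition Ln_closed (n : nat) (M : Ln_struct n) (B : set M) : Prop :=
  forall k x y, B x -> B y -> B (Ln_f k x y).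

Record substructure (n : nat) (M : Ln_struct n) := Substructure {
  sub_set :> set M;
  sub_closed : Ln_closed sub_set
}.

Definition sub_f (n : nat) (M : Ln_struct n) (B : substructure M)
    (k : 'I_n.+1) (x y : set_type B) : set_type B :=
  SigSub (mem_set (sub_closed k (set_valP x) (set_valP y))).

Definition sub_struct (n : nat) (M : Ln_struct n) (B : substructure M) :
    Ln_struct n :=
  @LnStruct n (set_type B) (fun x => Ln_P (set_val x)) (@sub_f n M B).

Definition fin_gen (n : nat) (A : Ln_struct n) : Prop :=
  exists2 X : set A, finite_set X &
    forall B : set A, X `<=` B -> Ln_closed B -> B = [set: A].

(** * Automorphism groups with the topology of pointwise convergence *)

Section Aut.
Variables (n : nat) (M : Ln_struct n).

Record Aut := MkAut {
  aut_fun :> M -> M;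
  autP : `[< Ln_iso aut_fun >]
}.

HB.instance Definition _ := [isSub for aut_fun].
HB.instance Definition _ := [Choice of Aut by <:].

Definition aut_one_fun (x : M) : M := x.

Lemma aut_one_subproof : `[< Ln_iso aut_one_fun >].
Proof. by apply/asboolP; split => //; exists id. Qed.

Lemma aut_mul_subproof (g h : Aut) : `[< Ln_iso (g \o h) >].
Proof.
have /asboolP[bg Pg fg] := autP g; have /asboolP[bh Ph fh] := autP h.
apply/asboolP; split=> [|x|k x y] /=; first exact: bij_comp.
- by rewrite Pg Ph.
- by rewrite fh fg.
Qed.

Definition aut_inv_fun (g : Aut) (y : M) : M := xget y [set x | g x = y].

Lemma aut_invKr (g : Aut) : cancel (aut_inv_fun g) g.
Proof.
move=> y; have /asboolP[[h _ gh] _ _] := autP g.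
by rewrite /aut_inv_fun; case: xgetP => [x _ //|/(_ (h y))/=]; rewrite gh.
Qed.

Lemma aut_invK (g : Aut) : cancel g (aut_inv_fun g).
Proof.
move=> x; have /asboolP[bg _ _] := autP g.
by apply: (bij_inj bg); rewrite aut_invKr.
Qed.

Lemma aut_inv_subproof (g : Aut) : `[< Ln_iso (aut_inv_fun g) >].
Proof.
have /asboolP[bg Pg fg] := autP g.
apply/asboolP; split=> [|x|k x y].
- by exists g; [exact: aut_invKr | exact: aut_invK].
- by rewrite -Pg aut_invKr.
- by apply: (bij_inj bg); rewrite fg !aut_invKr.
Qed.

Definition aut_one : Aut := MkAut aut_one_subproof.
Definition aut_mul (g h : Aut) : Aut := MkAut (aut_mul_subproof g h).
Definition aut_inv (g : Aut) : Aut := MkAut (aut_inv_subproof g).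

Lemma aut_ext (g h : Aut) : g =1 h -> g = h.
Proof. by move=> gh; apply: val_inj; apply: funext. Qed.

Lemma aut_mulA : associative aut_mul.
Proof. by move=> g h k; apply: aut_ext. Qed.
Lemma aut_mul1g : left_id aut_one aut_mul.
Proof. by move=> g; apply: aut_ext. Qed.
Lemma aut_mulg1 : right_id aut_one aut_mul.
Proof. by move=> g; apply: aut_ext. Qed.
Lemma aut_mulVg : left_inverse aut_one aut_inv aut_mul.
Proof. by move=> g; apply: aut_ext => x; exact: aut_invK. Qed.
Lemma aut_mulgV : right_inverse aut_one aut_inv aut_mul.
Proof. by move=> g; apply: aut_ext => x; exact: aut_invKr. Qed.

HB.instance Definition _ := isGroup.Build Aut
  aut_mulA aut_mul1g aut_mulg1 aut_mulVg aut_mulgV.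

HB.instance Definition _ := Topological.copy Aut
  (initial_topology (aut_fun : Aut -> {ptws M -> discrete_topology M})).

End Aut.

(** * The class C_n and Fraisse limits *)

(* For a tree G of diameter at most n the construction adds nothing, so G is
   its own free completion but not a generalized n-gon.  Such degenerate
   completions are left out as ambient structures: trees of diameter < n still
   occur as substructures of generalized n-gons, while admitting a path
   x_0, ..., x_n as its own completion would make joint embedding fail, because
   f_n(x_0, x_n) = x_n there, whereas f_n(x, y) = x holds for all x, y in a
   generalized n-gon. *)
Definition class_C (n : nat) (A : Ln_struct n) : Prop :=
  exists D : bigraph,
  [/\ generalized_gon n D,
      free_over_finite n D
    & exists B : substructure (Ln_of n D), isomorphic A (sub_struct B)].

Definition homogeneous (n : nat) (M : Ln_struct n) : Prop :=
  forall (A B : substructure M) (h : sub_struct A -> sub_struct B),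
    fin_gen (sub_struct A) -> fin_gen (sub_struct B) -> Ln_iso h ->
    exists g : Aut M, forall x : sub_struct A, g (set_val x) = set_val (h x).

(* Only the finitely generated members of [K] matter for the age. *)
Definition fraisse_limit (n : nat) (K : Ln_struct n -> Prop)
    (M : Ln_struct n) : Prop :=
  [/\ countable [set: M],
      homogeneous M
    & forall A : Ln_struct n, fin_gen A ->
        (K A <-> exists B : substructure M, isomorphic A (sub_struct B))].

(* Main.v *)
Require Import Defs.
From HB Require Import structures.
From mathcomp Require Import all_boot order.
From mathcomp Require Import boolp classical_sets functions cardinality.
From mathcomp Require Import topology function_spaces.
From mathcomp Require Import zify.

(* [Delta] is generated by a finite set, so [Aut Delta] is discrete and only an
   injective homomorphism has to be found.  Start from the star whose leaves
   are the vertices of [Delta], and alternately glue in all finite extensions of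
   finite closed subgraphs and perform one step of the free completion.  Nothing
   is chosen on the way: the vertices of the resulting tower are finite trees
   with leaves in [Delta], so every permutation of the leaves acts on it, and
   this action is faithful.  The tower is a countable polygon which is a union
   of free completions of finite graphs and realizes every finite extension,
   hence a back-and-forth argument against the homogeneity of [Gamma]
   identifies the two.

   The back step needs the following fact: if a free polygon [D] contains a
   closed free subpolygon [A] generated by a finite set, then [D] is free over a
   finite graph [G] such that [A] is free over [A] intersected with [G].  It is
   proved by ranking the vertices of [D], those of [A] by the stages of [A] and
   the others, later, by the stages of [D]; the geodesics that climb above the
   ranks of their ends are then exactly the paths added by the free completion
   of the vertices of minimal rank. *)
Set Implicit Arguments.
Unset Strict Implicit.
Unset Printing Implicit Defensive.

Import Order.POrderTheory Order.TotalTheory Order.NatOrder.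
Import Order.ProdLexiOrder.

Local Open Scope classical_set_scope.

(** The star forgets the edges of [Delta]: the homomorphism restricts an action of all permutations
    of its vertex set, and it is injective because the leaves can be read off. The fixed centre
    makes the star a connected tree, so that free steps bring all distances down to n.

    The bound n recurs because non-backtracking walks shorter than n are determined by their ends
    and visible to the functions of [L_n], while at distance n those functions return their default
    value.

    Freeness is hard to recognise from its definition, which speaks of all pairs at distance n + 1.
    The proof replaces it by a local property of a rank function: a walk shorter than n whose inner
    vertices have constant rank above both ends is an entire added path. This can be checked
    directly for the stages of the tower, where glued extensions create no such walk at all, and for
    the stages of [A] followed by those of [D]. It is strong enough to recover every free step from
    the vertices of minimal rank. *)

Lemma ex_least (P : nat -> Prop) :
  (exists k, P k) -> exists2 k, P k & forall j, j < k -> ~ P j.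
Proof.
move=> exP; have exb : exists k, `[< P k >] by case: exP => k; exists k; apply/asboolP.
case: (ex_minnP exb) => k /asboolP Pk kmin; exists k => // j jk Pj.
by have := kmin j (asboolT Pj); lia.
Qed.

(** * Walks *)

Section Walk.
Variables (V : Type) (e : rel V).
Implicit Types (P S : set V) (g h : nat -> V).

(* Only the values of [g] on [0], ..., [L] matter. *)
Definition walk P g L :=
  (forall i, i <= L -> P (g i)) /\ (forall i, i < L -> e (g i) (g i.+1)).

(* Non-backtracking walks. *)
Definition nbw P g L := walk P g L /\ forall i, i.+1 < L -> g i <> g i.+2.

(* For a bipartite graph this says that it has no cycle of length less than
   [2n]; see [tf_of_no_cycle] and [no_cycle_of_tf]. *)
Definition tf n P :=
  forall g L, 0 < L < n.*2 -> nbw P g L -> g 0 <> g L.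

(* When [P] is a polygon, closed sets are the substructures for [L_n]; see
   [closed_in_Ln] and [Ln_closed_in]. *)
Definition closed_in n P S := S `<=` P /\
  forall g L, L < n -> nbw P g L -> S (g 0) -> S (g L) ->
    forall i, i <= L -> S (g i).

(* [x] and [y] are at distance [n + 1] in [P]. *)
Definition far n P x y := [/\ P x, P y,
  exists g, [/\ walk P g n.+1, g 0 = x & g n.+1 = y]
  & forall g L, walk P g L -> g 0 = x -> g L = y -> n < L].

Definition walk_connected P :=
  forall x y, P x -> P y -> exists g L, [/\ walk P g L, g 0 = x & g L = y].

Lemma walkS P P' g L : P `<=` P' -> walk P g L -> walk P' g L.
Proof. by move=> PP' [Pg eg]; split=> // i /Pg /PP'. Qed.

Lemma nbwS P P' g L : P `<=` P' -> nbw P g L -> nbw P' g L.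
Proof. by move=> PP' [wg ng]; split=> //; exact: walkS wg. Qed.

Lemma walk_in P S g L : walk P g L -> (forall i, i <= L -> S (g i)) ->
  walk S g L.
Proof. by case=> _ eg Sg; split. Qed.

Lemma nbw_in P S g L : nbw P g L -> (forall i, i <= L -> S (g i)) -> nbw S g L.
Proof. by case=> wg ng Sg; split=> //; exact: walk_in wg _. Qed.

Lemma tfS n P P' : P `<=` P' -> tf n P' -> tf n P.
Proof. by move=> PP' tP g L hL /(nbwS PP'); exact: tP. Qed.

Lemma walk_sub P g L a l : walk P g L -> a + l <= L ->
  walk P (fun i => g (a + i)) l.
Proof.
case=> Pg eg al; split=> i il; first by apply: Pg; lia.
by rewrite addnS; apply: eg; lia.
Qed.

Lemma nbw_sub P g L a l : nbw P g L -> a + l <= L ->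
  nbw P (fun i => g (a + i)) l.
Proof.
case=> wg ng al; split; first exact: walk_sub wg _.
by move=> i il; rewrite !addnS; apply: ng; lia.
Qed.

Definition wcat g L h := fun i => if i <= L then g i else h (i - L).

Lemma wcat0 g L h : wcat g L h 0 = g 0.
Proof. by []. Qed.

Lemma wcatE g L h i : g L = h 0 -> wcat g L h (L + i) = h i.
Proof.
rewrite /wcat => gh; case: ifP => h1; last by congr h; lia.
have -> : i = 0 by lia.
by rewrite addn0.
Qed.

Lemma walk_cat P g L h M : walk P g L -> walk P h M -> g L = h 0 ->
  walk P (wcat g L h) (L + M).
Proof.
case=> Pg eg [Ph eh] gh; rewrite /wcat; split=> i iL.
  by case: ifP => ?; [apply: Pg | apply: Ph; lia].
case: (ltngtP i L) => iL'.
- exact: eg.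
- by rewrite subSn ?(ltnW iL') //; apply: eh; lia.
- by rewrite iL' subSnn gh; apply: eh; lia.
Qed.

Lemma nbw_cat P g L h M : nbw P g L -> nbw P h M -> g L = h 0 ->
  (0 < L -> 0 < M -> g L.-1 <> h 1) -> nbw P (wcat g L h) (L + M).
Proof.
case=> wg ng [wh nh] gh nj; split; first exact: walk_cat.
move=> i iL; rewrite /wcat.
case: (ltnP i.+1 L) => iL1; first by rewrite (ltnW (ltnW iL1)); apply: ng.
case: (leqP i L) => iL2; last first.
  have -> : i.+2 - L = (i - L).+2 by lia.
  by apply: nh; lia.
have [iE|iE] : i = L \/ i = L.-1 /\ 0 < L by lia.
  have -> : i.+2 - L = 2 by lia.
  by rewrite iE gh; apply: nh; lia.
have -> : i.+2 - L = 1 by lia.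
by case: iE => -> L0; apply: nj => //; lia.
Qed.

Definition wrev g L := fun i => g (L - i) : V.

Hypothesis eC : symmetric e.

Lemma walk_rev P g L : walk P g L -> walk P (wrev g L) L.
Proof.
case=> Pg eg; split=> i iL; rewrite /wrev; first by apply: Pg; lia.
by rewrite eC (_ : L - i = (L - i.+1).+1); [apply: eg; lia | lia].
Qed.

Lemma nbw_rev P g L : nbw P g L -> nbw P (wrev g L) L.
Proof.
case=> wg ng; split; first exact: walk_rev.
move=> i iL; rewrite /wrev => E; apply: (ng (L - i.+2)); first by lia.
by rewrite -E; congr g; lia.
Qed.

Lemma far_sym n P x y : far n P x y -> far n P y x.
Proof.
case=> Px Py [g [wg g0 gL]] far_xy; split=> //.
  exists (wrev g n.+1); rewrite /wrev subn0 subnn; split=> //.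
  exact: walk_rev.
move=> h L wh h0 hL; apply: (far_xy (wrev h L)); rewrite /wrev ?subn0 ?subnn //.
exact: walk_rev.
Qed.

Lemma connected_retract P Q : P `<=` Q -> walk_connected P ->
  (forall z, Q z -> ~ P z -> exists g L, [/\ walk Q g L, g 0 = z & P (g L)]) ->
  walk_connected Q.
Proof.
move=> PQ cP toP.
have {}toP z : Q z -> exists g L, [/\ walk Q g L, g 0 = z & P (g L)].
  move=> Qz; have [Pz|] := pselect (P z); last exact: toP.
  by exists (fun=> z), 0; split=> //; split.
move=> u v /toP[g [L [wg g0 gL]]] /toP[h [M [wh h0 hM]]].
have [f [N [wf f0 fN]]] := cP _ _ gL hM.
have w1 := walk_cat wg (walkS PQ wf) (esym f0).
have E : wcat g L f (L + N) = wrev h M 0 by rewrite wcatE // /wrev subn0.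
exists (wcat (wcat g L f) (L + N) (wrev h M)), (L + N + M).
rewrite !wcat0 wcatE // /wrev subnn; split=> //.
exact: walk_cat w1 (walk_rev wh) E.
Qed.

(** Cutting out a step back and forth would shorten the walk by two. *)
Lemma min_nbw P g L : walk P g L ->
  (forall h M, walk P h M -> h 0 = g 0 -> h M = g L -> L <= M) -> nbw P g L.
Proof.
move=> wg gmin; split=> // i iL E.
have w1 : walk P g i by apply: (walk_sub (a := 0) wg); lia.
have w2 : walk P (fun j => g (i.+2 + j)) (L - i.+2) by apply: (walk_sub wg); lia.
have E' : g i = (fun j => g (i.+2 + j)) 0 by rewrite addn0.
have := gmin _ _ (walk_cat w1 w2 E'); rewrite wcat0 (wcatE _ E') (subnKC iL).
by move=> /(_ erefl erefl); lia.
Qed.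

Lemma ex_shortest P g L : walk P g L ->
  exists h M, [/\ nbw P h M, M <= L, h 0 = g 0, h M = g L &
    forall h' M', walk P h' M' -> h' 0 = g 0 -> h' M' = g L -> M <= M'].
Proof.
move=> wg.
have [|M [h [wh h0 hM]] Mmin] := @ex_least
  (fun M => exists h, [/\ walk P h M, h 0 = g 0 & h M = g L]).
  by exists L, g.
have {}Mmin h' M' : walk P h' M' -> h' 0 = g 0 -> h' M' = g L -> M <= M'.
  by move=> *; case: leqP => // /Mmin[]; exists h'.
exists h, M; split=> //; last exact: (Mmin g).
by apply: min_nbw => // h' M'; rewrite h0 hM; exact: Mmin.
Qed.

(** The interval runs from the last visit to [S] before [k] to the first one after it. Most proofs
    that a set is closed apply this to a walk assumed to leave the set. *)
Lemma excursion S g L k : S (g 0) -> S (g L) -> k <= L -> ~ S (g k) ->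
  exists a b, [/\ a < k < b, b <= L, S (g a), S (g b) &
    forall i, a < i < b -> ~ S (g i)].
Proof.
move=> S0 SL kL nSk.
have [|d [dk Sd] dmin] := @ex_least (fun d => d <= k /\ S (g (k - d))).
  by exists k; rewrite subnn.
have [|b [kb bL Sb] bmin] := @ex_least (fun b => [/\ k < b, b <= L & S (g b)]).
  exists L; split=> //; rewrite ltn_neqAle kL andbT.
  by apply/eqP => kE; rewrite kE in nSk.
have d0 : 0 < d by case: d Sd {dmin dk} => //; rewrite subn0.
exists (k - d), b; split=> //; first by lia.
move=> i /andP[ai ib] Si; case: (ltngtP i k) => ik.
- apply: (dmin (k - i)); first by lia.
  by rewrite subKn ?(ltnW ik) ?leq_subr.
- by apply: (bmin i) => //; split=> //; lia.
- by rewrite ik in Si.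
Qed.

(** Cut both walks just before they first differ: the reversed rest of one followed by the rest of
    the other is a closed walk. It may backtrack at its base point, the common end, but [tf] forbids
    it all the same. *)
Lemma uniq_nbw n P g L h M : tf n P -> nbw P g L -> nbw P h M ->
  g 0 = h 0 -> g L = h M -> L + M < n.*2 ->
  L = M /\ forall i, i <= L -> g i = h i.
Proof.
move=> tP; wlog LM : g L h M / L <= M.
  move=> W bg bh g0 gL LM; case: (leqP L M) => [|/ltnW] LM'; first exact: W.
  have [] := W h M g L LM' bh bg (esym g0) (esym gL); first by lia.
  by move=> ME gh; split=> // i iL; rewrite gh //; lia.
move=> bg bh g0 gL LM2.
have [E|nE] := pselect (forall i, i <= L -> g i = h i).
  split=> //; apply/eqP; rewrite eqn_leq LM /= leqNgt; apply/negP => LM'.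
  have bh' : nbw P (fun i => h (L + i)) (M - L) by apply: nbw_sub bh _; lia.
  have [] := tP _ (M - L) _ bh'; first by lia.
  by rewrite addn0 subnKC // -E.
have [|d [dL gd] dmin] := @ex_least (fun d => d <= L /\ g d <> h d).
  by apply: contrapT => nex; apply: nE => i iL; apply: contrapT => ?; apply: nex; exists i.
have d0 : 0 < d by case: d gd {dmin dL} => // /(_ g0).
have Ed : g d.-1 = h d.-1.
  by apply: contrapT => ne; apply: (dmin d.-1); [lia | split=> //; lia].
have b1 := nbw_rev (nbw_sub bg (a := d.-1) (l := L - d.-1) ltac:(lia)).
have b2 := nbw_sub bh (a := d.-1) (l := M - d.-1) ltac:(lia).
have [] := tP _ _ _ (nbw_cat b1 b2 _ _).
- by lia.
- by rewrite /wrev subnn addn0.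
- move=> h1 h2; rewrite /wrev addn1 prednK // (_ : d.-1 + _ = d) //; lia.
- rewrite wcat0 wcatE /wrev; last by rewrite subnn addn0.
  by rewrite subn0 !subnKC //; lia.
Qed.

Lemma nbw_inj n P g L i j : tf n P -> nbw P g L -> L < n.*2 -> i < j <= L ->
  g i <> g j.
Proof.
move=> tP bg Ln ij; have := tP _ (j - i) _ (nbw_sub bg (a := i) (l := j - i) _).
by rewrite addn0 subnKC; [apply | ]; lia.
Qed.

Variable side : pred V.
Hypothesis eside : forall x y, e x y -> side x != side y.

Lemma walk_side P g L : walk P g L -> side (g L) = side (g 0) (+) odd L.
Proof.
case=> _; elim: L => [|L IH] eg; first by rewrite addbF.
rewrite /= -[~~ _]addTb addbCA -IH; last by move=> i ?; apply: eg; lia.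
by have := eside (eg L (ltnSn _)); case: (side _) (side _) => -[].
Qed.

Lemma walk_odd P g L P' h M : walk P g L -> walk P' h M -> g 0 = h 0 ->
  g L = h M -> odd L = odd M.
Proof.
move=> /walk_side E /walk_side E' g0 gL; move: E.
by rewrite gL E' g0 => /addbI.
Qed.

(* A shortest closed non-backtracking walk is cyclically non-backtracking, so
   its periodic extension may be re-based at any of its vertices. *)
Lemma tf_periodic n P :
  (forall g L, 2 < L < n.*2 -> ~~ odd L -> (forall i, g (i + L) = g i) ->
     (forall i, P (g i)) -> (forall i, e (g i) (g i.+1)) ->
     (forall i j, i < j < i + L -> g i <> g j) -> False) -> tf n P.
Proof.
move=> H g L; have [m] := ubnP L; elim: m g L => // m IH g L Lm /andP[L0 Ln] bg E.
have sub i j : i < j -> j <= L -> j - i < L -> g i <> g j.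
  move=> ij jL jiL.
  have := IH (fun k => g (i + k)) (j - i) ltac:(lia) ltac:(lia) _.
  by rewrite addn0 subnKC; [apply; apply: (nbw_sub bg); lia | lia].
have inj i j : i < j -> j < L -> g i <> g j by move=> ij jL; apply: sub; lia.
have [[Pg eg] ng] := bg.
have Lodd : ~~ odd L.
  have := walk_side bg.1; rewrite E; case: (odd L) => //.
  by case: (side _).
have L2 : L <> 2 by move=> L2; apply: (ng 0); rewrite ?L2 // E L2.
apply: (H (fun i => g (i %% L)) L) => //; first by lia.
- by move=> i; rewrite modnDr.
- by move=> i; apply: Pg; rewrite ltnW // ltn_pmod.
- move=> i; have iL : i %% L < L by rewrite ltn_pmod.
  suff <- : g (i %% L).+1 = g (i.+1 %% L) by exact: eg.
  case: (ltngtP (i %% L).+1 L) => hi; try lia.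
    by rewrite -[i.+1]addn1 -modnDml addn1 (modn_small hi).
  by rewrite hi -E -[i.+1]addn1 -modnDml addn1 hi modnn.
- move=> i j ij; have iL : i %% L < L by rewrite ltn_pmod.
  have jL : j %% L < L by rewrite ltn_pmod.
  have ne : i %% L != j %% L.
    apply/eqP => ME; have /eqP := esym ME.
    by rewrite eqn_mod_dvd; [move=> /dvdn_leq; lia | lia].
  by case: (ltngtP (i %% L) (j %% L)) ne => // ? _; [|apply/nesym]; apply: inj.
Qed.

End Walk.

(** * Free steps *)

Section PathWalk.
Variables (V : choiceType) (e : rel V).

Lemma path_walk x y p : path_from_to e x y p ->
  exists g, [/\ walk e setT g (size p), g 0 = x, g (size p) = y &
    forall i, g i = nth x (x :: p) i].
Proof.
case=> /(pathP x) ep lp; exists (nth x (x :: p)); split=> //.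
by rewrite -lp (last_nth x).
Qed.

Lemma walk_path g L : walk e setT g L ->
  path_from_to e (g 0) (g L) (mkseq (fun i => g i.+1) L).
Proof.
case=> _ eg; split.
  apply/(pathP (g 0)) => i; rewrite size_mkseq => iL.
  rewrite (nth_mkseq _ _ iL); case: i iL => [|i] iL; first exact: eg.
  by rewrite [nth _ (_ :: _) _]/= nth_mkseq ?eg //; lia.
rewrite (last_nth (g 0)) size_mkseq; case: L {eg} => // L.
by rewrite [nth _ (_ :: _) _]/= nth_mkseq.
Qed.

End PathWalk.

Section Induced.
Variables (V : choiceType) (e : rel V).
Implicit Types (S : set V) (g : nat -> V).

(** A walk of length 0 has no edge to certify that its only vertex lies in [S]; hence the positive
    length. *)
Lemma walk_induced S g L : 0 < L ->
  walk (induced e S) setT g L <-> walk e S g L.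
Proof.
move=> L0; split=> [[_ eg]|[Sg eg]].
  have eg' i : i < L -> [/\ S (g i), S (g i.+1) & e (g i) (g i.+1)].
    by move=> /eg /and3P[/set_mem ? /set_mem].
  split=> i iL; last by have [] := eg' _ iL.
  case: (ltnP i L) => iL'; first by have [] := eg' _ iL'.
  have -> : i = L.-1.+1 by lia.
  by have [] := eg' L.-1 ltac:(lia).
by split=> // i iL; rewrite /induced eg // !mem_set //; apply: Sg; lia.
Qed.

Lemma farE n S x y :
  [/\ S x, S y & has_dist (induced e S) x y n.+1] <-> far e n S x y.
Proof.
split=> [[Sx Sy [p [pp pmin] sp]]|[Sx Sy [g [wg g0 gL]] gmin]].
  split=> //.
    have [g [wg g0 gL _]] := path_walk pp; rewrite sp in wg gL.
    by exists g; split=> //; apply/walk_induced.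
  move=> g [|L] wg g0 gL.
    have := pmin [::]; rewrite /path_from_to -g0 -gL /= sp => /(_ (conj isT erefl)).
    by lia.
  have /walk_path := (walk_induced S g (ltn0Sn L)).2 wg.
  by rewrite g0 gL => /pmin; rewrite size_mkseq sp.
split=> //; exists (mkseq (fun i => g i.+1) n.+1); last by rewrite size_mkseq.
split; first by rewrite -g0 -[X in path_from_to _ _ X]gL; apply: walk_path; apply/walk_induced.
move=> r pr; rewrite size_mkseq; case: r pr => [|z r] pr.
  by case: pr => _ /= xy; apply: (gmin (fun=> x) 0) => //; split.
have [h [wh h0 hL _]] := path_walk pr.
by apply: gmin h0 hL; apply/walk_induced.
Qed.

End Induced.

Section FreeStep.
Variables (V : choiceType) (e : rel V) (side : pred V) (n : nat).
Hypothesis eC : symmetric e.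
Hypothesis eside : forall x y, e x y -> side x != side y.
Hypothesis n_gt2 : 2 < n.
Implicit Types (S P : set V) (g : nat -> V).

Local Notation far := (far e n).
Local Notation nbw := (nbw e).

(** [free_step] with the added paths [q] as a parameter and with distances expressed by walks. *)
Definition fstep S S' (q : V -> V -> nat -> V) :=
  [/\ [/\ forall x y, far S x y -> q x y 0 = x /\ q x y n.-1 = y,
          forall x y k, far S x y -> k <= n.-1 -> q y x k = q x y (n.-1 - k),
          forall x y k, far S x y -> 0 < k < n.-1 -> ~ S (q x y k)
        & forall x y k x' y' k', far S x y -> 0 < k < n.-1 ->
            far S x' y' -> 0 < k' < n.-1 -> q x y k = q x' y' k' ->
            (x', y', k') = (x, y, k) \/ (x', y', k') = (y, x, n.-1 - k)],
      forall z, S' z <-> S z \/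
        exists x y k, [/\ far S x y, 0 < k < n.-1 & z = q x y k]
    & forall u v, S' u -> S' v ->
        (e u v <->
         [/\ S u, S v & e u v] \/
         exists x y k, [/\ far S x y, k < n.-1, u = q x y k & v = q x y k.+1])].

Lemma free_stepP S S' : free_step n e S S' <-> exists q, fstep S S' q.
Proof.
split=> -[q [[q1 q2 q3 q4] S'E eE]]; exists q.
  split; first split.
  - by move=> x y /farE; exact: q1.
  - by move=> x y k /farE; exact: q2.
  - by move=> x y k /farE fxy k0; apply: q3.
  - by move=> x y k x' y' k' /farE f1 k0 /farE f2 k0'; apply: q4.
  - move=> z; rewrite S'E; split=> -[Sz|[x [y [k h]]]]; [by left| |by left|].
      by case: h => -[/farE f1 f2] f3; right; exists x, y, k.
    by case: h => /farE f1 f2 f3; right; exists x, y, k.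
  - move=> u v Su Sv; apply: (iff_trans (eE u v Su Sv)).
    by split=> -[|[x [y [k [/farE f1 f2 f3 f4]]]]]; by [left | right; exists x, y, k].
split; first split.
- by move=> x y /farE; exact: q1.
- by move=> x y k /farE; exact: q2.
- by move=> x y k [/farE fxy k0]; apply: q3.
- by move=> x y k x' y' k' [/farE f1 k0] [/farE f2 k0']; apply: q4.
- rewrite eqEsubset; split=> z /=; rewrite S'E => -[Sz|[x [y [k h]]]]; [by left| |by left|].
    by case: h => /farE f1 f2 f3; right; exists x, y, k.
  by case: h => -[/farE f1 f2] f3; right; exists x, y, k.
- move=> u v Su Sv; apply: (iff_trans (eE u v Su Sv)).
  by split=> -[|[x [y [k [/farE f1 f2 f3 f4]]]]]; by [left | right; exists x, y, k].
Qed.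

Lemma far_neq S x y : far S x y -> x <> y.
Proof.
case=> Sx Sy _ fxy E; suff : n < 0 by [].
by apply: (fxy (fun=> x)) => //; split.
Qed.

Section Step.
Variables (S S' : set V) (q : V -> V -> nat -> V).
Hypothesis Sq : fstep S S' q.

Lemma fstep_sub : S `<=` S'.
Proof. by case: Sq => _ S'E _ z Sz; apply/S'E; left. Qed.

Lemma fstep_q0 x y : far S x y -> q x y 0 = x.
Proof. by case: Sq => -[q1 _ _ _] _ _ /q1[]. Qed.

Lemma fstep_qL x y : far S x y -> q x y n.-1 = y.
Proof. by case: Sq => -[q1 _ _ _] _ _ /q1[]. Qed.

Lemma fstep_new x y k : far S x y -> 0 < k < n.-1 -> ~ S (q x y k).
Proof. by case: Sq => -[_ _ + _] _ _; exact. Qed.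

Lemma fstep_in x y k : far S x y -> k <= n.-1 -> S' (q x y k).
Proof.
move=> fxy kn; have [-> |k0] := posnP k.
  by rewrite fstep_q0 //; apply: fstep_sub; case: fxy.
move: kn; rewrite leq_eqVlt => /predU1P[->|kn].
  by rewrite fstep_qL //; apply: fstep_sub; case: fxy.
by case: Sq => _ S'E _; apply/S'E; right; exists x, y, k; rewrite k0 kn.
Qed.

Lemma fstep_nbw x y : far S x y -> nbw S' (q x y) n.-1.
Proof.
move=> fxy; split; first split.
- by move=> i; exact: fstep_in.
- move=> i iL; have [_ _ eE] := Sq; apply/eE; [apply: fstep_in => //; lia..|].
  by right; exists x, y, i.
move=> i iL; have [-> |i0] := posnP i.
  (* For n = 3 the vertices two steps apart are the two ends of the path, which are distinct but
     both old. *)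
  rewrite fstep_q0 //; have [L2|L2] : 2 = n.-1 \/ 2 < n.-1 by lia.
    by rewrite L2 fstep_qL //; exact: far_neq fxy.
  by move=> E; apply: (fstep_new (k := 2) fxy) => //; rewrite -E; case: fxy.
have [E|lt] : i.+2 = n.-1 \/ i.+2 < n.-1 by lia.
  move=> E'; apply: (@fstep_new x y i) => //; first by lia.
  by rewrite E' E fstep_qL //; case: fxy.
have [[_ _ _ qi] _ _] := Sq.
have hi : 0 < i < n.-1 by lia.
have hi2 : 0 < i.+2 < n.-1 by lia.
move=> /(qi _ _ _ _ _ _ fxy hi fxy hi2)[[]|[xy _ _]]; first by lia.
by move: fxy => /far_neq; apply.
Qed.

Lemma fstep_nbr x y k w : far S x y -> 0 < k < n.-1 -> S' w ->
  e (q x y k) w -> w = q x y k.-1 \/ w = q x y k.+1.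
Proof.
move=> fxy k0 Sw; have [[q1 q2 q3 qi] S'E eE] := Sq.
rewrite eE //; last by apply: fstep_in => //; lia.
case=> [[/(q3 _ _ _ fxy k0)]//|[x' [y' [k' [fxy' kn' E ->]]]]].
have k0' : 0 < k'.
  case: k' kn' E => // _ E; case: (q3 _ _ _ fxy k0).
  by rewrite E (q1 _ _ fxy').1; case: fxy'.
have {}kn' : 0 < k' < n.-1 by rewrite k0'.
have [[-> -> ->]|[-> -> ->]] := qi _ _ _ _ _ _ fxy k0 fxy' kn' E.
  by right.
by left; rewrite q2 //; [congr q|]; lia.
Qed.

Lemma fstep_newP z : S' z -> ~ S z ->
  exists x y k, [/\ far S x y, 0 < k < n.-1 & z = q x y k].
Proof. by case: Sq => _ S'E _ /S'E[]. Qed.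

(** Inner vertices of an added path have only two neighbours, so a non-backtracking walk that has
    entered the path must go on towards its far end. *)
Lemma fstep_follow g L x y k : nbw S' g L -> far S x y -> k < n.-1 ->
  g 0 = q x y k -> g 1 = q x y k.+1 ->
  forall j, j <= L -> k + j <= n.-1 -> g j = q x y (k + j).
Proof.
move=> bg fxy kn g0 g1.
elim/ltn_ind=> -[|[|j]] IH jL jn; rewrite ?addn0 ?addn1 //.
have gj := IH j.+1 ltac:(lia) ltac:(lia) ltac:(lia).
have gj' := IH j ltac:(lia) ltac:(lia) ltac:(lia).
have [[Sg eg] ng] := bg.
have := eg j.+1 jL; rewrite gj => /(fstep_nbr (k := k + j.+1) fxy ltac:(lia) (Sg _ jL)) [E|-> //].
  by case: (ng j) => //; rewrite gj' E; congr q; lia.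
by congr q; lia.
Qed.

(* Only interior vertices of one new path may occur between two old ones. *)
Lemma fstep_excursion g L : nbw S' g L -> 1 < L -> S (g 0) -> S (g L) ->
  (forall i, 0 < i < L -> ~ S (g i)) ->
  L = n.-1 /\ exists x y, far S x y /\ forall k, k <= n.-1 -> g k = q x y k.
Proof.
move=> bg L1 S0 SL Sn; have [[Sg eg] _] := bg.
have [x [y [fxy g0 g1]]] : exists x y,
    [/\ far S x y, g 0 = q x y 0 & g 1 = q x y 1].
  have [x [y [k [fxy k0 g1]]]] := fstep_newP (Sg 1 (ltnW L1)) (Sn 1 L1).
  have qlow j : 0 < j < n.-1 -> g 0 <> q x y j.
    by move=> jn E; apply: (fstep_new fxy jn); rewrite -E.
  have := eg 0 ltac:(lia); rewrite g1 eC => /(fstep_nbr fxy k0 (Sg 0 isT)) [] g0.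
    have k1 : k = 1 by apply: contrapT => ?; apply: (qlow k.-1) => //; lia.
    by exists x, y; split=> //; [rewrite g0 k1|rewrite k1].
  have kn : k.+1 = n.-1 by apply: contrapT => ?; apply: (qlow k.+1) => //; lia.
  have [[_ q2 _ _] _ _] := Sq.
  exists y, x; split; first exact: far_sym.
    by rewrite g0 (q2 x y 0) // kn subn0.
  by rewrite (q2 x y 1) //; [congr q|]; lia.
have fol := fstep_follow (k := 0) bg fxy ltac:(lia) g0 g1.
have E : L = n.-1.
  case: (ltngtP L n.-1) => // Ln.
    have := fol L (leqnn _) (ltnW Ln); rewrite add0n => E.
    by case: (fstep_new (k := L) fxy ltac:(lia)); rewrite -E.
  have := fol n.-1 (ltnW Ln) (leqnn _); rewrite add0n fstep_qL // => E.
  by case: (Sn n.-1 ltac:(lia)); rewrite E; case: fxy.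
by split=> //; exists x, y; split=> // k kn; apply: fol; lia.
Qed.

(** A short cycle neither lies in [S] nor avoids [S], so it contains a whole added path, of length n
    - 1. The rest is shorter than n + 1, the distance of the two ends in [S], so it contains an
    added path as well. The two paths fill the cycle and join the same pair, hence coincide. *)
Lemma fstep_tf : tf e n S -> tf e n S'.
Proof.
move=> tS; apply: (tf_periodic eside) => g L /andP[L2 Ln] Lodd gL Sg eg ginj.
have bsh a M : nbw S' (fun i => g (a + i)) M.
  split; first by split=> i _; rewrite ?addnS.
  by move=> i _; rewrite !addnS; apply: ginj; lia.
have [|] := pselect (exists a, S (g a)); last first.
  (* A cycle avoiding [S] would follow an added path up to its end, which lies in [S]. *)
  move=> nS; have nSg a : ~ S (g a) by move=> Sa; apply: nS; exists a.
  have [x [y [k [fxy k0 g1]]]] := fstep_newP (Sg 1) (nSg 1).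
  have k1 u v a j : far S u v -> g a = q u v j.-1 -> g a.+1 = q u v j ->
      0 < j <= n.-1 -> False.
    move=> fuv ga ga1 jn; apply: (nSg (a + (n - j))).
    have -> := @fstep_follow (fun i => g (a + i)) (n - j) u v j.-1
      (bsh _ _) fuv; rewrite ?addn0 ?addn1 ?prednK //; try lia.
    rewrite (_ : _ + _ = n.-1); last by lia.
    by rewrite fstep_qL //; case: fuv.
  have [[_ q2 _ _] _ _] := Sq.
  have := eg 0; rewrite eC g1 => /(fstep_nbr fxy k0 (Sg 0)) [] g0.
    by apply: (k1 _ _ 0 k fxy g0 g1); lia.
  have := eg 1; rewrite g1 => /(fstep_nbr fxy k0 (Sg 2)) [] g2; last first.
    by apply: (ginj 0 2); rewrite ?g0 ?g2 //; lia.
  apply: (k1 y x 1 (n - k)); first exact: far_sym.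
  - by rewrite g1 (q2 x y) //; [congr q|]; lia.
  - by rewrite g2 (q2 x y) //; [congr q|]; lia.
  - by lia.
move=> [a Sa].
have [|/existsNP[k]] := pselect (forall k, k <= L -> S (g (a + k))).
  move=> aS; apply: (tS _ L _ (nbw_in (bsh a L) aS)); first by lia.
  by rewrite addn0 gL.
move=> /not_implyP[kL nSk].
have Sa0 : S (g (a + 0)) by rewrite addn0.
have SaL : S (g (a + L)) by rewrite gL.
have [a' [b [ab bL Sa' Sb Sab]]] := excursion (S := S) (g := fun i => g (a + i)) Sa0 SaL kL nSk.
have exc c d : S (g c) -> S (g (c + d)) -> (forall i, 0 < i < d -> ~ S (g (c + i))) ->
    1 < d -> d = n.-1 /\ exists x y, far S x y /\ forall k, k <= n.-1 -> g (c + k) = q x y k.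
  by move=> Sc Sd Scd d1; apply: fstep_excursion (bsh _ _) d1 _ Sd Scd; rewrite addn0.
pose c := a + a'.
have [E [x [y [fxy gq]]]] := exc c (b - a') Sa'
  ltac:(by rewrite (_ : c + _ = a + b) // /c; lia)
  ltac:(by move=> i hi; rewrite -addnA; apply: Sab; lia) ltac:(lia).
have gc : g c = x by rewrite -(addn0 c) gq // fstep_q0.
have gcn : g (c + n.-1) = y by rewrite gq // fstep_qL.
have [Sx Sy _ fmin] := fxy.
have [aS|/existsNP[j]] := pselect (forall j, j <= L - n.-1 -> S (g (c + n.-1 + j))).
  have := fmin _ _ (walk_rev eC (walk_in (bsh (c + n.-1) (L - n.-1)).1 aS)).
  rewrite /wrev subnn subn0 addn0 gcn -addnA subnKC ?gL ?gc; last by lia.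
  by move=> /(_ erefl erefl); lia.
move=> /not_implyP[jL nSj].
have [|/= |a1 [b1 [ab1 bL1 Sa1 Sb1 Sab1]]] := excursion (S := S)
  (g := fun i => g (c + n.-1 + i)) _ _ jL nSj.
- by rewrite addn0 gcn.
- by rewrite -addnA subnKC ?gL ?gc //; lia.
have [E1 [x1 [y1 [fxy1 gq1]]]] := exc (c + n.-1 + a1) (b1 - a1) Sa1
  ltac:(by rewrite -addnA subnKC //; lia)
  ltac:(by move=> i hi; rewrite -addnA; apply: Sab1; lia) ltac:(lia).
(* The length is even and below 2n, so two excursions of length n - 1 leave no room for further
   edges. *)
have a10 : a1 = 0 by lia.
have LE : L = n.-1 + n.-1 by lia.
rewrite a10 addn0 in gq1.
have x1E : x1 = y by rewrite -gcn -(addn0 (c + _)) gq1 // fstep_q0.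
have y1E : y1 = x by rewrite -gc -gL LE addnA gq1 // fstep_qL.
have [[_ q2 _ _] _ _] := Sq.
apply: (ginj (c + 1) (c + n.-1 + n.-2)); first by lia.
have n1 : 1 <= n.-1 by lia.
have n2 : n.-2 <= n.-1 by lia.
rewrite (gq 1 n1) (gq1 _ n2) x1E y1E (q2 x y _ fxy n2); congr q.
by lia.
Qed.

(** Distances are measured in [S], not in [A]: no path is created that the step from [S] does not
    add. *)
Definition fstep_on A := [set z | A z \/
  exists x y k, [/\ far S x y, A x /\ A y, 0 < k < n.-1 & z = q x y k]].

Lemma fstep_on_sub A : A `<=` fstep_on A.
Proof. by move=> z Az; left. Qed.

Lemma fstep_onS : fstep_on S = S'.
Proof.
have [_ S'E _] := Sq; rewrite eqEsubset; split=> z.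
  by case=> [Sz|[x [y [k [fxy [Sx Sy] k0 ->]]]]]; apply/S'E; [left | right; exists x, y, k].
case/S'E => [Sz|[x [y [k [fxy k0 ->]]]]]; [by left | right].
by exists x, y, k; split=> //; case: fxy.
Qed.

Lemma fstep_on_subS A : A `<=` S -> fstep_on A `<=` S'.
Proof.
move=> AS z [/AS /fstep_sub//|[x [y [k [fxy _ kn ->]]]]].
by apply: fstep_in => //; lia.
Qed.

Lemma fstep_on_q A x y k : far S x y -> A x -> A y -> k <= n.-1 ->
  fstep_on A (q x y k).
Proof.
move=> fxy Ax Ay kn; have [->|k0] := posnP k; first by rewrite fstep_q0 //; left.
move: kn; rewrite leq_eqVlt => /predU1P[->|kn]; first by rewrite fstep_qL //; left.
by right; exists x, y, k; rewrite k0 kn.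
Qed.

Lemma fstep_on_finite A : finite_set A -> finite_set (fstep_on A).
Proof.
move=> fA; pose f (t : V * V * nat) := q t.1.1 t.1.2 t.2.
apply: (@sub_finite_set _ _ (A `|` f @` (A `*` A `*` `I_n))).
  move=> z [Az|[x [y [k [fxy [Ax Ay] kn ->]]]]]; [by left | right].
  by exists (x, y, k) => //; split=> //=; lia.
rewrite finite_setU; split=> //; apply: finite_image.
by apply: finite_setX; [exact: finite_setX | exact: finite_II].
Qed.

Lemma fstep_on_connected A : A `<=` S -> walk_connected e A -> walk_connected e (fstep_on A).
Proof.
move=> AS cA; apply: (connected_retract eC (@fstep_on_sub A) cA) => z.
case=> [//|[x [y [k [fxy [Ax Ay] kn ->]]]]] _.
exists (wrev (q x y) k), k; rewrite /wrev subn0 subnn fstep_q0 //.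
split=> //; apply: (walk_rev eC); have [[_ eq] _] := fstep_nbw fxy.
by split=> i ik; [apply: fstep_on_q => //; lia | apply: eq; lia].
Qed.

(** An excursion starts and ends in [A], as inner vertices of the paths over [A] have no neighbours
    elsewhere. If it stays in [S] it contradicts the closedness of [A]; otherwise it contains an
    added path, whose length n - 1 leaves room for nothing else, so that path has its ends in
    [A]. *)
Lemma fstep_on_closed A : closed_in e n S A -> closed_in e n S' (fstep_on A).
Proof.
move=> [AS cA]; split; first exact: fstep_on_subS.
move=> g L Ln bg A0 AL k kL; apply: contrapT => nAk.
have [a [b [ab bL Aa Ab nAab]]] := excursion A0 AL kL nAk.
have [[Sg eg] ng] := bg.
have inA c d : fstep_on A (g c) -> e (g c) (g d) -> S' (g d) -> ~ fstep_on A (g d) ->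
    A (g c).
  case=> // -[x [y [j [fxy [Ax Ay] jn ->]]]] ecd Sd nAd.
  by case: nAd; case: (fstep_nbr fxy jn Sd ecd) => ->; apply: fstep_on_q => //; lia.
have {}Aa : A (g a) by apply: (inA a a.+1) => //; [apply: eg|apply: Sg|apply: nAab]; lia.
have {}Ab : A (g b).
  apply: (inA b b.-1) => //; [|by apply: Sg; lia | by apply: nAab; lia].
  by rewrite eC -{2}(prednK (n := b)); [apply: eg|]; lia.
have bab := nbw_sub bg (a := a) (l := b - a) ltac:(lia).
have [aS|/existsNP[j /not_implyP[jL nSj]]] :=
    pselect (forall j, j <= b - a -> S (g (a + j))).
  have := cA _ _ _ (nbw_in bab aS) _ _ (k - a); rewrite addn0 subnKC; last by lia.
  rewrite subnKC; last by lia.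
  by move=> /(_ ltac:(lia) Aa Ab ltac:(lia)) Ak; apply: nAk; left.
have [||a1 [b1 [ab1 bL1 Sa1 Sb1 Sab1]]] :=
  excursion (S := S) (g := fun i => g (a + i)) _ _ jL nSj.
- by rewrite addn0; apply: AS.
- by rewrite subnKC; [apply: AS | lia].
have [E [x [y [fxy gq]]]] := fstep_excursion
  (nbw_sub bab (a := a1) (l := b1 - a1) ltac:(lia)) ltac:(lia)
  ltac:(by rewrite /= ?addn0) ltac:(by rewrite /= subnKC //; lia)
  ltac:(by move=> i hi; apply: Sab1; lia).
have a0 : a = 0 by lia.
have a10 : a1 = 0 by lia.
have bE : b = n.-1 by lia.
subst a a1 b; rewrite /= in gq.
apply: nAk; have -> : g k = q x y k by rewrite -gq; [rewrite !add0n|lia].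
apply: fstep_on_q => //; last by lia.
  by rewrite -(fstep_q0 fxy) -gq.
by rewrite -(fstep_qL fxy) -gq.
Qed.

End Step.

(* Distances above [n] shrink along a chain that joins the pairs at distance
   [n + 1] by shorter paths. *)
Lemma contract (F : nat -> set V) : (forall i j, i <= j -> F i `<=` F j) ->
  (forall j x y, far (F j) x y ->
    exists w, [/\ walk e (F j.+1) w n.-1, w 0 = x & w n.-1 = y]) ->
  forall j g L, walk e (F j) g L -> exists j' h M,
    [/\ j <= j', walk e (F j') h M, M <= n, h 0 = g 0 & h M = g L].
Proof.
move=> Fm Ff j g L; elim/ltn_ind: L j g => L IH j g wg.
have [f [N [bf NL f0 fN fmin]]] := ex_shortest wg.
have [Nn|nN] := leqP N n; first by exists j, f, N; split=> //; exact: bf.1.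
have wf2 : walk e (F j) (fun i => f (n.+1 + i)) (N - n.+1).
  by apply: walk_sub bf.1 _; lia.
have fa : far (F j) (f 0) (f n.+1).
  have [[Ff' _] _] := bf; split; [apply: Ff' | apply: Ff' | |]; try lia.
    by exists f; split=> //; apply: (walk_sub (a := 0) bf.1); lia.
  move=> u K wu u0 uK; rewrite ltnNge; apply/negP => Kn.
  have E' : u K = (fun i => f (n.+1 + i)) 0 by rewrite addn0.
  have := fmin _ _ (walk_cat wu wf2 E'); rewrite wcat0 wcatE // subnKC //.
  by rewrite u0 f0 fN => /(_ erefl erefl); lia.
have [w [ww w0 wn]] := Ff _ _ _ fa.
have E' : w n.-1 = (fun i => f (n.+1 + i)) 0 by rewrite wn addn0.
have wc := walk_cat ww (walkS (Fm _ _ (leqnSn j)) wf2) E'.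
have [|j' [h' [M' [jj' wh' Mn h0' hM']]]] := IH _ _ j.+1 _ wc; first by lia.
rewrite wcat0 w0 f0 in h0'; rewrite wcatE // subnKC // fN in hM'.
by exists j', h', M'; split=> //; lia.
Qed.

End FreeStep.

Section Stages.
Variables (V : choiceType) (e : rel V) (n : nat).
Hypothesis eC : symmetric e.
Hypothesis n_gt2 : 2 < n.
Variables (F : nat -> set V) (q : nat -> V -> V -> nat -> V).
Hypothesis Fq : forall j, fstep e n (F j) (F j.+1) (q j).

Lemma stages_mono i j : i <= j -> F i `<=` F j.
Proof.
elim: j => [|j IH]; first by rewrite leqn0 => /eqP ->.
rewrite leq_eqVlt ltnS => /predU1P[->//|/IH ij] z /ij.
exact: fstep_sub (Fq j) z.
Qed.

Lemma stages_finite j : finite_set (F 0) -> finite_set (F j).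
Proof.
move=> f0; elim: j => // j IH; rewrite -(fstep_onS (Fq j)).
exact: fstep_on_finite.
Qed.

Lemma stages_connected j : walk_connected e (F 0) -> walk_connected e (F j).
Proof.
move=> c0; elim: j => // j IH; rewrite -(fstep_onS (Fq j)).
exact: (fstep_on_connected eC n_gt2 (Fq j)).
Qed.

(** Added paths have length n - 1, so a closed set that contains their ends contains them. *)
Lemma stages_min W C : closed_in e n W C -> (forall j, F j `<=` W) ->
  F 0 `<=` C -> \bigcup_j F j `<=` C.
Proof.
move=> [CW cC] FW FC z [j _]; elim: j z => [|j IH] z; first exact: FC.
move=> Fz; have [Fjz|nFz] := pselect (F j z); first exact: IH.
have [x [y [k [fxy kn ->]]]] := fstep_newP (Fq j) Fz nFz.
have bq := nbwS (FW j.+1) (fstep_nbw n_gt2 (Fq j) fxy).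
have [Fx Fy _ _] := fxy.
apply: (cC _ _ _ bq); [lia | | | lia].
  by rewrite (fstep_q0 (Fq j) fxy); exact: IH.
by rewrite (fstep_qL (Fq j) fxy); exact: IH.
Qed.

End Stages.

(** * Tame extensions *)

Section Tame.
Variables (V : choiceType) (e : rel V) (side : pred V) (n : nat).
Hypothesis eC : symmetric e.
Hypothesis eside : forall x y, e x y -> side x != side y.
Hypothesis n_gt2 : 2 < n.
Variable W : set V.
Hypothesis eW : forall x y, e x y -> W x.
Hypothesis tfW : tf e n W.
Hypothesis diamW : forall x y, W x -> W y ->
  exists g L, [/\ walk e W g L, g 0 = x, g L = y & L <= n].
Variables (d : Order.disp_t) (T : orderType d) (r : V -> T).
Implicit Types (S B F Y : set V) (g : nat -> V).

Local Notation nbw := (nbw e).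
Local Notation "x <=r y" := (Order.le (r x) (r y)) (at level 70).
Local Notation "x <r y" := (Order.lt (r x) (r y)) (at level 70).

(** An added path as seen by the rank alone. The last clause replaces the fact that inner vertices
    have two neighbours: further neighbours are allowed if they have larger rank, that is, if they
    come later. *)
Definition arc g := [/\ nbw W g n.-1,
  forall i, 0 < i < n.-1 -> r (g i) = r (g 1),
  g 0 <r g 1, g n.-1 <r g 1 &
  forall k w, 0 < k < n.-1 -> e (g k) w -> w <=r g 1 ->
    w = g k.-1 \/ w = g k.+1].

(* Every short excursion above the ranks of its two ends is an arc. *)
Definition tame B := [/\ B `<=` W,
  forall x y, B x -> x <=r y,
  forall x y, B x -> ~ B y -> W y -> x <r y &
  forall g L, 1 < L < n -> nbw W g L ->
    (forall i, 0 < i < L -> r (g i) = r (g 1)) -> g 0 <r g 1 -> g L <r g 1 ->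
    L = n.-1 /\ arc g].

Lemma arc_rev g : arc g -> arc (wrev g n.-1).
Proof.
case=> bg rg g0 gL gn; have E : r (wrev g n.-1 1) = r (g 1).
  by apply: rg; lia.
split.
- exact: nbw_rev.
- by move=> i hi; rewrite E; apply: rg; lia.
- by rewrite E /wrev subn0.
- by rewrite E /wrev subnn.
move=> k w kn ew; rewrite E => rw; have [|E'|E'] := gn (n.-1 - k) w _ ew rw.
- by lia.
- by right; rewrite E' /wrev; congr g; lia.
- by left; rewrite E' /wrev; congr g; lia.
Qed.

Lemma arc_ltn g i : arc g -> i <= n.-1 -> (g i <r g 1) -> i = 0 \/ i = n.-1.
Proof.
move=> [_ rg _ _ _] iL; have [->|i0] := posnP i; first by left.
move: iL; rewrite leq_eqVlt => /predU1P[->|iL]; first by right.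
by rewrite rg ?ltxx // i0.
Qed.

Lemma arc_forward g h k l : arc g -> arc h -> 0 < k < n.-1 -> 0 < l < n.-1 ->
  g k = h l -> g k.+1 = h l.+1 ->
  k = l /\ forall i, k <= i <= n.-1 -> g i = h i.
Proof.
move=> ag ah kn ln gh gh1.
wlog kl : g h k l ag ah kn ln gh gh1 / l <= k.
  move=> H; case: (leqP l k) => [|/ltnW] kl; first exact: H.
  have [E H'] := H h g l k ah ag ln kn (esym gh) (esym gh1) kl.
  by split=> // i ik; rewrite H' //; lia.
have [[[Wg eg] ng] rg g0 gL gn] := ag; have [[[Wh eh] nh] rh h0 hL hn] := ah.
have rE : r (g 1) = r (h 1) by rewrite -(rg k kn) -(rh l ln) gh.
have fol i : k + i <= n.-1 -> g (k + i) = h (l + i).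
  elim/ltn_ind: i => -[|[|i]] IH iL; rewrite ?addn0 ?addn1 //.
  have gi := IH i.+1 ltac:(lia) ltac:(lia).
  have gi' := IH i ltac:(lia) ltac:(lia).
  have ee : e (h (l + i.+1)) (g (k + i.+2)).
    by rewrite -gi !addnS; apply: eg; lia.
  have [||E|E] := hn (l + i.+1) _ _ ee.
  - by lia.
  - rewrite -rE; move: iL; rewrite leq_eqVlt => /predU1P[->|iL].
      exact: ltW.
    by rewrite rg ?lexx //; lia.
  - case: (ng (k + i)); first by lia.
    by rewrite gi' -!addnS E; congr h; lia.
  - by rewrite E; congr h; lia.
(* The end of [g] lies below the inner rank, hence is an end of [h]; its index on [h] is positive,
   so it is the last one. *)
have kE : k = l.
  have E : g n.-1 = h (l + (n.-1 - k)) by rewrite -fol ?subnKC //; lia.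
  have := gL; rewrite E rE => /(arc_ltn ah) []; lia.
split=> // i /andP[ki iL]; have := fol (i - k); rewrite -kE subnKC //.
by apply.
Qed.

(** This yields the uniqueness of descriptions that a free step demands of its new vertices. *)
Lemma arc_eq g h k l : arc g -> arc h -> 0 < k < n.-1 -> 0 < l < n.-1 ->
  g k = h l ->
  (k = l /\ forall i, i <= n.-1 -> g i = h i) \/
  (k = n.-1 - l /\ forall i, i <= n.-1 -> g i = h (n.-1 - i)).
Proof.
move=> ag ah kn ln gh.
have half h' l' : arc h' -> 0 < l' < n.-1 -> g k = h' l' -> g k.+1 = h' l'.+1 ->
    k = l' /\ forall i, i <= n.-1 -> g i = h' i.
  move=> ah' ln' gh' gh1; have [E fw] := arc_forward ag ah' kn ln' gh' gh1.
  split=> // i iL; have [|ik] := leqP k i; first by move=> ?; apply: fw; lia.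
  have [[[Wg eg] ng] rg _ _ _] := ag; have [[[Wh eh] nh] rh _ _ hn] := ah'.
  have rE : r (g 1) = r (h' 1) by rewrite -(rg k kn) -(rh l' ln') gh'.
  have gk1 : g k.-1 = h' l'.-1.
    have ee : e (h' l') (g k.-1).
      by rewrite -gh' eC -{2}(prednK (n := k)); [apply: eg|]; lia.
    have [] := hn l' _ ln' ee; rewrite -?rE //.
      have [->|k1] := posnP k.-1; first by apply: ltW; case: ag.
      by rewrite rg ?lexx //; lia.
    move=> E'; case: (ng k.-1); first by lia.
    by rewrite E' -gh1; congr g; lia.
  have [||||_ bw] := @arc_forward (wrev g n.-1) (wrev h' n.-1) (n.-1 - k) (n.-1 - l')
    (arc_rev ag) (arc_rev ah').
  - by lia.
  - by lia.
  - by rewrite /wrev !subKn //; lia.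
  - rewrite /wrev (_ : _ - _ = k.-1); last by lia.
    by rewrite (_ : _ - _ = l'.-1) //; lia.
  by have := bw (n.-1 - i); rewrite /wrev !subKn //; apply; lia.
have [[[Wg eg] ng] rg g0 gL _] := ag; have [[[Wh eh] nh] rh _ _ hn] := ah.
have rE : r (g 1) = r (h 1) by rewrite -(rg k kn) -(rh l ln) gh.
have ee : e (h l) (g k.+1) by rewrite -gh; apply: eg; lia.
have [|gk1|gk1] := hn l _ ln ee; last by left; exact: half.
  rewrite -rE; have [->|k1] : k.+1 = n.-1 \/ k.+1 < n.-1 by lia.
    exact: ltW.
  by rewrite rg ?lexx.
right; have [|||-> E] := half (wrev h n.-1) (n.-1 - l) (arc_rev ah).
- by lia.
- by rewrite /wrev subKn //; lia.
- by rewrite /wrev gk1; congr h; lia.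
- by split=> // i /E.
Qed.

Section Base.
Variable B : set V.
Hypothesis tB : tame B.

Definition arcful Y := forall z, Y z -> ~ B z ->
  exists g k, [/\ arc g, 0 < k < n.-1, g k = z & forall i, i <= n.-1 -> Y (g i)].

Definition good Y := [/\ B `<=` Y, Y `<=` W & arcful Y].

Lemma good_setU Y : Y `<=` W -> arcful Y -> good (Y `|` B).
Proof.
move=> YW aY; have [BW _ _ _] := tB; split; first by move=> z; right.
  by move=> z [/YW|/BW].
by move=> z [/aY h|//] /h [g [k [ag kn gk Yg]]]; exists g, k; split=> // i /Yg; left.
Qed.

(** An inner vertex of an arc reaches vertices of no larger rank only along the arc, and the base is
    below everything else. *)
Lemma good_nbr Y x w : good Y -> Y x -> ~ Y w -> e x w -> x <r w.
Proof.
case=> BY YW aY Yx nYw exw; have [Bx|nBx] := pselect (B x).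
  have [_ _ + _] := tB; apply=> //; first by move=> /BY.
  by apply: (eW (y := x)); rewrite eC.
have [g [k [ag kn gk Yg]]] := aY _ Yx nBx.
rewrite ltNge; apply/negP => rw; have [_ rg _ _ gn] := ag.
subst x; rewrite rg // in rw.
by case: (gn _ _ kn exw rw) => E; apply: nYw; rewrite E; apply: Yg; lia.
Qed.

Lemma ex_max g L : exists2 m, m <= L & forall i, i <= L -> g i <=r g m.
Proof.
elim: L => [|L [m mL mmax]].
  by exists 0 => // i; rewrite leqn0 => /eqP ->; rewrite lexx.
have [h|h] := leP (r (g L.+1)) (r (g m)).
  exists m; first by lia.
  by move=> i; rewrite leq_eqVlt ltnS => /predU1P[->|/mmax].
exists L.+1 => // i; rewrite leq_eqVlt ltnS => /predU1P[->|/mmax iL].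
  exact: lexx.
exact: le_trans iL (ltW h).
Qed.

(** The rank rises when the walk leaves [Y] at either end, so the maximal rank is attained on a
    stretch between two lower vertices. By tameness that stretch is an arc; having length n - 1, it
    fills the walk. *)
Lemma good_excursion Y g L : good Y -> 1 < L < n -> nbw W g L ->
  Y (g 0) -> Y (g L) -> (forall i, 0 < i < L -> ~ Y (g i)) ->
  L = n.-1 /\ arc g.
Proof.
move=> gY L1 bg Y0 YL nY; have [[Wg eg] _] := bg.
have [m mL mmax] := ex_max g L.
have r0 : g 0 <r g m.
  apply: (@lt_le_trans _ _ (r (g 1))); last by apply: mmax; lia.
  by apply: (good_nbr gY) => //; [apply: nY | apply: eg]; lia.
have rL : g L <r g m.
  apply: (@lt_le_trans _ _ (r (g L.-1))); last by apply: mmax; lia.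
  apply: (good_nbr gY) => //; first by apply: nY; lia.
  by rewrite eC -{2}(prednK (n := L)); [apply: eg|]; lia.
have [|a [b [ab bL ra rb nab]]] := @excursion _ [set v | v <r g m] g L m r0 rL mL.
  by rewrite /= ltxx.
have rE i : a < i < b -> r (g i) = r (g m).
  move=> hi; apply: le_anti; rewrite mmax /=; last by lia.
  by rewrite leNgt; apply/negP/nab.
have [_ _ _ EP] := tB.
have bab := nbw_sub bg (a := a) (l := b - a) ltac:(lia).
have [||||E ag] := EP _ _ _ bab.
- by lia.
- by move=> i hi /=; rewrite !rE //; lia.
- by rewrite /= addn0 (rE (a + 1)) //; lia.
- by rewrite /= subnKC ?(rE (a + 1)) //; lia.
have a0 : a = 0 by lia.
by subst a; split; [lia | exact: ag].
Qed.

(** The parity of n + 1 excludes a connecting walk of length n. *)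
Lemma short_nbw S x y : far e n S x y -> S `<=` W ->
  exists g L, [/\ nbw W g L, g 0 = x, g L = y & L < n].
Proof.
move=> [Sx Sy [h [wh h0 hL]] fmin] SW.
have [g [L [wg g0 gL Ln]]] := diamW (SW _ Sx) (SW _ Sy).
have := walk_odd eside wg wh; rewrite g0 gL h0 hL => /(_ erefl erefl) odL.
have [f [M [bf ML f0 fM _]]] := ex_shortest wg.
exists f, M; rewrite f0 fM; split=> //; apply: leq_ltn_trans ML _.
rewrite ltn_neqAle Ln andbT; apply/eqP => E; move: odL.
by rewrite E /=; case: odd.
Qed.

(** The short geodesic of [W] between the two vertices must leave [Y], and its excursion is an arc,
    long enough to be all of it. *)
Lemma good_far Y x y : good Y -> far e n Y x y ->
  exists g, [/\ arc g, g 0 = x, g n.-1 = y & forall i, 0 < i < n.-1 -> ~ Y (g i)].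
Proof.
move=> gY fxy; have [BY YW _] := gY; have [Yx Yy _ fmin] := fxy.
have [g [L [bg g0 gL Ln]]] := short_nbw fxy YW.
have [/(walk_in bg.1) wY|/existsNP[k /not_implyP[kL nYk]]] :=
    pselect (forall i, i <= L -> Y (g i)).
  by have := fmin _ _ wY g0 gL; lia.
have [||a [b [ab bL Ya Yb nab]]] := excursion (S := Y) _ _ kL nYk; rewrite ?g0 ?gL //.
have [||||E ag] := good_excursion gY _ (nbw_sub bg (a := a) (l := b - a) ltac:(lia)) _ _ _.
- by lia.
- by rewrite /= addn0.
- by rewrite /= subnKC //; lia.
- by move=> i hi; apply: nab; lia.
have a0 : a = 0 by lia.
subst a; exists g; split=> //; first by rewrite -gL; congr g; lia.
by move=> i hi; apply: nab; lia.
Qed.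

(* The junk value [x] occurs only if [x] and [y] are not joined by a
   non-backtracking walk of length [n - 1], which is unique by [tfW]. *)
Definition geo x y k := xget x [set z | exists g,
  [/\ nbw W g n.-1, g 0 = x, g n.-1 = y & z = g k]].

Lemma geoE g k : nbw W g n.-1 -> k <= n.-1 -> geo (g 0) (g n.-1) k = g k.
Proof.
move=> bg kn; rewrite /geo; case: xgetP => [z _ [h [bh h0 hL ->]]|/(_ (g k)) []].
  have [||| _ -> //] := uniq_nbw eC tfW bh bg; rewrite ?h0 ?hL //; lia.
by exists g.
Qed.

Lemma geo_rev g k : nbw W g n.-1 -> k <= n.-1 ->
  geo (g n.-1) (g 0) k = g (n.-1 - k).
Proof.
move=> bg kn; have := geoE (nbw_rev eC bg) kn.
by rewrite /wrev subn0 subnn => ->.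
Qed.

Definition next F := [set z | F z \/
  exists x y k, [/\ far e n F x y, 0 < k < n.-1 & z = geo x y k]].

(** Closedness is asked inside the union of [F] and [B], so that pairs at distance n + 1 in [F] keep
    this distance when the base is added, where [good_far] applies. *)
Definition chain_inv F := [/\ F `<=` W, arcful F & closed_in e n (F `|` B) F].

Section Next.
Variable F : set V.
Hypothesis iF : chain_inv F.

Lemma next_good : good (F `|` B).
Proof. by case: iF => FW aF _; exact: good_setU. Qed.

Lemma next_far x y : far e n F x y -> far e n (F `|` B) x y.
Proof.
move=> fxy; have [FW _ [_ cF]] := iF; have [Fx Fy [h [wh h0 hL]] fmin] := fxy.
split; [by left | by left | |].
  by exists h; split=> //; apply: walkS wh => z; left.
move=> g L wg g0 gL; rewrite ltnNge; apply/negP => Ln.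
have := walk_odd eside wg wh; rewrite g0 gL h0 hL => /(_ erefl erefl) odL.
have [f [M [bf ML f0 fM _]]] := ex_shortest wg.
have Ln' : L < n.
  by rewrite ltn_neqAle Ln andbT; apply/eqP => E; move: odL; rewrite E /=; case: odd.
have wf := walk_in bf.1 (cF _ _ (leq_ltn_trans ML Ln') bf _ _).
have := fmin _ _ (wf _ _); rewrite f0 fM g0 gL => /(_ Fx Fy erefl erefl).
by lia.
Qed.

Lemma next_arc x y : far e n F x y -> exists g, [/\ arc g, g 0 = x, g n.-1 = y,
  forall k, k <= n.-1 -> geo x y k = g k &
  forall i, 0 < i < n.-1 -> ~ (F `|` B) (g i)].
Proof.
move=> /next_far /(good_far next_good) [g [ag g0 gL gn]].
by exists g; split=> // k kn; rewrite -g0 -gL geoE //; case: ag.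
Qed.

Lemma next_fstep : fstep e n F (next F) geo.
Proof.
have [FW aF cF] := iF; have [BW Bmin Blt EP] := tB.
have gk x y k (fxy : far e n F x y) : 0 < k < n.-1 -> exists g,
    [/\ arc g, g 0 = x, g n.-1 = y, geo x y k = g k & ~ (F `|` B) (g k)].
  move=> kn; have [g [ag g0 gL gE nF]] := next_arc fxy.
  by exists g; split=> //; [apply: gE; lia | exact: nF].
have geo0 x y : far e n F x y -> geo x y 0 = x /\ geo x y n.-1 = y.
  by move=> /next_arc [g [ag g0 gL gE _]]; rewrite !gE.
have geor x y k : far e n F x y -> k <= n.-1 -> geo y x k = geo x y (n.-1 - k).
  move=> /next_arc [g [[bg _ _ _ _] g0 gL gE _]] kn.
  by rewrite gE ?leq_subr // -geo_rev // g0 gL.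
split=> //; first split=> //.
- by move=> x y k fxy /(gk _ _ _ fxy) [g [_ _ _ -> nF]] Fg; apply: nF; left.
- move=> x y k x' y' k' fxy kn fxy' kn' E.
  have [g [ag g0 gL gE _]] := gk _ _ _ fxy kn.
  have [h [ah h0 hL hE _]] := gk _ _ _ fxy' kn'.
  have [|[-> gh]|[-> gh]] := arc_eq ag ah kn kn'; first by rewrite -gE -hE.
    by left; rewrite -h0 -hL -g0 -gL !gh.
  by right; rewrite -h0 -hL -g0 -gL !gh // ?subn0 ?subnn ?subKn //; lia.
(* The crux: an edge leaving an interior vertex of a new path either stays on
   that path or increases the rank, so it cannot end in [F]. *)
have nbr u v x y k : far e n F x y -> 0 < k < n.-1 -> u = geo x y k ->
    next F v -> e u v -> v <=r u -> v = geo x y k.-1 \/ v = geo x y k.+1.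
  move=> fxy kn uE _ euv vu; have [g [ag g0 gL gE _]] := next_arc fxy.
  have [_ rg _ _ gn] := ag.
  rewrite !gE in uE *; try lia; subst u.
  by apply: gn euv _ => //; rewrite -(rg k kn).
have lowF u v x y k : far e n F x y -> 0 < k < n.-1 -> u = geo x y k ->
    F v -> e u v -> v <=r u.
  move=> fxy kn uE Fv euv.
  have [g [ag g0 gL gE nFg]] := gk _ _ _ fxy kn.
  rewrite leNgt; apply/negP => uv.
  have nFu : ~ (F `|` B) u by rewrite uE gE.
  have := good_nbr next_good (x := v) (w := u) ltac:(by left) nFu.
  rewrite eC => /(_ euv) /ltW.
  by rewrite leNgt uv.
move=> u v Fu Fv; split; last first.
  case=> [[]//|[x [y [k [fxy kn -> ->]]]]].
  have [g [[[[_ eg] _] _ _ _ _] _ _ gE _]] := next_arc fxy.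
  by rewrite !gE; [apply: eg| |]; lia.
move=> euv.
have new a b x y k : far e n F x y -> 0 < k < n.-1 -> a = geo x y k -> next F b ->
    e a b -> b <=r a -> exists x y k,
    [/\ far e n F x y, k < n.-1, a = geo x y k & b = geo x y k.+1].
  move=> fxy kn aE Fb eab ba.
  have [E|E] := nbr _ _ _ _ _ fxy kn aE Fb eab ba; last by exists x, y, k; split=> //; lia.
  exists y, x, (n.-1 - k); split; [exact: far_sym|lia| |].
    by rewrite geor ?subKn //; lia.
  by rewrite geor // ?E; [congr geo|]; lia.
have flip a b : (exists x y k,
    [/\ far e n F x y, k < n.-1, a = geo x y k & b = geo x y k.+1]) ->
    exists x y k, [/\ far e n F x y, k < n.-1, b = geo x y k & a = geo x y k.+1].
  move=> [x [y [k [fxy kn aE bE]]]]; exists y, x, (n.-1 - k.+1); split.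
  - exact: far_sym.
  - by lia.
  - by rewrite geor ?subKn //; lia.
  - by rewrite geor // ?aE; [congr geo|]; lia.
have evu : e v u by rewrite eC.
have [[Fu'|[x [y [k [fxy kn uE]]]]] [Fv'|[x' [y' [k' [fxy' kn' vE]]]]]] := (Fu, Fv).
- by left.
- by right; apply: flip; apply: (new _ _ _ _ _ fxy' kn' vE) => //; apply: (lowF v u x' y' k').
- by right; apply: (new _ _ _ _ _ fxy kn uE) => //; apply: (lowF u v x y k).
(* Between two new vertices the edge is read from the end of larger rank. *)
right; have [vu|uv] := leP (r v) (r u).
  exact: (new _ _ _ _ _ fxy kn uE).
by apply: flip; apply: (new _ _ _ _ _ fxy' kn' vE) => //; exact: ltW.
Qed.

Lemma next_base : next F `&` B `<=` F.
Proof.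
move=> z [[//|[x [y [k [/next_arc[g [ag _ _ gE nF]] kn ->]]]]]].
by rewrite gE; [move=> Bg; case: (nF k kn); right | lia].
Qed.

Lemma next_inv : chain_inv (next F).
Proof.
have [FW aF [_ cF]] := iF; have stp := next_fstep.
have FF' : F `<=` next F := fstep_sub stp.
split.
- move=> z [/FW//|[x [y [k [/next_arc[g [[[[Wg _] _] _ _ _ _] _ _ gE _]] kn ->]]]]].
  by rewrite gE; [apply: Wg|]; lia.
- move=> z [Fz|[x [y [k [fxy kn ->]]]]] nBz.
    have [g [k [ag kn gk Fg]]] := aF z Fz nBz.
    by exists g, k; split=> // i /Fg /FF'.
  have [g [ag g0 gL gE _]] := next_arc fxy.
  exists g, k; split=> //; first by rewrite gE //; lia.
  by move=> i iL; rewrite -gE //; exact: fstep_in stp _ _ _ fxy iL.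
split; first by move=> z; left.
move=> g L Ln bg F0 FL k kL; apply: contrapT => nFk.
have [a [b [ab bL Fa Fb nFab]]] := excursion F0 FL kL nFk.
have [[Yg eg] _] := bg; have [_ Bmin _ _] := tB.
have Bab i : a < i < b -> B (g i).
  by move=> hi; have [/(nFab _ hi)|//] : (next F `|` B) (g i) by apply: Yg; lia.
(* The base has minimal rank, so an inner vertex of an arc has no neighbour there off the arc. An
   excursion through the base therefore starts and ends in [F]. *)
have inF u w : next F u -> ~ next F w -> B w -> e u w -> F u.
  case=> // -[x [y [j [fxy jn ->]]]] nFw Bw euw; exfalso; apply: nFw.
  have [h [[_ rh h0 _ hn] _ _ hE _]] := next_arc fxy.
  rewrite hE in euw; last by lia.
  have [] := hn j w jn euw (Bmin _ _ Bw) => ->; rewrite -hE; try lia;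
    by apply: fstep_in stp _ _ _ fxy _; lia.
have {}Fa : F (g a).
  by apply: (inF _ (g a.+1)) => //; [apply: nFab|apply: Bab|apply: eg]; lia.
have {}Fb : F (g b).
  have hb : a < b.-1 < b by lia.
  apply: (inF _ _ Fb (nFab _ hb) (Bab _ hb)).
  by rewrite eC -{2}(prednK (n := b)); [apply: eg|]; lia.
have bab := nbw_sub bg (a := a) (l := b - a) ltac:(lia).
have Yab i : i <= b - a -> (F `|` B) (g (a + i)).
  move=> iL; have [->|i0] := posnP i; first by left; rewrite addn0.
  have [->|ib] : i = b - a \/ i < b - a by lia.
    by left; rewrite subnKC //; lia.
  by right; apply: Bab; lia.
apply: nFk; apply: FF'.
have := cF _ _ _ (nbw_in bab Yab) _ _ (k - a); rewrite addn0 !subnKC; try lia.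
by apply=> //; lia.
Qed.

End Next.

(* The vertices above the base of a closed set generated inside the base come
   in full arcs. *)
Lemma closure_arcful A X : closed_in e n W A -> X `<=` A `&` B ->
  (forall C, closed_in e n W C -> X `<=` C -> A `<=` C) -> arcful A.
Proof.
move=> [AW cA] XAB Amin.
(* [A'] is the largest arcful subset of [A], as arcful sets are stable under unions. By minimality
   of [A] it remains to see that [A'] is closed. *)
pose A' := [set z | A z /\ (B z \/ exists D, [/\ D `<=` A, arcful D & D z])].
have A'A : A' `<=` A by move=> z [].
have aA' : arcful A'.
  move=> z [Az [//|[D [DA aD Dz]]]] nBz.
  have [g [k [ag kn gk Dg]]] := aD z Dz nBz.
  exists g, k; split=> // i iL; split; first exact/DA/Dg.
  by right; exists D; split=> //; exact: Dg.
have gY := good_setU (subset_trans A'A AW) aA'.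
suff cA' : closed_in e n W A'.
  have AA' : A `<=` A' by apply: Amin => // z /XAB [Az Bz]; split=> //; left.
  by have -> : A = A' by rewrite eqEsubset.
split; first exact: subset_trans A'A AW.
move=> g L Ln bg A0 AL k kL; apply: contrapT => nAk.
have Ag i : i <= L -> A (g i) by apply: (cA _ _ Ln bg); exact: A'A.
have [a [b [ab bL Aa Ab nAab]]] := excursion A0 AL kL nAk.
have bab := nbw_sub bg (a := a) (l := b - a) ltac:(lia).
have [||||E ag] := good_excursion gY _ bab _ _ _.
- by lia.
- by left; rewrite /= addn0.
- by left; rewrite /= subnKC //; lia.
- move=> i hi; have nA' := nAab (a + i) ltac:(lia).
  by case=> // Bi; apply: nA'; split; [apply: Ag; lia | left].
apply: (nAab k) => //; split; first exact: Ag.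
(* Adjoining the arc just found keeps [A'] arcful, because the ends of the arc already belong to
   [A']. *)
right; exists (A' `|` [set z | exists2 i, i <= n.-1 & z = g (a + i)]); split.
- by move=> z [/A'A//|[i hi ->]]; apply: Ag; lia.
- move=> z [Az|[i iL ->]] nBz.
    have [h [l [ah ln hl Ah]]] := aA' z Az nBz.
    by exists h, l; split=> // i /Ah; left.
  have [i0|[iN|i1]] : i = 0 \/ i = n.-1 \/ 0 < i < n.-1 by lia.
  + have Az : A' (g (a + i)) by rewrite i0 addn0.
    have [h [l [ah ln hl Ah]]] := aA' _ Az nBz.
    by exists h, l; split=> // j /Ah; left.
  + have Az : A' (g (a + i)) by rewrite iN -E subnKC //; lia.
    have [h [l [ah ln hl Ah]]] := aA' _ Az nBz.
    by exists h, l; split=> // j /Ah; left.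
  + exists (fun i => g (a + i)), i; split=> // j jL.
    by right; exists j.
- by right; exists (k - a); [lia | rewrite subnKC //; lia].
Qed.

Variable F0 : set V.
Hypothesis F0B : F0 `<=` B.
Hypothesis cF0 : closed_in e n B F0.
Hypothesis conF0 : walk_connected e F0.

Definition chain j := iter j next F0.
Definition hull := [set z | exists j, chain j z].

Lemma chain_invP j : chain_inv (chain j).
Proof.
elim: j => [|j IH]; last exact: next_inv.
have [BW _ _ _] := tB; split.
- by move=> z /F0B /BW.
- by move=> z /F0B.
- have -> // : chain 0 `|` B = B.
  by rewrite eqEsubset; split=> z; [case=> // /F0B | right].
Qed.

Lemma chain_fstep j : fstep e n (chain j) (chain j.+1) geo.
Proof. exact/next_fstep/chain_invP. Qed.

Lemma chain_mono i j : i <= j -> chain i `<=` chain j.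
Proof. exact: (stages_mono chain_fstep). Qed.

Lemma chain_connected j : walk_connected e (chain j).
Proof. exact: (stages_connected eC n_gt2 chain_fstep). Qed.

Lemma hull_sub : hull `<=` W.
Proof. by move=> z [j]; case: (chain_invP j) => + _ _; apply. Qed.

Lemma hull_arcful : arcful hull.
Proof.
move=> z [j Fz] nBz; have [_ aF _] := chain_invP j.
have [g [k [ag kn gk Fg]]] := aF _ Fz nBz.
by exists g, k; split=> // i /Fg Fi; exists j.
Qed.

Lemma hull_base : hull `&` B `<=` F0.
Proof.
move=> z [[j Fz] Bz]; elim: j Fz => // j IH Fz; apply: IH.
exact: (next_base (chain_invP j)).
Qed.

Lemma hull_min C : closed_in e n W C -> F0 `<=` C -> hull `<=` C.
Proof.
move=> [CW cC] FC z [j]; elim: j z => [|j IH] z; first exact: FC.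
case=> [/IH//|[x [y [k [fxy kn ->]]]]].
have [g [[bg _ _ _ _] g0 gL gE _]] := next_arc (chain_invP j) fxy.
rewrite gE; last by lia.
have [/IH Cx /IH Cy _ _] := fxy.
by apply: (cC _ _ _ bg); rewrite ?g0 ?gL //; lia.
Qed.

(** An excursion inside the base is handled by [chain_inv]. Any other one is an arc, hence the whole
    walk. At a later stage its ends are joined by a walk of length at most n, hence less than n by
    parity, and by uniqueness a shortest such walk is the arc. *)
Lemma hull_closed : closed_in e n W hull.
Proof.
split; first exact: hull_sub.
move=> g L Ln bg A0 AL k kL; apply: contrapT => nAk.
have [a [b [ab bL [j1 Aa] [j2 Ab] nAab]]] := excursion A0 AL kL nAk.
have [[Wg eg] _] := bg.
pose j := maxn j1 j2.
have {}Aa : chain j (g a) by apply: chain_mono Aa; lia.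
have {}Ab : chain j (g b) by apply: chain_mono Ab; lia.
have bab := nbw_sub bg (a := a) (l := b - a) ltac:(lia).
have [Bab|/existsNP[i /not_implyP[hi nBi]]] :=
    pselect (forall i, 0 < i < b - a -> B (g (a + i))).
  have [_ _ [_ cF]] := chain_invP j; apply: nAk; exists j.
  have YY i : i <= b - a -> (chain j `|` B) (g (a + i)).
    move=> iL; have [->|i0] := posnP i; first by left; rewrite addn0.
    have [->|ib] : i = b - a \/ i < b - a by lia.
      by left; rewrite subnKC //; lia.
    by right; apply: Bab; lia.
  have := cF _ _ _ (nbw_in bab YY) _ _ (k - a); rewrite addn0 !subnKC; try lia.
  by apply=> //; lia.
have gY := good_setU hull_sub hull_arcful.
have [||||a1 [b1 [ab1 bL1 Ya1 Yb1 nYab1]]] := @excursion _ (hull `|` B)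
  (fun i => g (a + i)) (b - a) i.
- by left; exists j; rewrite /= addn0.
- by left; exists j; rewrite /= subnKC //; lia.
- by lia.
- by case=> //; apply: nAab; lia.
have [||||E ag] := good_excursion gY _
  (nbw_sub bab (a := a1) (l := b1 - a1) ltac:(lia)) _ _ _.
- by lia.
- by rewrite /= addn0.
- by rewrite /= subnKC //; lia.
- by move=> c hc; apply: nYab1; lia.
have a0 : a = 0 by lia.
have bE : b = n.-1 by lia.
have LE : L = n.-1 by lia.
subst a b L.
have [j' [h [M [jj' wh Mn h0 hM]]]] : exists j' h M, [/\ j <= j',
    walk e (chain j') h M, M <= n, h 0 = g 0 & h M = g n.-1].
  have [h [M [wh h0 hM]]] := chain_connected Aa Ab.
  have [||j' [h' [M' [jj' wh' Mn h0' hM']]]] := contract n_gt2 (F := chain) _ _ (j := j) wh.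
  - exact: chain_mono.
  - move=> a x y fxy; exists (geo x y).
    have st := chain_fstep a.
    by rewrite (fstep_q0 st fxy) (fstep_qL st fxy); have [] := fstep_nbw n_gt2 st fxy.
  by exists j', h', M'; rewrite h0' hM'; split.
have [FW _ _] := chain_invP j'.
have [f [N [bf NM f0 fN _]]] := ex_shortest wh.
have odM := walk_odd eside (walkS FW wh) bg.1 h0 hM.
have nM : M <> n.
  by move=> E'; move: odM; rewrite E' -[in odd n](prednK (n := n)) /=; [case: odd | lia].
apply: nAk; exists j'; have [[Ff _] _] := bf.
have [NE fg'] := uniq_nbw eC tfW (nbwS FW bf) bg ltac:(by rewrite f0)
  ltac:(by rewrite fN) ltac:(lia).
by rewrite -fg'; [apply: Ff|]; lia.
Qed.

Lemma hull_connected : walk_connected e hull.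
Proof.
move=> x y [i Fx] [j Fy].
have [g [L [wg g0 gL]]] := chain_connected (chain_mono (leq_maxl i j) Fx)
  (chain_mono (leq_maxr i j) Fy).
by exists g, L; split=> //; apply: walkS wg => z Fz; exists (maxn i j).
Qed.

End Base.
End Tame.

(** * Ranks from stages *)

Section Levels.
Variables (V : choiceType) (e : rel V) (n : nat).
Hypothesis n_gt2 : 2 < n.

(* Short excursions from [S] into [S'] run along a path all of whose interior
   edges inside [S'] are its own. *)
Definition tight_step (S S' : set V) := forall g L, nbw e S' g L -> 1 < L < n ->
  S (g 0) -> S (g L) -> (forall i, 0 < i < L -> ~ S (g i)) ->
  L = n.-1 /\ forall j w, 0 < j < n.-1 -> S' w -> e (g j) w ->
    w = g j.-1 \/ w = g j.+1.

Lemma fstep_tight S S' q : symmetric e -> fstep e n S S' q -> tight_step S S'.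
Proof.
move=> eC Sq g L bg L1 S0 SL nS.
have [-> [x [y [fxy gq]]]] := fstep_excursion eC n_gt2 Sq bg ltac:(lia) S0 SL nS.
split=> // j w jn Sw; rewrite !gq; try lia.
exact: (fstep_nbr n_gt2 Sq).
Qed.

Variable W : nat -> set V.
Hypothesis W_mono : forall i j, i <= j -> W i `<=` W j.

Let Om := \bigcup_i W i.

Lemma ex_level : exists r : V -> nat, forall z k, Om z -> (W k z <-> r z <= k).
Proof.
have /choice[r rP] z : exists k, Om z -> W k z /\ forall j, j < k -> ~ W j z.
  have [[i _ Wi]|nz] := pselect (Om z); last by exists 0.
  by have [|k Wk kmin] := @ex_least (W^~ z); [exists i | exists k].
exists r => z k /rP [Wr rmin]; split=> [Wk|rk]; last exact: W_mono rk _ Wr.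
by rewrite leqNgt; apply/negP => /rmin.
Qed.

Hypothesis eOm : forall x y, e x y -> Om x.
Hypothesis eC : symmetric e.
Hypothesis W_tight : forall k, tight_step (W k) (W k.+1).
Variable r : V -> nat.
Hypothesis rP : forall z k, Om z -> (W k z <-> r z <= k).

(** Truncated subtraction gives all of [W i] the minimal rank 0 and keeps the order above it. A peak
    whose inner vertices appear at stage s + 1 is an excursion from [W s], to which tightness
    applies. *)
Lemma tame_levels i : tame e n Om (fun z => r z - i) (W i).
Proof.
split.
- by move=> z Wz; exists i.
- by move=> x y Wx; rewrite leEnat; have Ox : Om x by [exists i]; have := (rP i Ox).1 Wx; lia.
- move=> x y Wx nWy Oy; rewrite ltEnat /=.
  have Ox : Om x by exists i.
  have := (rP i Ox).1 Wx; have : ~ r y <= i by move/(rP i Oy).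
  by lia.
move=> g L L1 bg rg; rewrite !ltEnat /= => r0 rL.
have [[Og eg] _] := bg.
have rE j : 0 < j < L -> r (g j) = r (g 1).
  by move=> hj; have := rg j hj; have := r0; lia.
pose s := (r (g 1)).-1.
have [] := W_tight (k := s) (g := g) (L := L).
- apply: nbw_in bg _ => j jL; apply/rP; first exact: Og.
  have [->|j0] := posnP j; first by lia.
  have [->|jL'] : j = L \/ j < L by lia.
    by lia.
  by rewrite rE; lia.
- by [].
- by apply/rP; [apply: Og | lia].
- by apply/rP; [apply: Og | lia].
- by move=> j hj /rP; rewrite rE //; move=> /(_ (Og _ _)); lia.
move=> E nbr; subst L; split=> //; split=> //.
move=> k w kn ew; rewrite leEnat => rw.
apply: nbr => //; apply/rP; last by lia.
by apply: (eOm (y := g k)); rewrite eC.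
Qed.

End Levels.

(** * Ranking a closed subset before the rest *)

Section Lexicographic.
Variables (V : choiceType) (e : rel V) (side : pred V) (n : nat).
Hypothesis eC : symmetric e.
Hypothesis n_gt2 : 2 < n.

Local Notation lex := (nat *l nat)%type.

Lemma lexi_le (a b c d : nat) :
  Order.le ((a, b) : lex) ((c, d) : lex) = (a < c) || (a == c) && (b <= d).
Proof.
rewrite leEprodlexi /= !leEnat.
by case: (ltngtP a c).
Qed.

Lemma lexi_lt (a b c d : nat) :
  Order.lt ((a, b) : lex) ((c, d) : lex) = (a < c) || (a == c) && (b < d).
Proof.
by rewrite ltNge lexi_le; lia.
Qed.

Variables (F C : nat -> set V) (A : set V) (rF rC : V -> nat).
Hypothesis F_tight : forall k, tight_step e n (F k) (F k.+1).
Hypothesis C_tight : forall k, tight_step e n (C k) (C k.+1).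
Hypothesis FP : forall z k, F k z <-> rF z <= k.
Hypothesis CP : forall z k, A z -> (C k z <-> rC z <= k).
Hypothesis CA : forall k, C k `<=` A.
Hypothesis AF : A `&` F 0 `<=` C 0.
Hypothesis A_arcful : arcful e n setT rF (F 0) A.

(* [A] is ranked by its own stages; what lies outside comes afterwards. *)
Definition lex_rank z : lex :=
  if `[< A z >] then (0, rC z) else
  if `[< F 0 z >] then (0, 0) else (1, rF z).

Lemma lex_rankA z : A z -> lex_rank z = (0, rC z).
Proof. by move=> Az; rewrite /lex_rank asboolT. Qed.

Lemma lex_rankF z : ~ A z -> F 0 z -> lex_rank z = (0, 0).
Proof. by move=> nAz Fz; rewrite /lex_rank asboolF // asboolT. Qed.

Lemma lex_rankN z : ~ A z -> ~ F 0 z -> lex_rank z = (1, rF z).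
Proof. by move=> nAz nFz; rewrite /lex_rank !asboolF. Qed.

Lemma lex_base z : (C 0 `|` F 0) z <-> lex_rank z = (0, 0).
Proof.
split=> [[Cz|Fz]|].
- by rewrite lex_rankA; [congr pair; have := (CP 0 (CA Cz)).1 Cz; lia | exact: CA Cz].
- have [Az|nAz] := pselect (A z); last by rewrite lex_rankF.
  have /(CP 0 Az) : C 0 z by exact: AF.
  by rewrite lex_rankA // => ?; congr pair; lia.
have [Az|nAz] := pselect (A z).
  by rewrite lex_rankA // => -[r0]; left; apply/CP; rewrite ?r0.
by have [Fz|nFz] := pselect (F 0 z); [right | rewrite lex_rankN].
Qed.

(** Leaving [A] through a vertex off [F 0] raises the stage in [F]. This is why [A] may be ranked
    before everything outside: an edge from the outside down to such a vertex of [A] goes down in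
    [F] as well. *)
Lemma arcful_nbr z w : A z -> ~ F 0 z -> e z w -> rF w <= rF z -> A w.
Proof.
move=> Az nFz ezw rw; have [g [k [ag kn gk Ag]]] := A_arcful Az nFz.
have [_ rg _ _ gn] := ag; subst z.
by have [|->|->] := gn k w kn ezw; [rewrite -(rg k kn) | apply: Ag; lia..].
Qed.

(** A peak whose inner vertices are in [A] has its ends in [A] too and is an excursion between
    stages of [C]. A peak outside [A] is also a peak for [rF] and is an excursion between stages of
    [F]. *)
Lemma tame_lex : tame e n setT lex_rank (C 0 `|` F 0).
Proof.
have minr z : Order.le ((0, 0) : lex) (lex_rank z).
  by case: (lex_rank z) => a b; rewrite lexi_le; lia.
split=> //.
- by move=> x y /lex_base ->.
- move=> x y /lex_base -> /lex_base ny _; rewrite lt_neqAle minr andbT.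
  by apply/eqP => E; apply: ny; rewrite -E.
move=> g L L1 bg rg r0 rL; have [[_ eg] _] := bg.
have eg0 : e (g 1) (g 0) by rewrite eC; apply: eg; lia.
have egL : e (g L.-1) (g L) by rewrite -{2}(prednK (n := L)); [apply: eg|]; lia.
have rgL : lex_rank (g L.-1) = lex_rank (g 1) by apply: rg; lia.
suff [E nbr] : L = n.-1 /\ forall j w, 0 < j < n.-1 -> e (g j) w ->
    Order.le (lex_rank w) (lex_rank (g 1)) -> w = g j.-1 \/ w = g j.+1.
  by subst L; split=> //; split.
have [A1|nA1] := pselect (A (g 1)).
  rewrite (lex_rankA A1) in rg r0 rL rgL *.
  have s0 : 0 < rC (g 1).
    by move: r0 (minr (g 0)); case: (lex_rank (g 0)) => a b; rewrite lexi_lt; lia.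
  have AP z : lex_rank z = (0, rC (g 1)) -> A z /\ rC z = rC (g 1).
    have [Az|nAz] := pselect (A z); first by rewrite lex_rankA // => -[->].
    have [Fz|nFz] := pselect (F 0 z); last by rewrite lex_rankN.
    by rewrite lex_rankF // => -[E]; rewrite -E in s0.
  have Anbr z w : A z -> rC z = rC (g 1) -> e z w ->
      Order.le (lex_rank w) ((0, rC (g 1)) : lex) -> A w.
    move=> Az rz ezw; have [//|nAw] := pselect (A w).
    have [Fw _|nFw] := pselect (F 0 w); last by rewrite lex_rankN // lexi_le.
    apply: (arcful_nbr Az _ ezw); last by have /FP := Fw; lia.
    move=> Fz; have /(CP 0 Az) : C 0 z by exact: AF.
    by lia.
  have [AL rCL] := AP _ rgL.
  have A0' : A (g 0) by apply: (Anbr _ _ A1 _ eg0) => //; exact: ltW.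
  have AL' : A (g L) by apply: (Anbr _ _ AL _ egL) => //; exact: ltW.
  rewrite !lex_rankA // !lexi_lt /= in r0 rL.
  have [|||||E nbr] := C_tight (k := (rC (g 1)).-1) (g := g) (L := L).
  - apply: nbw_in bg _ => j jL; rewrite prednK //.
    have [->|j0] := posnP j; first by apply/CP => //; lia.
    have [->|jL'] : j = L \/ j < L by lia.
      by apply/CP => //; lia.
    have [|Aj rj] := AP (g j); first by apply: rg; lia.
    by apply/CP => //; lia.
  - by [].
  - by apply/CP => //; lia.
  - by apply/CP => //; lia.
  - move=> j hj Cj; have [|Aj rj] := AP (g j); first by apply: rg.
    by have /(CP _ Aj) := Cj; lia.
  split=> // j w jn ejw rw; apply: nbr => //; rewrite prednK //.
  have [|Aj rj] := AP (g j); first by apply: rg; lia.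
  have Aw := Anbr _ _ Aj rj ejw rw.
  by apply/CP => //; move: rw; rewrite lex_rankA // lexi_le; lia.
have [F1|nF1] := pselect (F 0 (g 1)).
  by move: r0; rewrite (lex_rankF nA1 F1) ltNge minr.
rewrite (lex_rankN nA1 nF1) in rg r0 rL rgL *.
have s0 : 0 < rF (g 1) by rewrite ltnNge; apply/negP => /FP.
have NP z : lex_rank z = (1, rF (g 1)) -> [/\ ~ A z, ~ F 0 z & rF z = rF (g 1)].
  have [Az|nAz] := pselect (A z); first by rewrite lex_rankA.
  have [Fz|nFz] := pselect (F 0 z); first by rewrite lex_rankF.
  by rewrite lex_rankN // => -[->].
have Nnbr z w : ~ A z -> rF z = rF (g 1) -> e z w -> A w -> rF w < rF (g 1).
  move=> nAz rz ezw Aw; rewrite ltnNge; apply/negP => rw; apply: nAz.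
  apply: (arcful_nbr Aw); [|by rewrite eC | by lia].
  by move/FP; lia.
have low z w : ~ A z -> rF z = rF (g 1) -> e z w ->
    Order.lt (lex_rank w) ((1, rF (g 1)) : lex) -> rF w < rF (g 1).
  move=> nAz rz ezw; have [Aw _|nAw] := pselect (A w); first exact: (Nnbr z).
  have [Fw _|nFw] := pselect (F 0 w); first by have /FP := Fw; lia.
  by rewrite lex_rankN // lexi_lt; lia.
have [nAL nFL rFL] := NP _ rgL.
have r0' := low _ _ nA1 erefl eg0 r0.
have rL' := low _ _ nAL rFL egL rL.
have [|||||E nbr] := F_tight (k := (rF (g 1)).-1) (g := g) (L := L).
- apply: nbw_in bg _ => j jL; apply/FP.
  have [->|j0] := posnP j; first by lia.
  have [->|jL'] : j = L \/ j < L by lia.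
    by lia.
  have [|_ _] := NP (g j); first by apply: rg; lia.
  by lia.
- by [].
- by apply/FP; lia.
- by apply/FP; lia.
- move=> j hj /FP; have [|_ _] := NP (g j); first by apply: rg.
  by lia.
split=> // j w jn ejw rw; apply: nbr => //; rewrite prednK //; apply/FP.
have [|nAj _ rj] := NP (g j); first by apply: rg; lia.
have [Aw|nAw] := pselect (A w); first by apply: ltnW; exact: Nnbr ejw _.
have [Fw|nFw] := pselect (F 0 w); first by have /FP := Fw; lia.
by move: rw; rewrite lex_rankN // lexi_le; lia.
Qed.

End Lexicographic.

(** * Isomorphisms between induced subgraphs *)

Section Iso.
Variables (V1 V2 : choiceType) (e1 : rel V1) (e2 : rel V2).

Definition iso_on (A : set V1) (h : V1 -> V2) :=
  (forall x y, A x -> A y -> h x = h y -> x = y) /\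
  (forall x y, A x -> A y -> e2 (h x) (h y) = e1 x y).

Lemma iso_onS A B h : B `<=` A -> iso_on A h -> iso_on B h.
Proof.
by move=> BA [hi he]; split=> x y /BA Ax /BA Ay; [exact: hi | exact: he].
Qed.

Lemma iso_walk A h S w L : iso_on A h -> S `<=` A -> walk e1 S w L ->
  walk e2 (h @` S) (fun i => h (w i)) L.
Proof.
move=> [hi he] SA [Sw ew]; split=> i iL; first by exists (w i) => //; exact: Sw.
by rewrite he ?ew //; apply: SA; apply: Sw; lia.
Qed.

Lemma iso_nbw A h S w L : iso_on A h -> S `<=` A -> nbw e1 S w L ->
  nbw e2 (h @` S) (fun i => h (w i)) L.
Proof.
move=> ih SA [ww nw]; split; first exact: (iso_walk ih SA ww).
have [hi _] := ih; have [Sw _] := ww.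
have Aw i : i <= L -> A (w i) by move=> iL; apply: SA; apply: Sw.
by move=> i iL /hi E; apply: (nw i iL); apply: E; apply: Aw; lia.
Qed.

End Iso.

Lemma iso_inv (V1 V2 : choiceType) (e1 : rel V1) (e2 : rel V2) (x0 : V1) A h :
  iso_on e1 e2 A h -> exists g, (forall x, A x -> g (h x) = x) /\
    iso_on e2 e1 (h @` A) g.
Proof.
move=> [hi he]; exists (fun y => xget x0 [set x | A x /\ h x = y]).
have gK x : A x -> xget x0 [set x' | A x' /\ h x' = h x] = x.
  by move=> Ax; case: xgetP => [z _ [Az /hi]|/(_ x) []//]; exact.
split=> //; split=> _ _ [x Ax <-] [y Ay <-]; rewrite !gK //; first by move=> ->.
by rewrite he.
Qed.

Lemma iso_image_cancel (V1 V2 : choiceType) (h : V1 -> V2) g (A S : set V1) :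
  S `<=` A -> (forall x, A x -> g (h x) = x) -> g @` (h @` S) = S.
Proof.
move=> SA gK; rewrite eqEsubset; split=> [_ [_ [x Sx <-] <-]|x Sx].
  by rewrite gK //; exact: SA.
by exists (h x); [exists x | rewrite gK //; exact: SA].
Qed.

Lemma iso_comp (V1 V2 V3 : choiceType) (e1 : rel V1) (e2 : rel V2) (e3 : rel V3)
    A h k : iso_on e1 e2 A h -> iso_on e2 e3 (h @` A) k ->
  iso_on e1 e3 A (fun x => k (h x)).
Proof.
move=> [hi he] [ki ke]; split=> x y Ax Ay; last first.
  by rewrite ke ?he.
by move=> /ki E; apply: hi => //; apply: E.
Qed.

Lemma iso_far_half (V1 V2 : choiceType) (e1 : rel V1) (e2 : rel V2) n A h S x y :
  iso_on e1 e2 A h -> S `<=` A -> far e1 n S x y ->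
  far e2 n (h @` S) (h x) (h y).
Proof.
move=> ih SA [Sx Sy [w [ww w0 wL]] fmin]; split; [by exists x | by exists y | |].
  by exists (fun i => h (w i)); rewrite w0 wL; split=> //; exact: (iso_walk ih SA ww).
have [g [gK ig]] := iso_inv x ih.
move=> u L wu u0 uL; have := iso_walk ig (@image_subset _ _ h _ _ SA) wu.
rewrite (iso_image_cancel SA gK) => /fmin; apply; rewrite ?u0 ?uL gK //; exact: SA.
Qed.

Lemma iso_far (V1 V2 : choiceType) (e1 : rel V1) (e2 : rel V2) n A h S x y :
  iso_on e1 e2 A h -> S `<=` A -> S x -> S y ->
  far e1 n S x y <-> far e2 n (h @` S) (h x) (h y).
Proof.
move=> ih SA Sx Sy; split; first exact: (iso_far_half ih SA).
have [g [gK ig]] := iso_inv x ih.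
move=> /(iso_far_half ig (@image_subset _ _ h _ _ SA)).
by rewrite (iso_image_cancel SA gK) !gK //; exact: SA.
Qed.

Lemma fstep_transport (V1 V2 : choiceType) (e1 : rel V1) (e2 : rel V2) n (x0 : V1)
    A h S S' q :
  2 < n -> iso_on e1 e2 A h -> S' `<=` A -> fstep e1 n S S' q ->
  exists q', fstep e2 n (h @` S) (h @` S') q'.
Proof.
move=> n2 ih S'A Sq; have SS' := fstep_sub Sq.
have SA := subset_trans SS' S'A.
have [g [gK ig]] := iso_inv x0 ih.
have hi := ih.1; have he := ih.2.
have [[q0 q2 qn qi] S'E eE] := Sq.
have fP x y : far e2 n (h @` S) x y -> exists a b, [/\ S a, S b, h a = x, h b = y &
    far e1 n S a b].
  move=> fxy; have [[a Sa ax] [b Sb bY] _ _] := fxy.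
  exists a, b; split=> //; apply/(iso_far n ih SA) => //.
  by rewrite ax bY.
have qin a b k : far e1 n S a b -> k <= n.-1 -> S' (q a b k) by exact: fstep_in Sq _ _ _.
exists (fun x y k => h (q (g x) (g y) k)); split; first split.
- move=> _ _ /fP[a [b [Sa Sb <- <- fab]]].
  by rewrite !gK; [rewrite (q0 _ _ fab).1 (q0 _ _ fab).2 | exact: SA..].
- move=> _ _ k /fP[a [b [Sa Sb <- <- fab]]] kn.
  by rewrite !gK; [rewrite q2 | exact: SA..].
- move=> _ _ k /fP[a [b [Sa Sb <- <- fab]]] kn [z Sz].
  rewrite !gK; try exact: SA.
  move=> /hi E; apply: (qn _ _ _ fab kn); rewrite -E //; first exact: SA.
  by apply: S'A; apply: qin fab _; lia.
- move=> x y k x' y' k' /fP[a [b [Sa Sb <- <- fab]]] kn.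
  move=> /fP[a' [b' [Sa' Sb' <- <- fab']]] kn'.
  rewrite !gK; try exact: SA.
  move=> /hi E; have {}E : q a b k = q a' b' k'.
    by apply: E; apply: S'A; apply: qin => //; lia.
  by have [[-> -> ->]|[-> -> ->]] := qi _ _ _ _ _ _ fab kn fab' kn' E; [left|right].
- move=> z; split=> [[x /S'E[Sx|[a [b [k [fab kn ->]]]]] <-]|].
  + by left; exists x.
  + have [Sa Sb _ _] := fab; right; exists (h a), (h b), k; split=> //.
      exact/(iso_far n ih SA).
    by rewrite !gK //; exact: SA.
  case=> [[x Sx <-]|[_ [_ [k [/fP[a [b [Sa Sb <- <- fab]]] kn ->]]]]].
    by exists x => //; exact: SS'.
  by rewrite !gK; [eexists; [apply: (qin _ _ k fab); lia|] | exact: SA..].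
- move=> _ _ [u Su <-] [v Sv <-]; rewrite he; [|exact: S'A..].
  apply: (iff_trans (eE u v Su Sv)); split=> [[[Su' Sv' e']|[a [b [k [fab kn -> ->]]]]]|].
  + by left; split.
  + have [Sa Sb _ _] := fab; right; exists (h a), (h b), k; split=> //.
    * exact/(iso_far n ih SA).
    * by rewrite !gK //; exact: SA.
    * by rewrite !gK //; exact: SA.
  case=> [[[u' Su' /hi uE] [v' Sv' /hi vE] e']|].
    by left; rewrite -(uE (SA _ Su') (S'A _ Su)) -(vE (SA _ Sv') (S'A _ Sv)) in e' *.
  move=> [_ [_ [k [/fP[a [b [Sa Sb <- <- fab]]] kn]]]].
  rewrite !gK; try exact: SA.
  move=> /hi uE /hi vE; right; exists a, b, k; split=> //.
    by apply: uE; apply: S'A => //; apply: qin fab _; lia.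
  by apply: vE; apply: S'A => //; apply: qin fab _; lia.
Qed.

Section IsoTransport.
Variables (V1 V2 : choiceType) (e1 : rel V1) (e2 : rel V2) (n : nat).
Variables (A : set V1) (h : V1 -> V2).
Hypothesis ih : iso_on e1 e2 A h.

Lemma iso_pull_nbw S w L : S `<=` A -> nbw e2 (h @` S) w L -> exists u,
  nbw e1 S u L /\ forall i, i <= L -> h (u i) = w i.
Proof.
move=> SA bw; have [[hw _] _] := bw; have [x0 _ _] := hw 0 (leq0n L).
have [g [gK ig]] := iso_inv x0 ih.
exists (fun i => g (w i)); split.
  rewrite -(iso_image_cancel SA gK).
  exact: (iso_nbw ig (@image_subset _ _ h _ _ SA)).
by move=> i /hw [x Sx <-]; rewrite gK //; exact: SA.
Qed.

Lemma iso_tf S : S `<=` A -> tf e1 n S -> tf e2 n (h @` S).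
Proof.
move=> SA tS w L Ln /(iso_pull_nbw SA) [u [bu hu]] E; apply: (tS u L Ln bu).
have [[Su _] _] := bu; have [hi _] := ih.
by apply: hi; rewrite ?hu //; apply: SA; apply: Su.
Qed.

Lemma iso_connected S : S `<=` A -> walk_connected e1 S ->
  walk_connected e2 (h @` S).
Proof.
move=> SA cS _ _ [x Sx <-] [y Sy <-]; have [g [L [wg g0 gL]]] := cS x y Sx Sy.
by exists (fun i => h (g i)), L; rewrite g0 gL; split=> //; exact: (iso_walk ih).
Qed.

Lemma iso_closed S B : B `<=` A -> closed_in e1 n B S ->
  closed_in e2 n (h @` B) (h @` S).
Proof.
move=> BA [SB cS]; split; first exact: image_subset.
have [hi _] := ih.
move=> w L Ln /(iso_pull_nbw BA) [u [bu hu]]; have [[Bu _] _] := bu.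
have Su i : i <= L -> (h @` S) (w i) -> S (u i).
  move=> iL [x Sx]; rewrite -hu // => /hi <- //; first exact/BA/SB.
  by apply: BA; apply: Bu.
move=> w0 wL i iL; exists (u i); last exact: hu.
by apply: (cS _ _ Ln bu) => //; apply: Su.
Qed.

End IsoTransport.

(** * Extending isomorphisms along free steps *)

Section Extend.
Variables (V1 V2 : choiceType) (e1 : rel V1) (e2 : rel V2).
Variables (side1 : pred V1) (side2 : pred V2) (n : nat).
Hypothesis e1_side : forall x y, e1 x y -> side1 x != side1 y.
Hypothesis e2_side : forall x y, e2 x y -> side2 x != side2 y.
Hypothesis n_gt2 : 2 < n.

Lemma fstep_extend S S' q T T' q' h :
  fstep e1 n S S' q -> fstep e2 n T T' q' -> iso_on e1 e2 S h -> h @` S = T ->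
  exists h', [/\ forall x, S x -> h' x = h x, iso_on e1 e2 S' h', h' @` S' = T' &
    forall x y k, far e1 n S x y -> k <= n.-1 -> h' (q x y k) = q' (h x) (h y) k].
Proof.
move=> Sq Tq ih hST; have [hi he] := ih.
have [[q0 qr qn qi] S'E eE] := Sq; have [[q0' qr' qn' qi'] T'E eE'] := Tq.
have farh x y : far e1 n S x y -> far e2 n T (h x) (h y).
  by rewrite -hST => /(iso_far_half ih); apply.
(* A new vertex has just two descriptions, and the symmetry of [q'] sends both to the same point. *)
have /choice[h' h'P] z : exists w, (S z -> w = h z) /\
    forall x y k, far e1 n S x y -> 0 < k < n.-1 -> z = q x y k -> w = q' (h x) (h y) k.
  have [Sz|nSz] := pselect (S z).
    by exists (h z); split=> // x y k fxy kn zE; case: (qn _ _ _ fxy kn); rewrite -zE.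
  have [[x [y [k [fxy kn zE]]]]|nz] := pselect (exists x y k,
      [/\ far e1 n S x y, 0 < k < n.-1 & z = q x y k]); last first.
    exists (h z); split=> // x y k fxy kn zE; case: nz; exists x, y, k.
    by split.
  exists (q' (h x) (h y) k); split=> // x1 y1 k1 fxy1 kn1; rewrite zE => E.
  have [[-> -> ->//]|[-> -> ->]] := qi _ _ _ _ _ _ fxy kn fxy1 kn1 E.
  by rewrite (qr' (h x) (h y)) ?subKn //; [lia | exact: farh | lia].
have hS x : S x -> h' x = h x by case: (h'P x) => + _; apply.
have hq x y k : far e1 n S x y -> k <= n.-1 -> h' (q x y k) = q' (h x) (h y) k.
  move=> fxy; have [Sx Sy _ _] := fxy; have fh := farh _ _ fxy.
  have [->|k0] := posnP k; first by rewrite (q0 _ _ fxy).1 (q0' _ _ fh).1 hS.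
  rewrite leq_eqVlt => /predU1P[->|kn]; first by rewrite (q0 _ _ fxy).2 (q0' _ _ fh).2 hS.
  by case: (h'P (q x y k)) => _; apply; rewrite // k0.
have T_S z : S' z -> T (h' z) -> S z.
  move=> S'z Tz; apply: contrapT => nSz.
  have [x [y [k [fxy kn zE]]]] := fstep_newP Sq S'z nSz.
  by apply: (qn' _ _ _ (farh _ _ fxy) kn); rewrite -hq -?zE //; lia.
have S_T z : S z -> T (h' z) by move=> Sz; rewrite -hST hS //; exists z.
have h'i x y : S' x -> S' y -> h' x = h' y -> x = y.
  move=> S'x S'y E; have [Sx|nSx] := pselect (S x).
    have Sy : S y by apply: T_S => //; rewrite -E; exact: S_T.
    by apply: hi => //; rewrite -!hS.
  have nSy : ~ S y by move=> /S_T; rewrite -E => /(T_S _ S'x).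
  have [x1 [y1 [k1 [fxy1 kn1 xE]]]] := fstep_newP Sq S'x nSx.
  have [x2 [y2 [k2 [fxy2 kn2 yE]]]] := fstep_newP Sq S'y nSy.
  have [Sx1 Sy1 _ _] := fxy1; have [Sx2 Sy2 _ _] := fxy2.
  move: E; rewrite xE yE !hq //; try lia.
  move=> /(qi' _ _ _ _ _ _ (farh _ _ fxy1) kn1 (farh _ _ fxy2) kn2).
  case=> -[/hi E1 /hi E2 E3].
    by rewrite (E1 Sx2 Sx1) (E2 Sy2 Sy1) E3.
  rewrite (E1 Sx2 Sy1) (E2 Sy2 Sx1) E3 (qr x1 y1 _ fxy1) ?leq_subr // subKn //.
  by lia.
exists h'; split=> //.
- split=> // u v Su Sv; apply/idP/idP => [|/(eE u v Su Sv)].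
    have T'h z : S' z -> T' (h' z).
      move=> S'z; apply/T'E; have [Sz|nSz] := pselect (S z); first by left; exact: S_T.
      have [x [y [k [fxy kn zE]]]] := fstep_newP Sq S'z nSz.
      by right; exists (h x), (h y), k; split=> //; [exact: farh | rewrite zE hq //; lia].
    move=> /(eE' _ _ (T'h _ Su) (T'h _ Sv)).
    case=> [[/(T_S _ Su) Su' /(T_S _ Sv) Sv']|]; first by rewrite !hS // he.
    move=> [_x [_y [k [fxy kn uE vE]]]].
    have [] := fxy; rewrite -hST => -[x Sx xE] [y Sy yE] _ _.
    rewrite -{}xE -{}yE -{1}hST in fxy uE vE.
    have {}fxy : far e1 n S x y by apply/(iso_far n ih).
    rewrite -hq in uE vE *; try lia; try exact: fxy.
    have uE' : u = q x y k.
      by apply: h'i => //; apply: (fstep_in Sq fxy); lia.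
    have vE' : v = q x y k.+1.
      by apply: h'i; rewrite ?vE ?hq //; apply: (fstep_in Sq fxy).
    by apply/(eE u v Su Sv); right; exists x, y, k.
  case=> [[Su' Sv' euv]|[x [y [k [fxy kn -> ->]]]]]; first by rewrite !hS // he.
  have fh := farh _ _ fxy.
  rewrite !hq //; try lia.
  apply/eE'; [apply: (fstep_in Tq fh); lia | apply: (fstep_in Tq fh); lia |].
  by right; exists (h x), (h y), k.
rewrite eqEsubset; split=> [_ [z S'z <-]|w /T'E].
  apply/T'E; have [Sz|nSz] := pselect (S z); first by left; exact: S_T.
  have [x [y [k [fxy kn zE]]]] := fstep_newP Sq S'z nSz.
  by right; exists (h x), (h y), k; split=> //; [exact: farh | rewrite zE hq //; lia].
case=> [|[_x [_y [k [fxy kn wE]]]]].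
  by rewrite -hST => -[x Sx <-]; exists x; [exact: fstep_sub Sq _ Sx | rewrite hS].
have [] := fxy; rewrite -hST => -[x Sx xE] [y Sy yE] _ _.
rewrite -{}xE -{}yE -{1}hST in fxy wE.
have {}fxy : far e1 n S x y by apply/(iso_far n ih).
exists (q x y k); first by apply: (fstep_in Sq fxy); lia.
by rewrite hq //; lia.
Qed.

Definition side_on (A : set V1) h := forall x, A x -> side2 (h x) = side1 x.

(** The side of a path vertex is determined by the side of the first end and the parity of the
    position. *)
Lemma fstep_extend_side S S' q T T' q' h :
  fstep e1 n S S' q -> fstep e2 n T T' q' -> iso_on e1 e2 S h -> h @` S = T ->
  side_on S h ->
  exists h', [/\ forall x, S x -> h' x = h x, iso_on e1 e2 S' h', h' @` S' = T' &
    side_on S' h'].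
Proof.
move=> Sq Tq ih hST sh; have [h' [hS ih' hS'T' hq]] := fstep_extend Sq Tq ih hST.
exists h'; split=> // z S'z; have [Sz|nSz] := pselect (S z); first by rewrite hS // sh.
have [x [y [k [fxy kn ->]]]] := fstep_newP Sq S'z nSz.
have fh : far e2 n T (h x) (h y) by rewrite -hST; exact: (iso_far_half ih).
rewrite hq //; last by lia.
have [[Wq eq] _] := fstep_nbw n_gt2 Sq fxy; have [[Wq' eq'] _] := fstep_nbw n_gt2 Tq fh.
have w1 : walk e1 S' (q x y) k by split=> i ik; [apply: Wq | apply: eq]; lia.
have w2 : walk e2 T' (q' (h x) (h y)) k by split=> i ik; [apply: Wq' | apply: eq']; lia.
rewrite (walk_side e1_side w1) (walk_side e2_side w2).
rewrite (fstep_q0 Sq fxy) (fstep_q0 Tq fh) sh //.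
by case: fxy.
Qed.

Lemma chain_extend (F : nat -> set V1) (F' : nat -> set V2) q q' h0 :
  (forall j, fstep e1 n (F j) (F j.+1) (q j)) ->
  (forall j, fstep e2 n (F' j) (F' j.+1) (q' j)) ->
  iso_on e1 e2 (F 0) h0 -> h0 @` F 0 = F' 0 -> side_on (F 0) h0 ->
  exists h, [/\ forall x, F 0 x -> h x = h0 x, iso_on e1 e2 (\bigcup_j F j) h,
    h @` (\bigcup_j F j) = \bigcup_j F' j & side_on (\bigcup_j F j) h].
Proof.
move=> Fq Fq' ih0 hF0 sh0.
pose ok j h := [/\ iso_on e1 e2 (F j) h, h @` F j = F' j & side_on (F j) h].
have /choice[st stP] (jh : nat * (V1 -> V2)) : exists h', ok jh.1 jh.2 ->
    ok jh.1.+1 h' /\ forall x, F jh.1 x -> h' x = jh.2 x.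
  have [[ih hF sh]|nok] := pselect (ok jh.1 jh.2); last by exists jh.2.
  have [h' [hS ih' hF' sh']] := fstep_extend_side (Fq jh.1) (Fq' jh.1) ih hF sh.
  by exists h'.
pose hs := fix hs j := if j is j'.+1 then st (j', hs j') else h0.
have hsok j : ok j (hs j) by elim: j => // j IH; case: (stP (j, hs j) IH).
have hsS j x : F j x -> hs j.+1 x = hs j x by case: (stP (j, hs j) (hsok j)) => _; apply.
have Fm := stages_mono Fq.
have hsm i j x : i <= j -> F i x -> hs j x = hs i x.
  move=> + Fx; elim: j => [|j IH]; first by rewrite leqn0 => /eqP ->.
  rewrite leq_eqVlt ltnS => /predU1P[->//|ij].
  by rewrite hsS ?IH //; exact: Fm ij _ Fx.
have /choice[h hP] x : exists w, forall j, F j x -> w = hs j x.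
  have [[j Fj]|nF] := pselect (exists j, F j x); last first.
    by exists (h0 x) => j Fj; case: nF; exists j.
  exists (hs j x) => i Fi; have [ij|/ltnW ji] := leqP i j; first exact: hsm.
  by rewrite -(hsm _ _ _ ji).
have two x y : (\bigcup_j F j) x -> (\bigcup_j F j) y -> exists j, F j x /\ F j y.
  move=> [i _ Fi] [j _ Fj]; exists (maxn i j).
  by split; [apply: Fm Fi; exact: leq_maxl | apply: Fm Fj; exact: leq_maxr].
exists h; split.
- by move=> x /hP.
- split=> x y Fx Fy; have [j [Fjx Fjy]] := two _ _ Fx Fy; have [[hi he] _ _] := hsok j.
    by rewrite (hP _ _ Fjx) (hP _ _ Fjy); exact: hi.
  by rewrite (hP _ _ Fjx) (hP _ _ Fjy) he.
- rewrite eqEsubset; split=> [_ [x [j _ Fx] <-]|w [j _]].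
    by exists j => //; rewrite (hP _ _ Fx); have [_ <- _] := hsok j; exists x.
  by have [_ <- _] := hsok j => -[x Fx <-]; exists x; [exists j | rewrite (hP _ _ Fx)].
- by move=> x [j _ Fx]; rewrite (hP _ _ Fx); have [_ _ sh] := hsok j; exact: sh.
Qed.

End Extend.

(** * Generalized polygons and their [L_n]-functions *)

Lemma ex_walk_min (V : Type) (e : rel V) P x y :
  (exists g L, [/\ walk e P g L, g 0 = x & g L = y]) ->
  exists g L, [/\ nbw e P g L, g 0 = x, g L = y &
    forall h M, walk e P h M -> h 0 = x -> h M = y -> L <= M].
Proof.
move=> [g [L [wg g0 gL]]]; have [h [M [bh ML h0 hM hmin]]] := ex_shortest wg.
exists h, M; split=> //; [exact: etrans h0 g0 | exact: etrans hM gL |].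
by move=> u K wu u0 uK; apply: (hmin u K) => //; rewrite ?g0 ?gL.
Qed.

Definition wcons (V : Type) (x : V) (g : nat -> V) i := if i is j.+1 then g j else x.

Lemma walk_cons (V : Type) (e : rel V) (P : set V) x g L : P x -> e x (g 0) ->
  walk e P g L -> walk e P (wcons x g) L.+1.
Proof. by move=> Px exg [Pg eg]; split=> -[|i] //= iL; [exact: Pg | exact: eg]. Qed.

Lemma is_cycle_walk (V : choiceType) (e : rel V) c : is_cycle e c ->
  exists g, [/\ forall i, e (g i) (g i.+1), forall i, g (i + size c) = g i,
    forall i, g i <> g i.+2 & forall i, g i \in c].
Proof.
case=> /andP[]; case: c => [|x p] // ec uc c2.
pose L := size (x :: p); have L2 : 2 < L by [].
have sL i : i %% L < L by rewrite ltn_pmod; lia.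
have modS i : i.+1 %% L = if (i %% L).+1 < L then (i %% L).+1 else 0.
  rewrite -addn1 -modnDml addn1; case: ifP => h; first by rewrite modn_small.
  have -> : (i %% L).+1 = L by have := sL i; lia.
  by rewrite modnn.
exists (fun i => nth x (x :: p) (i %% L)); split.
- move=> i; rewrite modS; move/(pathP x): ec => ec.
  have := ec (i %% L); rewrite size_rcons => /(_ (sL i)).
  have nr k : nth x (rcons p x) k = nth x p k.
    by rewrite nth_rcons if_same; case: ltnP => // h; rewrite nth_default.
  rewrite nr -rcons_cons nth_rcons (sL i); case: ifP => // h.
  by rewrite [nth x p _]nth_default //=; have := sL i; rewrite /L /= in h *; lia.
- by move=> i; rewrite modnDr.
- move=> i /eqP; rewrite nth_uniq //; try exact: sL.
  move: (modS i.+1) (sL i); rewrite (modS i) => -> iL /eqP.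
  by case: (ltnP (i %% L).+1 L) => h; case: ifP; lia.
- by move=> i; apply: mem_nth; exact: sL.
Qed.

Lemma periodicM (T : Type) (c : nat -> T) m : (forall i, c (i + m) = c i) ->
  forall a i, c (i + a * m) = c i.
Proof. by move=> cm; elim=> [|a IH] i; rewrite ?addn0 // mulSn addnA IH. Qed.

Lemma periodic_mod (T : Type) (c : nat -> T) m : (forall i, c (i + m) = c i) ->
  forall i, c (i %% m) = c i.
Proof. by move=> cm i; rewrite {2}(divn_eq i m) addnC periodicM. Qed.

Lemma mkseq_cycle (V : choiceType) (e : rel V) g L : 2 < L ->
  (forall i, g (i + L) = g i) -> (forall i, e (g i) (g i.+1)) ->
  (forall i j, i < j < L -> g i <> g j) -> is_cycle e (mkseq g L).
Proof.
move=> L2 gL eg ginj; split; last by rewrite size_mkseq.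
apply/andP; split; last first.
  apply/mkseq_uniqP => i j; rewrite !inE => iL jL E; apply: contrapT => ij.
  by have [/ginj/(_ E)|/ginj/(_ (esym E))] : i < j < L \/ j < i < L by lia.
case: L {ginj} L2 gL => // L L2 gL; rewrite /mkseq /=.
apply/(pathP (g 0)) => i; rewrite size_rcons size_map size_iota => iL.
rewrite -rcons_cons !nth_rcons /= size_map size_iota iL.
have -> : nth (g 0) (g 0 :: [seq g i | i <- iota 1 L]) i = g i.
  by case: i iL => [|i] iL //=; rewrite (nth_map 0) ?size_iota ?nth_iota // add1n.
case: ifP => iL'; first by rewrite (nth_map 0) ?size_iota ?nth_iota // add1n.
have -> : i = L by lia.
by rewrite eqxx -(gL 0).
Qed.

Lemma tf_of_no_cycle (V : choiceType) (e : rel V) (side : pred V) n S :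
  (forall x y, e x y -> side x != side y) ->
  no_cycle_shorter_than (induced e S) n.*2 -> tf e n S.
Proof.
move=> eside nc; apply: (tf_periodic eside) => g L /andP[L2 Ln] _ gL Sg eg ginj.
suff : n.*2 <= L by lia.
rewrite -(size_mkseq g L); apply: nc; apply: mkseq_cycle => // [i|i j ij].
  by rewrite /induced !mem_set // eg.
by apply: ginj; lia.
Qed.

Lemma no_cycle_of_tf (V : choiceType) (e : rel V) n S : tf e n S ->
  no_cycle_shorter_than (induced e S) n.*2.
Proof.
move=> tS c cc; have [g [eg gc gn _]] := is_cycle_walk cc.
rewrite leqNgt; apply/negP => cn; have [_ c2] := cc.
apply: (tS g (size c)); [by lia | | by rewrite -(gc 0)].
split; last by move=> i _; exact: gn.
by apply/walk_induced; [lia | split].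
Qed.

(** A polygon carried by the vertices [Om], all other points being isolated. The tower needs this
    form, since its type contains trees that occur at no stage. The 2n-cycle is given as a periodic
    walk. *)
Definition gonlike n (D : bigraph) (Om : set D) :=
  [/\ forall x y : D, adj x y -> Om x, tf (@adj D) n Om,
      forall x y, Om x -> Om y ->
        exists g L, [/\ walk (@adj D) Om g L, g 0 = x, g L = y & L <= n]
    & exists c : nat -> D, [/\ forall i, adj (c i) (c i.+1),
        forall i, c (i + n.*2) = c i & forall i, c i <> c i.+2]].

Section Gonlike.
Variables (n : nat) (D : bigraph) (Om : set D).
Hypothesis n_gt2 : 2 < n.
Hypothesis gD : gonlike n Om.
Local Notation e := (@adj D).
Let eC : symmetric e := @adj_sym D.
Let eside := @adj_side D.
Implicit Types (x y : D) (g h : nat -> D).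

Lemma gon_walk g L : Om (g 0) -> walk e setT g L -> walk e Om g L.
Proof.
case: gD => eOm _ _ _ g0 [_ eg]; split=> // i iL.
have [->//|i0] := posnP i; apply: (eOm _ (g i.-1)).
by rewrite eC -{2}(prednK i0); apply: eg; lia.
Qed.

Lemma gon_path x y p : Om x -> path_from_to e x y p ->
  exists g, [/\ walk e Om g (size p), g 0 = x, g (size p) = y &
    forall i, g i = nth x (x :: p) i].
Proof.
move=> Ox /path_walk [g [wg g0 gL gi]]; exists g; split=> //.
by apply: gon_walk => //; rewrite g0.
Qed.

(* Opposite vertices are joined by several geodesics, because in the presence
   of a [2n]-cycle every vertex has at least two neighbours. *)
Lemma gon_opposite x y g : walk e Om g n -> g 0 = x -> g n = y ->
  (forall h M, walk e Om h M -> h 0 = x -> h M = y -> n <= M) ->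
  exists2 h, walk e Om h n /\ h 0 = x /\ h n = y & h 1 <> g 1.
Proof.
case: gD => eOm tD diam [c [ec cper cn]] wg g0 gn gmin; have [Og eg] := wg.
have Ox : Om x by rewrite -g0; apply: Og.
have Oy : Om y by rewrite -gn; apply: Og.
have exg : e x (g 1) by rewrite -g0; apply: eg; lia.
have [[x2 exx2 x2x1]|nox2] := pselect (exists2 x2, e x x2 & x2 <> g 1).
  have Ox2 : Om x2 by apply: (eOm _ x); rewrite eC.
  have [h [L [wh h0 hL Ln]]] := diam _ _ Ox2 Oy.
  have wc : walk e Om (wcons x h) L.+1 by apply: walk_cons => //; rewrite h0.
  have := walk_odd eside wc wg; rewrite g0 gn /= hL => /(_ erefl erefl) od.
  have := gmin _ _ wc erefl hL; rewrite leq_eqVlt => /predU1P[E|nL].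
    by exists (wcons x h); rewrite /= ?h0 // E.
  have LE : L = n by lia.
  by move: od; rewrite LE /=; case: odd.
(* If [g 1] is the only neighbour of [x], every [c i] is at distance less than n from [g 1]. At a
   vertex of the cycle farthest from [g 1] both neighbours on the cycle are nearer by one, which
   gives two distinct short geodesics to it. *)
have x1 z : e x z -> z = g 1 by move=> exz; apply: contrapT => ?; apply: nox2; exists z.
have Oc i : Om (c i) by apply: eOm (ec i).
have Og1 : Om (g 1) by apply: Og; lia.
have /choice[m mP] i : exists k, k < n /\ exists h, [/\ nbw e Om h k, h 0 = g 1, h k = c i &
    forall h' M, walk e Om h' M -> h' 0 = g 1 -> h' M = c i -> k <= M].
  have [|h [k [bh h0 hk hmin]]] := @ex_walk_min _ e Om (g 1) (c i).
    have [u [L [wu u0 uL _]]] := diam _ _ Og1 (Oc i).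
    by exists u, L.
  exists k; split; last by exists h.
  have [u [L [wu u0 uL Ln]]] := diam _ _ Ox (Oc i).
  case: L wu uL Ln => [|L] wu uL Ln.
    have : walk e Om (wcons (g 1) u) 1.
      by apply: walk_cons => //; rewrite u0 eC.
    by move=> /hmin; rewrite /= uL => /(_ erefl erefl); lia.
  have wu' : walk e Om (fun i => u (1 + i)) L by apply: walk_sub wu _.
  have /x1 u1 : e x (u 1) by rewrite -u0; have [_ eu] := wu; apply: eu.
  by have := hmin _ _ wu'; rewrite /= addn0 add1n => /(_ u1 uL); lia.
have [i imax] : exists i, forall j, m j <= m i.
  have [|k [i <-] kmin] := @ex_least (fun k => exists i, n - m i = k).
    by exists (n - m 0), 0.
  exists i => j; rewrite leqNgt; apply/negP => ij.
  by apply: (kmin (n - m j)); [have := (mP j).1; lia | exists j].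
(* By periodicity this is the position before [i], reached without subtracting from [i]. *)
pose p := i + n.*2.-1.
have pE : c p.+1 = c i by rewrite -(cper i) -addnS prednK //; lia.
have [_ [h [bh h0 hk hmin]]] := mP p.
have [mi [u [bu u0 uk umin]]] := mP i.
have [_ [h' [bh' h0' hk' hmin']]] := mP p.+2.
have [pi p2i] := (imax p, imax p.+2).
have step f k : walk e Om f k -> f 0 = g 1 -> e (f k) (c i) ->
    k <= m i -> walk e Om (fun j => if j <= k then f j else c i) k.+1 /\ m i = k.+1.
  move=> wf f0 ef ki.
  have we : walk e Om (wcons (f k) (fun=> c i)) 1.
    by apply: walk_cons => //; exact: wf.1.
  have wf2 := walk_cat wf we erefl.
  have E : wcat f k (wcons (f k) (fun=> c i)) =1 (fun j => if j <= k then f j else c i).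
    move=> j; rewrite /wcat; case: leqP => // kj.
    by rewrite -(subnSK kj).
  rewrite addn1 in wf2.
  have {}wf2 : walk e Om (fun j => if j <= k then f j else c i) k.+1.
    by rewrite -(funext E).
  split=> //; have := umin _ _ wf2; rewrite ltnn /= f0 => /(_ erefl erefl).
  rewrite leq_eqVlt => /predU1P[//|mk].
  have mk' : m i = k by lia.
  have := walk_odd eside wf2 bu.1; rewrite /= ltnn f0 u0 uk => /(_ erefl erefl).
  by rewrite mk' /=; case: odd.
have e1 : e (h (m p)) (c i) by rewrite hk -pE; apply: ec.
have e2 : e (h' (m p.+2)) (c i) by rewrite hk' -pE eC; apply: ec.
have [w1 m1] := step h _ bh.1 h0 e1 pi.
have [w2 m2] := step h' _ bh'.1 h0' e2 p2i.
have mm : m p.+2 = m p by lia.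
rewrite mm in w2 hk'.
have b1 : nbw e Om (fun j => if j <= m p then h j else c i) (m p).+1.
  by apply: min_nbw => // v M wv; rewrite /= ltnn h0 -m1; apply: umin.
have b2 : nbw e Om (fun j => if j <= m p then h' j else c i) (m p).+1.
  by apply: min_nbw => // v M wv; rewrite /= ltnn h0' -m1; apply: umin.
have [_ E] := uniq_nbw eC tD b1 b2 ltac:(by rewrite /= h0 h0')
  ltac:(by rewrite /= ltnn) ltac:(lia).
have := E (m p) (leqnSn _); rewrite /= leqnn hk hk' => /cn.
by [].
Qed.

Lemma path_mkseq g L x : g 0 = x ->
  forall k, k <= L -> nth x (x :: mkseq (fun i => g i.+1) L) k = g k.
Proof. by move=> g0 [|k] kL //=; rewrite nth_mkseq. Qed.

Lemma short_unique g L : nbw e Om g L -> L < n ->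
  unique_shortest_path e (g 0) (g L) (mkseq (fun i => g i.+1) L).
Proof.
move=> bg Ln; have [_ tD _ _] := gD; have [[Og eg] _] := bg.
have O0 : Om (g 0) by apply: Og.
have mn h M : walk e Om h M -> h 0 = g 0 -> h M = g L -> L <= M.
  move=> /ex_shortest [f [N [bf NM f0 fN _]]] h0 hM.
  have [MN|NL] := leqP L N; first by lia.
  have [] := uniq_nbw eC tD bf bg; rewrite ?f0 ?fN ?h0 ?hM //; lia.
have sp : shortest_path e (g 0) (g L) (mkseq (fun i => g i.+1) L).
  split; first by apply: walk_path; split=> //; exact: eg.
  by move=> q /(gon_path O0) [h [wh h0 hL _]]; rewrite size_mkseq; apply: mn wh h0 hL.
split=> // q [pq qmin].
have [h [wh h0 hL hi]] := gon_path O0 pq.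
have sq : size q = L.
  have := qmin _ sp.1; rewrite size_mkseq => qL.
  by apply/eqP; rewrite eqn_leq qL (mn _ _ wh h0 hL).
rewrite sq in wh hL.
have bh : nbw e Om h L by apply: min_nbw => // u M wu; rewrite h0 hL; apply: mn.
have [_ gh] := uniq_nbw eC tD bg bh (esym h0) (esym hL) ltac:(lia).
apply: (@eq_from_nth _ (g 0)); first by rewrite size_mkseq sq.
by move=> i; rewrite sq => iL; rewrite nth_mkseq // (gh i.+1 iL) (hi i.+1).
Qed.

Lemma Ln_short (k : 'I_n.+1) g L : nbw e Om g L -> L < n ->
  @Ln_f n (Ln_of n D) k (g 0) (g L) = if k <= L then g k else g 0.
Proof.
move=> bg Ln; have us := short_unique bg Ln.
rewrite /=; case: xgetP => [z _ [p [up kp ->]]|nz].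
  have pE : p = mkseq (fun i => g i.+1) L by have [_] := us; apply; case: up.
  by move: kp; rewrite pE size_mkseq => kL; rewrite kL path_mkseq.
case: ifP => // kL; case: (nz (g k)); exists (mkseq (fun i => g i.+1) L).
by rewrite size_mkseq path_mkseq.
Qed.

(** Opposite vertices have several geodesics by [gon_opposite], so every function takes its default
    value. *)
Lemma Ln_far (k : 'I_n.+1) x y : Om x -> Om y ->
  (forall g L, walk e Om g L -> g 0 = x -> g L = y -> n <= L) ->
  @Ln_f n (Ln_of n D) k x y = x.
Proof.
move=> Ox Oy fxy; rewrite /=; case: xgetP => // z _ [p [[[pp pmin] up] _ _]].
have [_ _ diam _] := gD.
have [g [wg g0 gL gi]] := gon_path Ox pp.
have sp : size p = n.
  apply/eqP; rewrite eqn_leq (fxy _ _ wg g0 gL) andbT.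
  have [h [M [wh h0 hM Mn]]] := diam _ _ Ox Oy.
  apply: leq_trans Mn; rewrite -(size_mkseq (fun i => h i.+1) M); apply: pmin.
  by rewrite -h0 -hM; apply: walk_path; split=> //; case: wh.
rewrite sp in wg gL.
have [h [wh [h0 hn]] h1] := gon_opposite wg g0 gL fxy.
case: h1; rewrite gi -(up (mkseq (fun i => h i.+1) n)).
  by rewrite path_mkseq //; lia.
split; first by rewrite -h0 -hn; apply: walk_path; split=> //; case: wh.
by move=> q /pmin; rewrite size_mkseq sp.
Qed.

Lemma gon_dichotomy x y : Om x -> Om y ->
  (exists g L, [/\ nbw e Om g L, L < n, g 0 = x & g L = y]) \/
  (forall g L, walk e Om g L -> g 0 = x -> g L = y -> n <= L).
Proof.
move=> Ox Oy; have [_ _ diam _] := gD.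
have [g [M [wg g0 gM Mn]]] := diam _ _ Ox Oy.
have [|h [L [bh h0 hL hmin]]] := @ex_walk_min _ e Om x y; first by exists g, M.
have [Ln|nL] := ltnP L n; first by left; exists h, L.
by right=> u K wu u0 uK; apply: leq_trans nL (hmin _ _ wu u0 uK).
Qed.

Lemma closed_in_Ln (A : set D) : closed_in e n Om A -> @Ln_closed n (Ln_of n D) A.
Proof.
move=> [AO cA] k x y Ax Ay.
have [[g [L [bg Ln g0 gL]]]|fxy] := gon_dichotomy (AO _ Ax) (AO _ Ay).
  rewrite -g0 -gL (Ln_short k bg Ln); case: ifP => kL; last by rewrite g0.
  by apply: (cA _ _ Ln bg); rewrite ?g0 ?gL.
by rewrite Ln_far //; exact: AO.
Qed.

Lemma Ln_closed_in (A : set D) : A `<=` Om -> @Ln_closed n (Ln_of n D) A ->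
  closed_in e n Om A.
Proof.
move=> AO cA; split=> // g L Ln bg A0 AL i iL.
have ni : i < n.+1 by lia.
by have := cA (Ordinal ni) _ _ A0 AL; rewrite (Ln_short _ bg Ln) /= iL.
Qed.

(** Adjacency is not in the language but is recovered from [f_1]. The value [y] is also the default
    one when [x = y], which therefore has to be excluded. *)
Lemma adj_Ln x y : Om x -> Om y ->
  e x y <-> @Ln_f n (Ln_of n D) (inord 1) x y = y /\ x <> y.
Proof.
move=> Ox Oy; split=> [exy|[fE xy]].
  have bg : nbw e Om (wcons x (fun=> y)) 1.
    by split=> //; apply: walk_cons => //; split.
  have := Ln_short (inord 1) bg; rewrite /= inordK; last by lia.
  move=> /(_ ltac:(lia)) ->; split=> // E.
  by have := eside exy; rewrite E eqxx.
have [[g [L [bg Ln g0 gL]]]|fxy] := gon_dichotomy Ox Oy; last first.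
  by move: fE; rewrite Ln_far // => /xy.
move: fE; rewrite -{1}g0 -{1}gL (Ln_short _ bg Ln) inordK; last by lia.
case: ifP => [L1 g1|_]; last by rewrite g0.
by rewrite -g0 -g1; have [[_ eg] _] := bg; apply: eg.
Qed.

End Gonlike.

Definition emb n (M N : Ln_struct n) (A : set M) (h : M -> N) :=
  [/\ forall x y, A x -> A y -> h x = h y -> x = y,
      forall x, A x -> Ln_P (h x) = Ln_P x
    & forall k x y, A x -> A y -> h (Ln_f k x y) = Ln_f k (h x) (h y)].

Lemma gonlike_of_gon n (D : bigraph) : 2 < n -> generalized_gon n D ->
  gonlike n [set: D].
Proof.
move=> n2 [[diam _] [[c cc cn] nc]]; split=> //.
- apply: (tf_of_no_cycle (@adj_side D)) => s cs; apply: nc.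
  suff -> : @adj D = induced (@adj D) setT by [].
  by apply/funext => x; apply/funext => y; rewrite /induced !in_setT.
- move=> x y _ _; have [l ln [p [pp _] sp]] := diam x y.
  have [g [wg g0 gL _]] := path_walk pp.
  by exists g, (size p); split=> //; rewrite sp.
- by have [g [ge gc gn _]] := is_cycle_walk cc; exists g; rewrite -cn.
Qed.

Lemma cycle_inj n (D : bigraph) (Om : set D) c : tf (@adj D) n Om ->
  (forall i, adj (c i) (c i.+1)) -> (forall i, Om (c i)) ->
  (forall i, c i <> c i.+2) -> forall i j, i < j < n.*2 -> c i <> c j.
Proof.
move=> tD ec Oc cn i j ij.
by apply: (nbw_inj tD (g := c) (L := n.*2.-1)); [split; [split|]| lia | lia].
Qed.

Lemma gon_of_gonlike n (D : bigraph) : 2 < n -> gonlike n [set: D] ->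
  generalized_gon n D.
Proof.
move=> n2 [_ tD diam [c [ec cper cn]]].
have eC := @adj_sym D.
have bc L : nbw (@adj D) setT c L by split=> //; split.
have cinj := cycle_inj tD ec (fun=> I) cn.
split; split.
- move=> x y; have [g [L [wg g0 gL Ln]]] := diam x y I I.
  have [|h [M [bh h0 hM hmin]]] := @ex_walk_min _ (@adj D) setT x y; first by exists g, L.
  exists M; first exact: leq_trans (hmin _ _ wg g0 gL) Ln.
  exists (mkseq (fun i => h i.+1) M); last by rewrite size_mkseq.
  split; first by rewrite -h0 -hM; exact: walk_path bh.1.
  by move=> q /path_walk[u [wu u0 uL _]]; rewrite size_mkseq; exact: hmin wu u0 uL.
- move=> m /(_ (c 0) (c n)) [l lm [p [pp _] sp]].
  have [g [wg g0 gL _]] := path_walk pp.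
  have [h [M [bh ML h0 hM _]]] := ex_shortest wg.
  rewrite leqNgt; apply/negP => mn.
  have [|||E _] := uniq_nbw eC tD bh (bc n); rewrite ?h0 ?hM //; lia.
- exists (mkseq c n.*2); last by rewrite size_mkseq.
  by apply: mkseq_cycle => //; lia.
- move=> s; have := no_cycle_of_tf tD (c := s).
  suff <- : @adj D = induced (@adj D) setT by [].
  by apply/funext => x; apply/funext => y; rewrite /induced !in_setT.
Qed.

Section Embeddings.
Variables (n : nat) (D1 D2 : bigraph) (Om1 : set D1) (Om2 : set D2).
Hypothesis n_gt2 : 2 < n.
Hypothesis g1 : gonlike n Om1.
Hypothesis g2 : gonlike n Om2.

(** Short geodesics stay in the closed sets and are carried over by [h]; at distance n both sides
    take the default value. *)
Lemma emb_iso A h : closed_in (@adj D1) n Om1 A -> closed_in (@adj D2) n Om2 (h @` A) ->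
  iso_on (@adj D1) (@adj D2) A h -> side_on (@side D1) (@side D2) A h ->
  @emb n (Ln_of n D1) (Ln_of n D2) A h.
Proof.
move=> [AO cA] [hAO chA] ih sh; have [hi he] := ih; split=> // k x y Ax Ay.
have hA z : A z -> (h @` A) (h z) by move=> Az; exists z.
have [[g [L [bg Ln g0 gL]]]|fxy] := gon_dichotomy g1 (AO _ Ax) (AO _ Ay).
  have Ag := cA _ _ Ln bg; rewrite g0 gL in Ag.
  have bhg := nbwS hAO (iso_nbw ih (@subset_refl _ A) (nbw_in bg (Ag Ax Ay))).
  have := Ln_short n_gt2 g2 k bhg Ln; rewrite /= g0 gL => ->.
  by have := Ln_short n_gt2 g1 k bg Ln; rewrite /= g0 gL => ->; case: ifP.
rewrite (Ln_far n_gt2 g1 k (AO _ Ax) (AO _ Ay) fxy).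
rewrite (Ln_far n_gt2 g2 k) //; try by apply: hAO; exact: hA.
have [[u [L [bu Ln u0 uL]]]|//] :=
  gon_dichotomy g2 (hAO _ (hA _ Ax)) (hAO _ (hA _ Ay)).
have := chA _ _ Ln bu; rewrite u0 uL => /(_ (hA _ Ax) (hA _ Ay)) Au.
have [g [gK ig]] := iso_inv x ih.
have [wgu _] := iso_nbw ig (@subset_refl _ (h @` A)) (nbw_in bu Au).
have gA : g @` (h @` A) `<=` Om1 by rewrite (iso_image_cancel (@subset_refl _ A) gK).
by have := fxy _ _ (walkS gA wgu); rewrite u0 uL !gK // => /(_ erefl erefl); lia.
Qed.

Lemma iso_emb A h : closed_in (@adj D1) n Om1 A -> h @` A `<=` Om2 ->
  @emb n (Ln_of n D1) (Ln_of n D2) A h ->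
  iso_on (@adj D1) (@adj D2) A h /\ side_on (@side D1) (@side D2) A h.
Proof.
move=> cA hAO [hi hP hf]; have [AO _] := cA; split=> //; split=> // x y Ax Ay.
have Oh z : A z -> Om2 (h z) by move=> Az; apply: hAO; exists z.
apply/idP/idP.
  move=> /(adj_Ln n_gt2 g2 (Oh _ Ax) (Oh _ Ay)) [fE xy].
  apply/(adj_Ln n_gt2 g1 (AO _ Ax) (AO _ Ay)); split; last by move=> E; apply: xy; rewrite E.
  have Af := closed_in_Ln n_gt2 g1 cA (inord 1) Ax Ay.
  by apply: hi => //; rewrite hf.
move=> /(adj_Ln n_gt2 g1 (AO _ Ax) (AO _ Ay)) [fE xy].
apply/(adj_Ln n_gt2 g2 (Oh _ Ax) (Oh _ Ay)); split; last by move=> E; apply: xy; exact: hi.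
by rewrite -hf // fE.
Qed.

End Embeddings.

(** * Closed subsets as polygons in their own right *)

Section SubBigraph.
Variables (D : bigraph) (A : set D).

Definition sub_adj (x y : set_type A) := adj (set_val x) (set_val y).

Lemma sub_adj_sym : symmetric sub_adj.
Proof. by move=> x y; exact: adj_sym. Qed.

Lemma sub_adj_side (x y : set_type A) : sub_adj x y ->
  side (set_val x) != side (set_val y).
Proof. exact: adj_side. Qed.

Definition sub_bigraph : bigraph :=
  BiGraph (side := fun x : set_type A => side (set_val x)) sub_adj_sym sub_adj_side.

Lemma set_val_iso : iso_on (@adj sub_bigraph) (@adj D) setT set_val.
Proof. by split=> // x y _ _; exact: val_inj. Qed.

Lemma set_val_image : set_val @` [set: set_type A] = A.
Proof.
rewrite eqEsubset; split=> [_ [x _ <-]|x Ax]; first exact: set_valP.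
by exists (SigSub (mem_set Ax)).
Qed.

Variables (n : nat) (Om : set D).
Hypothesis n_gt2 : 2 < n.
Hypothesis gD : gonlike n Om.
Hypothesis cA : closed_in (@adj D) n Om A.
Hypothesis conA : walk_connected (@adj D) A.
Hypothesis cycA : exists c : nat -> D, [/\ forall i, adj (c i) (c i.+1),
  forall i, c (i + n.*2) = c i, forall i, c i <> c i.+2 & forall i, A (c i)].

Lemma sub_retract : exists h : D -> sub_bigraph,
  [/\ forall x, A x -> set_val (h x) = x, iso_on (@adj D) (@adj sub_bigraph) A h
    & h @` A = setT].
Proof.
have [c [_ _ _ Ac]] := cycA; pose a0 : set_type A := SigSub (mem_set (Ac 0)).
have hK x : A x -> set_val (insubd a0 x) = x by move=> /mem_set Ax; exact: insubdK.
exists (insubd a0); split=> //.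
  split=> x y Ax Ay; last by rewrite /= /sub_adj !hK.
  by move=> /(congr1 set_val); rewrite !hK.
rewrite eqEsubset; split=> // x _; exists (set_val x); first exact: set_valP.
by apply: val_inj; apply: hK; exact: set_valP.
Qed.

Lemma sub_gonlike : gonlike n [set: sub_bigraph].
Proof.
have [eOm tD diam _] := gD; have [AO cA'] := cA.
have eC := @adj_sym D.
have [h [hK ih hA]] := sub_retract.
split=> //.
- move=> g L Ln /(iso_nbw set_val_iso (@subset_refl _ setT)).
  rewrite set_val_image => /(nbwS AO) bg E; apply: (tD _ _ Ln bg).
  by rewrite E.
- suff H x y : A x -> A y -> exists g L, [/\ walk (@adj D) A g L, g 0 = x, g L = y & L <= n].
    move=> x y _ _; have [g [L [wg g0 gL Ln]]] := H _ _ (set_valP x) (set_valP y).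
    exists (fun i => h (g i)), L; split=> //.
    + by rewrite -hA; exact: (iso_walk ih).
    + by rewrite g0; apply: val_inj; exact: hK (set_valP x).
    + by rewrite gL; apply: val_inj; exact: hK (set_valP y).
  move=> Ax Ay.
  have [[g [L [bg Ln g0 gL]]]|fxy] := gon_dichotomy gD (AO _ Ax) (AO _ Ay).
    exists g, L; split=> //; last exact: ltnW.
    by apply: (walk_in bg.1); apply: (cA' _ _ Ln bg); rewrite ?g0 ?gL.
  (* If [x] and [y] are opposite, the first step of a walk inside [A] leads to a vertex that by
     parity is not opposite to [y]; from there the geodesic stays in [A]. *)
  have [u [[|L] [wu u0 uL]]] := conA Ax Ay; first by exists u, 0.
  have [Au eu] := wu; have Ax1 : A (u 1) by apply: Au.
  have exu : adj x (u 1) by rewrite -u0; apply: eu.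
  have [[g [M [bg Mn g0 gM]]]|fu] := gon_dichotomy gD (AO _ Ax1) (AO _ Ay).
    exists (wcons x g), M.+1; split=> //.
    apply: walk_cons => //; first by rewrite g0.
    by apply: (walk_in bg.1); apply: (cA' _ _ Mn bg); rewrite ?g0 ?gM.
  have [v [K [wv v0 vK Kn]]] := diam _ _ (AO _ Ax) (AO _ Ay).
  have [w [M [ww w0 wM Mn]]] := diam _ _ (AO _ Ax1) (AO _ Ay).
  have wc : walk (@adj D) Om (wcons x w) M.+1.
    by apply: walk_cons => //; [exact: AO | rewrite w0].
  have := walk_odd (@adj_side D) wc wv (esym v0); rewrite vK => /(_ wM).
  have := fxy _ _ wv v0 vK; have := fu _ _ ww w0 wM => nM nK.
  by have [-> ->] : M = n /\ K = n by [lia]; rewrite /=; case: odd.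
- have [c [ec cper cn Ac]] := cycA; exists (fun i => h (c i)); split.
  + by move=> i; rewrite ih.2.
  + by move=> i; rewrite cper.
  + by move=> i E; apply: (cn i); apply: (ih.1 _ _ _ _ E).
Qed.

Lemma sub_emb : @emb n (Ln_of n sub_bigraph) (Ln_of n D) setT set_val.
Proof.
apply: (emb_iso n_gt2 sub_gonlike gD).
- by split.
- by rewrite set_val_image.
- exact: set_val_iso.
- by [].
Qed.

Lemma sub_class_C (F : nat -> set D) q (Acl : @Ln_closed n (Ln_of n D) A) :
  finite_set (F 0) -> walk_connected (@adj D) (F 0) ->
  (forall j, fstep (@adj D) n (F j) (F j.+1) (q j)) -> \bigcup_j F j = A ->
  class_C (sub_struct (Substructure Acl)).
Proof.
move=> fF cF Fq FA; have [h [hK ih hA]] := sub_retract; have [c _] := cycA.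
have F_A j : F j `<=` A by move=> z Fz; rewrite -FA; exists j.
have [_ tS _ _] := sub_gonlike.
exists sub_bigraph; split.
- exact: gon_of_gonlike sub_gonlike.
- exists (h @` F 0); split.
  + exact: finite_image.
  + move=> _ _ [x Fx <-] [y Fy <-]; have [g [L [wg g0 gL]]] := cF x y Fx Fy.
    have wh := iso_walk ih (F_A 0) wg.
    case: L gL wg wh => [|L] gL wg wh.
      by exists [::]; split=> //=; rewrite -g0 -gL.
    have /walk_path := (walk_induced (adj (b := sub_bigraph)) _ _ (ltn0Sn L)).2 wh.
    by rewrite g0 gL; eexists; eassumption.
  + by apply: no_cycle_of_tf; apply: tfS tS.
  + exists (fun j => h @` F j); split=> //.
      move=> j; apply/free_stepP.
      by have [q' ?] := fstep_transport (c 0) n_gt2 ih (F_A j.+1) (Fq j); exists q'.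
    by rewrite -hA -FA image_bigcup.
- have cT : @Ln_closed n (Ln_of n sub_bigraph) setT by [].
  exists (Substructure cT); have [ei eP ef] := sub_emb.
  have toT (x : set_type A) : (x : sub_bigraph) \in [set: sub_bigraph] by rewrite in_setT.
  exists (fun x : set_type A => SigSub (toT x)); split.
  + by exists set_val => x; apply: val_inj.
  + by [].
  + by move=> k x y; do 2! apply: val_inj; exact: esym (ef k x y I I).
Qed.

End SubBigraph.

(** * A homogeneous polygon with a large symmetric group *)

Section Agree.
Variables (V : Type) (e e' : rel V) (P : set V).
Hypothesis ee' : forall x y, P x -> P y -> e x y = e' x y.
Implicit Types (S : set V) (g : nat -> V).

Lemma agree_walk S g L : S `<=` P -> walk e S g L -> walk e' S g L.
Proof.
by move=> SP [Sg eg]; split=> // i iL; rewrite -ee' ?eg //; apply: SP; apply: Sg; lia.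
Qed.

Lemma agree_nbw S g L : S `<=` P -> nbw e S g L -> nbw e' S g L.
Proof. by move=> SP [wg ng]; split=> //; exact: agree_walk. Qed.

End Agree.

Section Agree2.
Variables (V : Type) (e e' : rel V) (n : nat) (P : set V).
Hypothesis ee' : forall x y, P x -> P y -> e x y = e' x y.
Let e'e x y : P x -> P y -> e' x y = e x y.
Proof. by move=> Px Py; rewrite ee'. Qed.

Lemma agree_far : far e n P = far e' n P.
Proof.
apply/funext => x; apply/funext => y; apply/propext; split=> -[Px Py [g [wg g0 gL]] fmin];
  (split=> //; [exists g; split=> // | move=> h M wh; apply: fmin]).
- exact: agree_walk ee' _ _ _ (@subset_refl _ P) wg.
- exact: agree_walk e'e _ _ _ (@subset_refl _ P) wh.
- exact: agree_walk e'e _ _ _ (@subset_refl _ P) wg.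
- exact: agree_walk ee' _ _ _ (@subset_refl _ P) wh.
Qed.

Lemma agree_closed S : closed_in e n P S -> closed_in e' n P S.
Proof.
move=> [SP cS]; split=> // g L Ln bg; apply: cS => //.
exact: agree_nbw e'e _ _ _ (@subset_refl _ P) bg.
Qed.

End Agree2.

(** * The tower of free steps and glued extensions *)

Section Tower.
Variables (K : choiceType) (n : nat).
Hypothesis n_gt2 : 2 < n.

Local Notation T := (GenTree.tree K).
Local Opaque pickle.

(* A finite bipartite graph on an initial segment of the natural numbers: its
   edges, and the sides of its vertices. *)
Definition code := (seq (nat * nat) * seq bool)%type.

(* Every new vertex records the stage at which it is added; a path vertex also
   its side and its position, a vertex of an extension its code and index. *)
Definition tag := (nat * (bool * nat + code * nat))%type.

Definition node (t : tag) (s : seq T) : T := GenTree.Node (pickle t) s.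

Definition level (z : T) : nat :=
  if z is GenTree.Node m _ then
    if unpickle m is Some t then (t : tag).1 else 0
  else 0.

Definition tside (z : T) : bool :=
  if z is GenTree.Node m _ then
    match (unpickle m : option tag) with
    | Some (_, inl t) => t.1
    | Some (_, inr t) => nth false t.1.2 t.2
    | None => false
    end
  else false.

Definition center : T := node (0, inl (true, 0)) [::].

(* The path added for an unordered pair has two descriptions. *)
Definition arcv (i : nat) (b : bool) (k : nat) (x y : T) : T :=
  choose (pred2 (node (i, inl (b, k)) [:: x; y])
                (node (i, inl (b, n.-1 - k)) [:: y; x]))
         (node (i, inl (b, k)) [:: x; y]).

Definition arcp i (x y : T) k : T :=
  if k == 0 then x else if k == n.-1 then y else
  arcv i (tside x (+) odd k) k x y.

Definition extp i (c : code) (s : seq T) k : T :=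
  if k < size s then nth center s k else node (i, inr (c, k)) s.

Definition cadj (c : code) : rel nat := fun k l => (k, l) \in c.1.
Definition cvert (c : code) : set nat := [set k | k < size c.2].
Definition cside (c : code) : pred nat := fun k => nth false c.2 k.

(** The first [m] vertices are to be identified with old ones; their closedness is what rules out
    short detours through the new vertices. *)
Definition code_ok (c : code) m :=
  [/\ forall k l, cadj c k l ->
        [/\ cadj c l k, cvert c k, cvert c l & cside c k != cside c l],
      tf (cadj c) n (cvert c), walk_connected (cadj c) (cvert c)
    & closed_in (cadj c) n (cvert c) [set k | k < m]].

(* The task of gluing the graph coded by [c] along [s]: the vertices of [s]
   are identified with the first ones of [c]. *)
Definition ext_ok (E : rel T) (W : set T) (c : code) (s : seq T) :=
  [/\ code_ok c (size s),
      uniq s /\ 0 < size s <= size c.2,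
      forall x, x \in s -> W x,
      closed_in E n W [set` s]
    & forall k l, k < size s -> l < size s ->
        E (nth center s k) (nth center s l) = cadj c k l /\
        tside (nth center s k) = cside c k].

Definition star : set T * rel T :=
  ([set z | z = center \/ exists a, z = GenTree.Leaf a],
   fun u v => `[< u = center /\ (exists a, v = GenTree.Leaf a) \/
                  v = center /\ (exists a, u = GenTree.Leaf a) >]).

Definition arc_step i (X : set T * rel T) : set T * rel T :=
  ([set z | X.1 z \/ exists x y k,
      [/\ far X.2 n X.1 x y, 0 < k < n.-1 & z = arcp i x y k]],
   fun u v => `[< X.2 u v \/ exists x y k,
      [/\ far X.2 n X.1 x y, k < n.-1, u = arcp i x y k & v = arcp i x y k.+1] >]).

Definition ext_step i (X : set T * rel T) : set T * rel T :=
  ([set z | X.1 z \/ exists c s k,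
      [/\ ext_ok X.2 X.1 c s, size s <= k < size c.2 & z = extp i c s k]],
   fun u v => `[< X.2 u v \/ exists c s k l,
      [/\ ext_ok X.2 X.1 c s, cadj c k l, u = extp i c s k & v = extp i c s l] >]).

Fixpoint stage i :=
  if i is j.+1 then (if odd j then arc_step else ext_step) j.+1 (stage j) else star.

Local Notation W i := (stage i).1.
Local Notation E i := (stage i).2.

Lemma level_node t s : level (node t s) = t.1.
Proof. by rewrite /level /node pickleK. Qed.

Lemma tside_arc i b k s : tside (node (i, inl (b, k)) s) = b.
Proof. by rewrite /tside /node pickleK. Qed.

Lemma tside_center : tside center = true.
Proof. exact: tside_arc. Qed.

Lemma level_center : level center = 0.
Proof. exact: level_node. Qed.

Lemma tside_ext i c k s : tside (node (i, inr (c, k)) s) = cside c k.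
Proof. by rewrite /tside /node pickleK. Qed.

Lemma node_inj t s t' s' : node t s = node t' s' -> t = t' /\ s = s'.
Proof. by move=> [/(pcan_inj pickleK) -> ->]. Qed.

Lemma arcvP i b k x y :
  arcv i b k x y = node (i, inl (b, k)) [:: x; y] \/
  arcv i b k x y = node (i, inl (b, n.-1 - k)) [:: y; x].
Proof.
rewrite /arcv; set P := pred2 _ _; set t := node _ _.
have : P (choose P t) by apply: chooseP; rewrite /P /= eqxx.
by move=> /orP[/eqP|/eqP] ->; [left|right].
Qed.

Lemma arcvC i b k x y : k <= n.-1 -> arcv i b k y x = arcv i b (n.-1 - k) x y.
Proof.
move=> kn; rewrite /arcv subKn //.
set t1 := node _ [:: y; x]; set t2 := node _ [:: x; y].
rewrite (@eq_choose _ _ (pred2 t2 t1)); last by move=> z; rewrite /= orbC.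
by apply: choose_id; rewrite /= eqxx ?orbT.
Qed.

Lemma arcv_inj i b k x y i' b' k' x' y' : 0 < k < n.-1 -> 0 < k' < n.-1 ->
  arcv i b k x y = arcv i' b' k' x' y' ->
  (x', y', k') = (x, y, k) \/ (x', y', k') = (y, x, n.-1 - k).
Proof.
move=> kn kn' A.
case: (arcvP i b k x y) (arcvP i' b' k' x' y') => A1 [A2|A2]; rewrite A1 A2 in A;
  have {}A := node_inj A; case: A => -[_ _ A] [-> ->].
- by left; rewrite A.
- by right; rewrite A subKn //; lia.
- by right; rewrite A.
- by left; congr (_, _, _); lia.
Qed.

Lemma arcp_interior i x y k : 0 < k < n.-1 ->
  arcp i x y k = arcv i (tside x (+) odd k) k x y.
Proof. by rewrite /arcp => kn; rewrite !ifF //; apply/eqP; lia. Qed.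

Lemma level_arcp i x y k : 0 < k < n.-1 -> level (arcp i x y k) = i.
Proof.
move=> kn; rewrite arcp_interior //.
by case: (arcvP i (tside x (+) odd k) k x y) => ->; rewrite level_node.
Qed.

Lemma tside_arcp i x y k : 0 < k < n.-1 -> tside (arcp i x y k) = tside x (+) odd k.
Proof.
move=> kn; rewrite arcp_interior //.
by case: (arcvP i (tside x (+) odd k) k x y) => ->; rewrite tside_arc.
Qed.

(** The condition on the sides, which holds at distance n + 1, makes the sides recorded from either
    end agree. *)
Lemma arcp_rev i x y k : tside y = tside x (+) odd n.+1 -> k <= n.-1 ->
  arcp i y x k = arcp i x y (n.-1 - k).
Proof.
move=> sxy kn; have [->|k0] := posnP k.
  by rewrite subn0 /arcp !eqxx ifF //; apply/eqP; lia.
move: kn; rewrite leq_eqVlt => /predU1P[->|kn].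
  by rewrite subnn /arcp !eqxx ifF //; apply/eqP; lia.
have bE : tside y (+) odd k = tside x (+) odd (n.-1 - k).
  rewrite sxy -addbA; congr (_ (+) _).
  by rewrite oddB ?(ltnW kn) // -{1}(prednK (n := n)) /=; [rewrite negbK | lia].
have nk : 0 < n.-1 - k < n.-1 by lia.
have {}k0 : 0 < k < n.-1 by rewrite k0.
by rewrite (arcp_interior _ _ _ k0) (arcp_interior _ _ _ nk) bE arcvC // ltnW //; lia.
Qed.

Lemma level_extp i c s k : size s <= k -> level (extp i c s k) = i.
Proof. by move=> sk; rewrite /extp ltnNge sk level_node. Qed.

Lemma stage_inv i : [/\ symmetric (E i),
  forall u v, E i u v -> [/\ W i u, W i v & tside u != tside v]
  & forall z, W i z -> level z <= i].
Proof.
elim: i => [|i [IHs IHe IHl]] /=.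
  split.
  - by move=> u v; apply/asboolP/asboolP => -[|] []; [right|left|right|left].
  - move=> u v /asboolP[[-> [a ->]]|[-> [a ->]]]; rewrite tside_center.
      by split; [left | right; exists a |].
    by split; [right; exists a | left |].
  - by move=> z [->|[a ->]]; rewrite ?level_center.
case: ifP => oi /=.
  have side_far x y : far (E i) n (W i) x y -> tside y = tside x (+) odd n.+1.
    case=> _ _ [g [wg <- <-]] _.
    by apply: (walk_side _ wg) => u v /IHe[].
  have sideE x y k : far (E i) n (W i) x y -> k <= n.-1 ->
      tside (arcp i.+1 x y k) = tside x (+) odd k.
    move=> fxy; have [->|k0] := posnP k; first by rewrite /arcp eqxx addbF.
    rewrite leq_eqVlt => /predU1P[->|kn]; last by rewrite tside_arcp // k0.
    rewrite /arcp eqxx ifF; last by apply/eqP; lia.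
    rewrite (side_far _ _ fxy) -{1}(prednK (n := n)) /=; last by lia.
    by rewrite negbK.
  have revE x y k : far (E i) n (W i) x y -> k <= n.-1 ->
      arcp i.+1 y x k = arcp i.+1 x y (n.-1 - k).
    by move=> /side_far; exact: arcp_rev.
  have inW x y k : far (E i) n (W i) x y -> k <= n.-1 ->
      W i (arcp i.+1 x y k) \/ exists x' y' k',
        [/\ far (E i) n (W i) x' y', 0 < k' < n.-1 & arcp i.+1 x y k = arcp i.+1 x' y' k'].
    move=> fxy; have [Wx Wy _ _] := fxy.
    have [->|k0] := posnP k; first by rewrite {1}/arcp eqxx; left.
    rewrite leq_eqVlt => /predU1P[->|kn].
      by rewrite {1}/arcp eqxx ifF; [left | apply/eqP; lia].
    by right; exists x, y, k; rewrite k0 kn.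
  split.
  - have flip u v : E i.+1 u v -> E i.+1 v u.
      rewrite /= oi => /asboolP[Euv|[x [y [k [fxy kn -> ->]]]]]; apply/asboolP.
        by left; rewrite IHs.
      right; exists y, x, (n.-1 - k.+1); split; [exact: far_sym | lia | |].
        by rewrite (revE _ _ _ fxy) ?leq_subr // subKn.
      rewrite (revE _ _ _ fxy); last by lia.
      by rewrite (_ : n.-1 - _ = k) //; lia.
    by move: flip; rewrite /= oi => flip u v; apply/idP/idP; exact: flip.
  - move=> u v /asboolP[/IHe[Wu Wv uv]|[x [y [k [fxy kn -> ->]]]]].
      by split=> //; left.
    split; [exact: inW fxy (ltnW kn) | exact: inW fxy kn |].
    rewrite (sideE _ _ _ fxy kn) (sideE _ _ _ fxy (ltnW kn)) [odd k.+1]/=.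
    by case: (tside x); case: (odd k).
  - move=> z [/IHl|[x [y [k [_ kn ->]]]]]; first by lia.
    by rewrite level_arcp.
have inW c s k : ext_ok (E i) (W i) c s -> cvert c k ->
    W i (extp i.+1 c s k) \/ exists c' s' k',
      [/\ ext_ok (E i) (W i) c' s', size s' <= k' < size c'.2 &
        extp i.+1 c s k = extp i.+1 c' s' k'].
  move=> ok kc; have [ks|sk] := ltnP k (size s).
    by left; rewrite /extp ks; case: ok => _ _ sW _ _; apply: sW; exact: mem_nth.
  by right; exists c, s, k; rewrite sk.
have sideE c s k : ext_ok (E i) (W i) c s -> tside (extp i.+1 c s k) = cside c k.
  move=> [_ _ _ _ ok]; rewrite /extp; case: ifP => ks; last by rewrite tside_ext.
  by case: (ok k k ks ks).
split.
- move=> u v; apply/asboolP/asboolP => -[Euv|[c [s [k [l [ok kl -> ->]]]]]];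
    [by left; rewrite IHs | right; exists c, s, l, k; split=> // | by left; rewrite IHs
    | right; exists c, s, l, k; split=> //];
    by case: ok => -[ck _ _ _] _ _ _ _; case: (ck _ _ kl).
- move=> u v /asboolP[/IHe[Wu Wv uv]|[c [s [k [l [ok kl -> ->]]]]]].
    by split=> //; left.
  have [[ck _ _ _] _ _ _ _] := ok; have [_ kc lc kls] := ck _ _ kl.
  by split; [exact: inW ok kc | exact: inW ok lc | rewrite !sideE].
- move=> z [/IHl|[c [s [k [_ /andP[sk _] ->]]]]]; first by lia.
  by rewrite level_extp.
Qed.

Lemma stage_mono i j : i <= j -> W i `<=` W j.
Proof.
elim: j => [|j IH]; first by rewrite leqn0 => /eqP ->.
rewrite leq_eqVlt ltnS => /predU1P[->//|/IH ij] z /ij Wz /=.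
by case: ifP => _; left.
Qed.

Lemma stage_edge_mono i j u v : i <= j -> E i u v -> E j u v.
Proof.
elim: j => [|j IH]; first by rewrite leqn0 => /eqP ->.
rewrite leq_eqVlt ltnS => /predU1P[->//|/IH ij] /ij Euv /=.
by case: ifP => _; apply/asboolP; left.
Qed.

(** The stage recorded in a vertex keeps it apart from everything built before. *)
Lemma stage_fresh i z : level z = i.+1 -> ~ W i z.
Proof. by move=> lz Wz; have [_ _ /(_ _ Wz)] := stage_inv i; rewrite lz ltnn. Qed.

(** A glued piece adds no edge between old vertices, since by the last clause of [ext_ok] its code
    agrees there with the existing graph. *)
Lemma stage_restrict i u v : W i u -> W i v -> E i.+1 u v -> E i u v.
Proof.
move=> Wu Wv /=; case: ifP => _ /asboolP[//|].
  move=> [x [y [k [_ kn uE vE]]]].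
  have [k0|k0] := posnP k.
    by case: (stage_fresh (i := i) (z := v)) => //; rewrite vE level_arcp //; lia.
  by case: (stage_fresh (i := i) (z := u)) => //; rewrite uE level_arcp //; lia.
move=> [c [s [k [l [ok kl uE vE]]]]].
have ks : k < size s.
  rewrite ltnNge; apply/negP => sk.
  by apply: (stage_fresh (i := i) (z := u)); rewrite // uE level_extp.
have ls : l < size s.
  rewrite ltnNge; apply/negP => sl.
  by apply: (stage_fresh (i := i) (z := v)); rewrite // vE level_extp.
by rewrite uE vE /extp ks ls; case: ok => _ _ _ _ /(_ _ _ ks ls)[->].
Qed.

Definition tadj : rel T := fun u v => `[< exists i, E i u v >].
Definition tvert : set T := \bigcup_i W i.

Lemma tadj_stage i u v : W i u -> W i v -> tadj u v = E i u v.
Proof.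
move=> Wu Wv; apply/asboolP/idP => [[j]|Euv]; last by exists i.
have [ji|/ltnW ij] := leqP j i; first exact: stage_edge_mono.
rewrite -(subnKC ij); elim: (j - i) => [|d IH]; first by rewrite addn0.
rewrite addnS => /stage_restrict H; apply: IH; apply: H;
  exact: stage_mono (leq_addr _ _) _ _.
Qed.

Lemma tadj_sym : symmetric tadj.
Proof.
by move=> u v; apply/asboolP/asboolP => -[i Euv]; exists i; have [-> _ _] := stage_inv i.
Qed.

Lemma tadj_side u v : tadj u v -> tside u != tside v.
Proof. by move=> /asboolP[i Euv]; have [_ /(_ _ _ Euv)[]] := stage_inv i. Qed.

Lemma tadj_vert u v : tadj u v -> tvert u.
Proof. by move=> /asboolP[i Euv]; exists i => //; have [_ /(_ _ _ Euv)[]] := stage_inv i. Qed.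

Lemma far_stage i : far tadj n (W i) = far (E i) n (W i).
Proof. exact: agree_far (@tadj_stage i). Qed.

Lemma arc_stage i : odd i -> fstep tadj n (W i) (W i.+1) (arcp i.+1).
Proof.
move=> oi; have WE z : W i.+1 z <-> W i z \/ exists x y k,
    [/\ far tadj n (W i) x y, 0 < k < n.-1 & z = arcp i.+1 x y k].
  by rewrite far_stage /= oi.
have n1 : n.-1 == 0 = false by apply/eqP; lia.
split=> //; first split.
- by move=> x y _; rewrite /arcp !eqxx n1.
- move=> x y k [_ _ [g [wg <- <-]] _]; apply: arcp_rev.
  exact: (walk_side tadj_side wg).
- by move=> x y k _ kn; apply: stage_fresh; exact: level_arcp.
- by move=> x y k x' y' k' _ kn _ kn'; rewrite !arcp_interior //; exact: arcv_inj.
move=> u v Wu Wv; rewrite (tadj_stage Wu Wv) far_stage.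
have -> : E i.+1 u v = `[< E i u v \/ exists x y k, [/\ far (E i) n (W i) x y,
    k < n.-1, u = arcp i.+1 x y k & v = arcp i.+1 x y k.+1] >] by rewrite /= oi.
split=> [/asboolP[Euv|]|]; [left | by right |].
  have [_ /(_ _ _ Euv)[Wu' Wv' _] _] := stage_inv i.
  by split=> //; apply/asboolP; left.
by case=> [[]//|h]; apply/asboolP; right.
Qed.

Local Notation task i := (ext_ok tadj (W i)).

Lemma task_stage i : task i = ext_ok (E i) (W i).
Proof.
have half e e' : (forall u v, W i u -> W i v -> e u v = e' u v) ->
    forall c s, ext_ok e (W i) c s -> ext_ok e' (W i) c s.
  move=> ee' c s [ok1 ok2 ok3 ok4 ok5]; split=> //.
    exact: agree_closed ee' _ ok4.
  move=> k l ks ls; rewrite -ee'; [exact: ok5 | apply: ok3; exact: mem_nth..].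
apply/funext => c; apply/funext => s; apply/propext; split; apply: half => //.
  exact: tadj_stage.
by move=> u v Wu Wv; rewrite (tadj_stage Wu Wv).
Qed.

Section ExtStage.
Variable i : nat.
Hypothesis ei : ~~ odd i.

Lemma ext_vert z : W i.+1 z <-> W i z \/ exists c s k,
  [/\ task i c s, size s <= k < size c.2 & z = extp i.+1 c s k].
Proof. by rewrite task_stage /= (negbTE ei). Qed.

Lemma ext_edge u v : W i.+1 u -> W i.+1 v -> tadj u v <->
  [/\ W i u, W i v & tadj u v] \/ exists c s k l,
  [/\ task i c s, cadj c k l, u = extp i.+1 c s k & v = extp i.+1 c s l].
Proof.
move=> Wu Wv; rewrite (tadj_stage Wu Wv) task_stage.
have -> : E i.+1 u v = `[< E i u v \/ exists c s k l, [/\ ext_ok (E i) (W i) c s,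
    cadj c k l, u = extp i.+1 c s k & v = extp i.+1 c s l] >] by rewrite /= (negbTE ei).
split=> [/asboolP[Euv|]|]; [left | by right |].
  have [_ /(_ _ _ Euv)[Wu' Wv' _] _] := stage_inv i.
  by split=> //; apply/asboolP; left.
by case=> [[]//|h]; apply/asboolP; right.
Qed.

Section Task.
Variables (c : code) (s : seq T).
Hypothesis ok : task i c s.
Local Notation p := (extp i.+1 c s).

Lemma extp_old k : k < size s -> p k = nth center s k.
Proof. by rewrite /extp => ->. Qed.

Lemma extp_old_in k : k < size s -> W i (p k).
Proof. by move=> ks; rewrite extp_old //; case: ok => _ _ + _ _; apply; exact: mem_nth. Qed.

Lemma extp_new k : size s <= k -> ~ W i (p k).
Proof. by move=> sk; apply: stage_fresh; exact: level_extp. Qed.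

Lemma extp_oldP k : W i (p k) -> k < size s.
Proof. by move=> Wk; rewrite ltnNge; apply/negP => /extp_new. Qed.

Lemma extp_in k : cvert c k -> W i.+1 (p k).
Proof.
move=> kc; apply/ext_vert; have [ks|sk] := ltnP k (size s); first by left; exact: extp_old_in.
by right; exists c, s, k; rewrite sk.
Qed.

Lemma extp_inj k l : p k = p l -> k = l.
Proof.
have [_ [us _] _ _ _] := ok => pkl.
have [ks|sk] := ltnP k (size s).
  have ls : l < size s by apply: extp_oldP; rewrite -pkl; exact: extp_old_in.
  by move: pkl; rewrite !extp_old // => /eqP; rewrite nth_uniq // => /eqP.
have sl : size s <= l.
  by rewrite leqNgt; apply/negP => /extp_old_in; rewrite -pkl; exact: extp_new.
by move: pkl; rewrite /extp !ltnNge sk sl /= => /node_inj[[->]].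
Qed.

(** A new vertex records its code, index and list, so it determines the task it comes from and has
    neighbours in that piece only. *)
Lemma ext_nbr k w : size s <= k -> cvert c k -> W i.+1 w -> tadj (p k) w ->
  exists2 l, cadj c k l & w = p l.
Proof.
move=> sk kc Ww; move=> /(ext_edge (extp_in kc) Ww) [[/extp_oldP]|]; first by rewrite ltnNge sk.
move=> [c' [s' [k' [l' [ok' kl' pk ->]]]]]; move: pk; rewrite {1}/extp ltnNge sk /= /extp.
case: ltnP => [ks' E|_ /node_inj[[-> ->] ->]]; last by exists l'.
exfalso; apply: (extp_new sk); rewrite /extp ltnNge sk /= E.
by case: ok' => _ _ + _ _; apply; exact: mem_nth.
Qed.

Lemma ext_iso : iso_on (cadj c) tadj (cvert c) p.
Proof.
have [[ck _ _ _] _ _ _ okE] := ok.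
split=> [k l _ _|k l kc lc]; first exact: extp_inj.
have csym a b : cadj c a b = cadj c b a by apply/idP/idP => /ck[].
have nbr a b : size s <= a -> cvert c a -> cvert c b -> tadj (p a) (p b) -> cadj c a b.
  by move=> sa ac bc /(ext_nbr sa ac (extp_in bc)) [b' ab' /extp_inj ->].
apply/idP/idP => [pkl|kl]; last first.
  by apply/(ext_edge (extp_in kc) (extp_in lc)); right; exists c, s, k, l.
have [ks|sk] := ltnP k (size s); last exact: nbr.
have [ls|sl] := ltnP l (size s); last by rewrite csym; apply: nbr => //; rewrite tadj_sym.
by have [<- _] := okE _ _ ks ls; rewrite -!extp_old.
Qed.

Lemma ext_side k : cvert c k -> tside (p k) = cside c k.
Proof.
move=> kc; have [ks|sk] := ltnP k (size s); last by rewrite /extp ltnNge sk tside_ext.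
by rewrite extp_old //; case: ok => _ _ _ _ /(_ _ _ ks ks)[].
Qed.

Definition piece := p @` cvert c.

Lemma piece_old z : piece z -> W i z -> z \in s.
Proof.
by move=> [k kc <-] /extp_oldP ks; rewrite extp_old // mem_nth.
Qed.

Lemma old_piece z : z \in s -> piece z.
Proof.
have [_ [_ /andP[_ sc]] _ _ _] := ok.
move=> zs; exists (index z s); last by rewrite extp_old ?index_mem // nth_index.
by apply: leq_trans sc; rewrite index_mem.
Qed.

Lemma piece_nbr z w : piece z -> ~ W i z -> W i.+1 w -> tadj z w -> piece w.
Proof.
move=> [k kc <-] nWk Ww.
have sk : size s <= k by rewrite leqNgt; apply/negP => /extp_old_in.
move=> /(ext_nbr sk kc Ww) [l kl ->]; exists l => //.
by have [[ck _ _ _] _ _ _ _] := ok; case: (ck _ _ kl).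
Qed.

Lemma piece_sub : piece `<=` W i.+1.
Proof. by move=> _ [k kc <-]; exact: extp_in. Qed.

Lemma old_image : p @` [set k | k < size s] = [set` s].
Proof.
rewrite eqEsubset; split=> [_ [k ks <-]|z zs] /=.
  by rewrite extp_old // mem_nth.
by exists (index z s); rewrite /= ?index_mem // extp_old ?index_mem // nth_index.
Qed.

Lemma piece_closed : closed_in tadj n piece [set` s].
Proof.
have [[_ _ _ cc] _ _ _ _] := ok; rewrite -old_image.
exact: (iso_closed ext_iso).
Qed.

Lemma piece_tf : tf tadj n piece.
Proof. by have [[_ tc _ _] _ _ _ _] := ok; exact: (iso_tf ext_iso). Qed.

Lemma piece_connected : walk_connected tadj piece.
Proof. by have [[_ _ cc _] _ _ _ _] := ok; exact: (iso_connected ext_iso). Qed.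

Lemma piece_finite : finite_set piece.
Proof. by apply: finite_image; exact: finite_II. Qed.

End Task.
End ExtStage.

(** * Cycles and closed sets after gluing *)

Section ExtMetric.
Variable i : nat.
Hypothesis ei : ~~ odd i.

(** An excursion never changes the piece, and in the piece the old vertices form a closed set, so it
    cannot be shorter than n. *)
Lemma ext_excursion g L : nbw tadj (W i.+1) g L -> 1 < L -> W i (g 0) -> W i (g L) ->
  (forall j, 0 < j < L -> ~ W i (g j)) ->
  n <= L /\ exists c s, task i c s /\ forall j, j <= L -> piece i c s (g j).
Proof.
move=> bg L1 g0 gL gn; have [[Wg eg] _] := bg.
have /(ext_vert ei)[/gn[]//|[c [s [k [ok /andP[sk kc] g1]]]]] := Wg 1 (ltnW L1).
have pc j : 0 < j < L -> piece i c s (g j).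
  elim: j => // -[|j] IH jL; first by rewrite g1; exists k.
  have jL' : 0 < j.+1 < L by lia.
  apply: (piece_nbr ei ok (IH jL')); [exact: gn | apply: Wg; lia | apply: eg; lia].
have pall j : j <= L -> piece i c s (g j).
  move=> jL; have [->|j0] := posnP j.
    apply: (piece_nbr ei ok (pc 1 _) (gn 1 _) (Wg 0 _)) => //.
    by rewrite tadj_sym; apply: eg; lia.
  have [->|jL'] : j = L \/ j < L by lia.
    have L1' : 0 < L.-1 < L by lia.
    apply: (piece_nbr ei ok (pc _ L1') (gn _ L1') (Wg L _)) => //.
    by rewrite -{2}(prednK (n := L)); [apply: eg|]; lia.
  by apply: pc; rewrite j0.
split; last by exists c, s.
rewrite leqNgt; apply/negP => Ln; have [_ cs] := piece_closed ei ok.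
have old z : z \in s -> W i z by case: ok => _ _ + _ _; apply.
apply: (gn 1); first by rewrite L1.
apply: old; apply: (cs _ _ Ln (nbw_in bg pall)); last by lia.
  exact: piece_old (pall 0 (leq0n _)) g0.
exact: piece_old (pall L (leqnn _)) gL.
Qed.

(** A short cycle has room for one excursion only, of length at least n. The rest is shorter than n
    and joins two vertices of [s], which is closed, so it stays in [s] and the whole cycle lies in
    one piece. *)
Lemma ext_tf : tf tadj n (W i) -> tf tadj n (W i.+1).
Proof.
move=> tW; apply: (tf_periodic tadj_side) => g L /andP[L2 Ln] Lodd gL Wg eg ginj.
have bsh a M : nbw tadj (W i.+1) (fun j => g (a + j)) M.
  split; first by split=> j _; rewrite ?addnS.
  by move=> j _; rewrite !addnS; apply: ginj; lia.
have inpiece c s a : task i c s -> (forall j, j <= L -> piece i c s (g (a + j))) -> False.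
  move=> ok pg; apply: (piece_tf ei ok _ (nbw_in (bsh a L) pg)); first by lia.
  by rewrite addn0 gL.
have [[a Wa]|nW] := pselect (exists a, W i (g a)); last first.
  have nWg a : ~ W i (g a) by move=> Wa; apply: nW; exists a.
  have /(ext_vert ei)[/nWg//|[c [s [k [ok /andP[sk kc] g0]]]]] := Wg 0.
  apply: (inpiece c s 0 ok) => j _; elim: j => [|j IH]; first by rewrite g0; exists k.
  by rewrite !add0n in IH *; apply: (piece_nbr ei ok IH) => //.
have [|/existsNP[k]] := pselect (forall k, k <= L -> W i (g (a + k))).
  move=> aW; apply: (tW _ L _ (nbw_in (bsh a L) aW)); first by lia.
  by rewrite addn0 gL.
move=> /not_implyP[kL nWk].
have [||a' [b [ab bL Wa' Wb nWab]]] :=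
  excursion (S := W i) (g := fun j => g (a + j)) _ _ kL nWk.
- by rewrite addn0.
- by rewrite gL.
have exc x d : W i (g x) -> W i (g (x + d)) -> (forall j, 0 < j < d -> ~ W i (g (x + j))) ->
    1 < d -> n <= d /\ exists c s, task i c s /\ forall j, j <= d -> piece i c s (g (x + j)).
  by move=> Wx Wxd nWx d1; apply: ext_excursion (bsh _ _) d1 _ Wxd nWx; rewrite addn0.
pose x := a + a'; pose d := b - a'.
have Wxd : W i (g (x + d)) by rewrite /x /d -addnA subnKC //; lia.
have [||nd [c [s [ok pd]]]] := exc x d Wa' Wxd.
- by move=> j hj; rewrite /x -addnA; apply: nWab; lia.
- by rewrite /d; lia.
have dL : d <= L by rewrite /d; lia.
have rest j : j <= L - d -> W i (g (x + d + j)).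
  move=> jL; apply: contrapT => nWj.
  have [||a1 [b1 [ab1 bL1 Wa1 Wb1 nWab1]]] := excursion (S := W i)
    (g := fun j => g (x + d + j)) _ _ jL nWj.
  - by rewrite addn0.
  - by rewrite -addnA subnKC // gL.
  have [|||n1 _] := exc (x + d + a1) (b1 - a1) Wa1.
  - by rewrite -[_ + a1 + _]addnA subnKC //; lia.
  - by move=> t ht; rewrite -[_ + a1 + _]addnA; apply: nWab1; lia.
  - by lia.
  - by lia.
apply: (inpiece c s x ok) => j jL; have [|dj] := leqP j d; first exact: pd.
have [_ _ _ [_ cs] _] := ok.
have es z : piece i c s z -> W i z -> z \in s by exact: piece_old.
have -> : g (x + j) = g (x + d + (j - d)) by congr g; lia.
apply: (old_piece ok); apply: (cs _ (L - d) _ (nbw_in (bsh (x + d) (L - d)) rest)); try lia.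
  by rewrite addn0; apply: es => //; apply: pd.
rewrite -addnA subnKC // gL; apply: es => //; rewrite -(addn0 x); exact: pd.
Qed.

Lemma ext_tight : tight_step tadj n (W i) (W i.+1).
Proof.
move=> g L bg /andP[L1 Ln] g0 gL gn.
by have [nL _] := ext_excursion bg L1 g0 gL gn; lia.
Qed.

Definition ext_on (A : set T) (J : set (code * seq T)) :=
  [set z | A z \/ exists2 t, J t & piece i t.1 t.2 z].

Variables (A : set T) (J : set (code * seq T)).
Hypothesis JA : forall t, J t -> task i t.1 t.2 /\ (forall x, x \in t.2 -> A x).

Lemma ext_on_finite : finite_set A -> finite_set J -> finite_set (ext_on A J).
Proof.
move=> fA fJ; apply: (@sub_finite_set _ _ (A `|` \bigcup_(t in J) piece i t.1 t.2)).
  by move=> z [Az|[t Jt pz]]; [left | right; exists t].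
rewrite finite_setU; split=> //; apply: bigcup_finite => // t /JA[ok _].
exact: piece_finite.
Qed.

Lemma ext_on_connected : walk_connected tadj A -> walk_connected tadj (ext_on A J).
Proof.
move=> cA; apply: (connected_retract tadj_sym _ cA) => [z|z]; first by left.
case=> [//|[t Jt pz]] _.
have [ok sA] := JA Jt; have [_ [_ /andP[s0 _]] _ _ _] := ok.
have xs := mem_nth center s0.
have [g [L [wg g0 gL]]] := piece_connected ei ok pz (old_piece ok xs).
exists g, L; split=> //; last by rewrite gL; exact: sA.
by apply: walkS wg => w pw; right; exists t.
Qed.

Lemma ext_on_closed : closed_in tadj n (W i) A -> closed_in tadj n (W i.+1) (ext_on A J).
Proof.
move=> [AW cA]; split.
  move=> z [/AW|[t /JA[ok _]]]; first exact: stage_mono (leqnSn i) z.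
  exact: (piece_sub ei ok).
move=> g L Ln bg A0 AL k kL; apply: contrapT => nAk.
have [a [b [ab bL Aa Ab nAab]]] := excursion A0 AL kL nAk.
have [[Wg eg] ng] := bg.
have inA x w : ext_on A J x -> ~ ext_on A J w -> W i.+1 w -> tadj x w -> A x.
  case=> // -[t Jt px] nw Ww xw; have [ok sA] := JA Jt.
  have [Wx|nWx] := pselect (W i x); first by apply: sA; exact: piece_old px Wx.
  by case: nw; right; exists t => //; exact: (piece_nbr ei ok px).
have {}Aa : A (g a).
  by apply: (inA _ (g a.+1)) => //; [apply: nAab | apply: Wg | apply: eg]; lia.
have {}Ab : A (g b).
  have hb : a < b.-1 < b by lia.
  apply: (inA _ _ Ab (nAab _ hb)); first by apply: Wg; lia.
  by rewrite tadj_sym -{2}(prednK (n := b)); [apply: eg|]; lia.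
have bab := nbw_sub bg (a := a) (l := b - a) ltac:(lia).
have [aW|/existsNP[j /not_implyP[jL nWj]]] :=
    pselect (forall j, j <= b - a -> W i (g (a + j))).
  have := cA _ _ _ (nbw_in bab aW) _ _ (k - a); rewrite addn0 !subnKC; try lia.
  by move=> /(_ ltac:(lia) Aa Ab ltac:(lia)) Ak; apply: nAk; left.
have [||a1 [b1 [ab1 bL1 Wa1 Wb1 nWab1]]] :=
  excursion (S := W i) (g := fun j => g (a + j)) _ _ jL nWj.
- by rewrite addn0; apply: AW.
- by rewrite subnKC; [apply: AW | lia].
have [|||n1 _] := @ext_excursion (fun j => g (a + (a1 + j))) (b1 - a1)
  (nbw_sub bab (a := a1) (l := b1 - a1) ltac:(lia)) ltac:(lia).
- by rewrite addn0.
- by rewrite subnKC //; lia.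
- by move=> t ht; apply: nWab1; lia.
- by lia.
Qed.

End ExtMetric.

Lemma star_edge u v : E 0 u v <-> u = center /\ (exists a, v = GenTree.Leaf a) \/
  v = center /\ (exists a, u = GenTree.Leaf a).
Proof. by split=> [/asboolP|h]; last exact/asboolP. Qed.

Lemma star_nbw g L : nbw tadj (W 0) g L -> L <= 2.
Proof.
move=> [[Wg eg] ng]; rewrite leqNgt; apply/negP => L3.
have eg' j : j < L -> E 0 (g j) (g j.+1).
  by move=> jL; rewrite -tadj_stage; [apply: eg | apply: Wg | apply: Wg]; lia.
have no a : center <> GenTree.Leaf a by [].
have /star_edge e0 := eg' 0 ltac:(lia); have /star_edge e1 := eg' 1 ltac:(lia).
have /star_edge e2 := eg' 2 ltac:(lia).
have n0 := ng 0 ltac:(lia); have n1 := ng 1 ltac:(lia).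
case: e1 => -[c1 [a la]]; last first.
  case: e0 => -[c0 [b lb]]; first by apply: n0; rewrite c0 c1.
  by apply: (no a); rewrite -la -c0.
case: e2 => -[c2 [b lb]]; first by apply: (no a); rewrite -la -c2.
by apply: n1; rewrite c1 c2.
Qed.

Lemma stage_tf i : tf tadj n (W i).
Proof.
elim: i => [|i IH]; last first.
  have [oi|ei] := boolP (odd i); last exact: ext_tf.
  exact: (fstep_tf tadj_sym tadj_side n_gt2 (arc_stage oi)).
move=> g L Ln bg; have L2 := star_nbw bg; have [[_ eg] ng] := bg.
have [L1|L1] : L = 1 \/ L = 2 by lia.
  by move=> g0; have := tadj_side (eg 0 ltac:(lia)); rewrite g0 L1 eqxx.
by rewrite L1; apply: ng; rewrite L1.
Qed.

Lemma stage_tight i : tight_step tadj n (W i) (W i.+1).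
Proof.
have [oi|ei] := boolP (odd i); last exact: ext_tight.
exact: (fstep_tight n_gt2 tadj_sym (arc_stage oi)).
Qed.

Lemma star_connected X : X `<=` W 0 -> walk_connected tadj (X `|` [set center]).
Proof.
move=> XW; apply: (@connected_retract _ _ tadj_sym [set center]).
- by move=> z; right.
- by move=> _ _ -> ->; exists (fun=> center), 0; split=> //; split.
- move=> z [Xz|//] nz; exists (wcons z (fun=> center)), 1; split=> //.
  have Wc : W 0 center by left.
  have [//|[a za]] := XW _ Xz.
  apply: walk_cons; [by left | | by split=> // j _; right].
  rewrite (tadj_stage (XW _ Xz) Wc); apply/star_edge; right; split=> //.
  by exists a.
Qed.

Lemma stage_connected i : walk_connected tadj (W i).
Proof.
elim: i => [|i IH].
  have -> : W 0 = W 0 `|` [set center].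
    by apply/seteqP; split=> z; [left | case=> [//|->]; left].
  exact: star_connected.
have [oi|ei] := boolP (odd i).
  rewrite -(fstep_onS (arc_stage oi)).
  exact: (fstep_on_connected tadj_sym n_gt2 (arc_stage oi)).
have -> : W i.+1 = ext_on i (W i) [set t | task i t.1 t.2].
  rewrite eqEsubset; split=> z; first move=> /(ext_vert ei) [Wz|[c [s [k [ok sk ->]]]]].
  - by left.
  - by right; exists (c, s) => //; exists k => //; case/andP: sk.
  case=> [|[t ok]]; first exact: stage_mono (leqnSn i) z.
  exact: (piece_sub ei ok).
by apply: ext_on_connected => // t ok; split=> //; case: ok.
Qed.

Lemma walk_stage g L : walk tadj tvert g L -> exists i, walk tadj (W i) g L.
Proof.
move=> [Wg eg]; suff [i Wi] : exists i, forall j, j <= L -> W i (g j).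
  by exists i; split.
elim: L Wg {eg} => [|L IH] Wg.
  by have [i _ Wi] := Wg 0 isT; exists i => j; rewrite leqn0 => /eqP ->.
have [|i Wi] := IH; first by move=> j jL; apply: Wg; lia.
have [k _ Wk] := Wg L.+1 (leqnn _); exists (maxn i k) => j.
rewrite leq_eqVlt ltnS => /predU1P[->|/Wi Wij].
  exact: stage_mono (leq_maxr i k) _ Wk.
exact: stage_mono (leq_maxl i k) _ Wij.
Qed.

Lemma tvert_tf : tf tadj n tvert.
Proof.
move=> g L Ln [wg ng]; have [i wi] := walk_stage wg.
exact: (stage_tf (i := i) Ln).
Qed.

Lemma tvert_diam x y : tvert x -> tvert y ->
  exists g L, [/\ walk tadj tvert g L, g 0 = x, g L = y & L <= n].
Proof.
(* A free step leads out of every odd stage, so the odd stages form a chain for [contract]. *)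
move=> [i _ Wx] [j _ Wy]; pose k := maxn i j; pose F m := W m.*2.+1.
have Fx : F k x by apply: stage_mono Wx; rewrite /k; lia.
have Fy : F k y by apply: stage_mono Wy; rewrite /k; lia.
have [g [L [wg g0 gL]]] := stage_connected Fx Fy.
have [||m [h [M [_ wh Mn h0 hM]]]] := contract n_gt2 (F := F) _ _ (j := k) wg.
- by move=> a b ab; apply: stage_mono; lia.
- move=> m u v fuv; have om : odd m.*2.+1 by rewrite /= odd_double.
  have st := arc_stage om; exists (arcp m.*2.+2 u v).
  rewrite (fstep_q0 st fuv) (fstep_qL st fuv); split=> //.
  have [wq _] := fstep_nbw n_gt2 st fuv; apply: walkS wq.
  by apply: stage_mono; lia.
exists h, M; rewrite h0 hM; split=> //; apply: walkS wh => z Fz.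
by exists m.*2.+1.
Qed.

(** A vertex of the next stage depends on finitely many vertices and at most one task of the present
    one. Performing the step over a finite closed connected set containing these vertices, for the
    tasks needed, preserves all the properties. *)
Lemma cofinal i X : finite_set X -> X `<=` W i -> exists A,
  [/\ finite_set A, X `<=` A, closed_in tadj n (W i) A & walk_connected tadj A].
Proof.
elim: i X => [|i IH] X fX XW.
  exists (X `|` [set center]); split.
  - by rewrite finite_setU; split.
  - by move=> x; left.
  - split; first by move=> z [/XW|->] //; left.
    move=> g L Ln bg A0 AL j jL; have L2 := star_nbw bg.
    have [->//|j0] := posnP j; have [->//|jL'] : j = L \/ j < L by lia.
    have [j1 L2'] : j = 1 /\ L = 2 by lia.
    subst j L; have [[Wg eg] ng] := bg.
    have eg' k : k < 2 -> E 0 (g k) (g k.+1).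
      by move=> kL; rewrite -tadj_stage; [apply: eg | apply: Wg | apply: Wg]; lia.
    have /star_edge[[g0 _]|[-> _]] := eg' 0 isT; last by right.
    have /star_edge[[-> _]|[g2 _]] := eg' 1 isT; first by right.
    by case: (ng 0); rewrite // g0 g2.
  - exact: star_connected.
have [oi|ei] := boolP (odd i).
  have st := arc_stage oi.
  have /choice[Y YP] x : exists Y, W i.+1 x -> [/\ finite_set Y, Y `<=` W i &
      forall A, Y `<=` A -> fstep_on tadj n (W i) (arcp i.+1) A x].
    have [Wx|nWx] := pselect (W i x).
      by exists [set x] => _; split=> // [_ ->//|A xA]; left; exact: xA.
    have [Wx'|nWx'] := pselect (W i.+1 x); last by exists set0.
    have [a [b [k [fab kn ->]]]] := fstep_newP st Wx' nWx.
    have [Wa Wb _ _] := fab.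
    exists ([set a] `|` [set b]) => _; split.
    - by rewrite finite_setU; split.
    - by move=> _ [->|->].
    - move=> A abA; right; exists a, b, k; split=> //.
      by split; apply: abA; [left|right].
  have [||A [fA YA cA conA]] := IH (\bigcup_(x in X) Y x).
  - by apply: bigcup_finite => // x /XW /YP[].
  - by move=> z [x /XW /YP[_ + _]]; apply.
  exists (fstep_on tadj n (W i) (arcp i.+1) A); split.
  - exact: fstep_on_finite.
  - by move=> x Xx; have [_ _] := YP _ (XW _ Xx); apply => z Yz; apply: YA; exists x.
  - exact: (fstep_on_closed tadj_sym n_gt2 st).
  - by apply: (fstep_on_connected tadj_sym n_gt2 st) => //; case: cA.
have /choice[Y YP] x : exists YJ : set T * set (code * seq T), W i.+1 x ->
    [/\ finite_set YJ.1 /\ finite_set YJ.2, YJ.1 `<=` W i,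
      forall t, YJ.2 t -> task i t.1 t.2 /\ (forall z, z \in t.2 -> YJ.1 z) &
      forall A J, YJ.1 `<=` A -> YJ.2 `<=` J -> ext_on i A J x].
  have [Wx|nWx] := pselect (W i x).
    by exists ([set x], set0) => _; split=> //= [_ ->//|A J xA _]; left; exact: xA.
  have [/(ext_vert ei)[//|[c [s [k [ok /andP[_ kc] xE]]]]]|nWx'] := pselect (W i.+1 x);
    last by exists (set0, set0).
  have [_ _ sW _ _] := ok.
  exists ([set` s], [set (c, s)]) => _; split=> //=.
  - by move=> _ ->.
  - by move=> A J _ J1; right; exists (c, s); [exact: J1 | exists k].
pose J := \bigcup_(x in X) (Y x).2.
have [||A [fA YA cA conA]] := IH (\bigcup_(x in X) (Y x).1).
- by apply: bigcup_finite => // x /XW /YP[[]].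
- by move=> z [x /XW /YP[_ + _ _]]; apply.
have JA t : J t -> task i t.1 t.2 /\ (forall x, x \in t.2 -> A x).
  move=> [x Xx Jt]; have [_ _ /(_ _ Jt)[ok sY] _] := YP _ (XW _ Xx).
  by split=> // z /sY Yz; apply: YA; exists x.
exists (ext_on i A J); split.
- by apply: ext_on_finite => //; apply: bigcup_finite => // x /XW /YP[[]].
- move=> x Xx; have [_ _ _] := YP _ (XW _ Xx); apply => z Yz; last by exists x.
  by apply: YA; exists x.
- exact: ext_on_closed.
- exact: ext_on_connected.
Qed.

Section Realize.
Variables (V2 : choiceType) (e2 : rel V2) (side2 : pred V2).
Hypothesis e2C : symmetric e2.
Hypothesis e2_side : forall x y, e2 x y -> side2 x != side2 y.

(** Enumerate [G] starting with the image of [S]. The resulting code, together with the list of the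
    vertices of [S], is a task, and its piece in the next stage is a copy of [G] over [S]. *)
Lemma realize i S G psi : ~~ odd i -> finite_set S -> S !=set0 ->
  closed_in tadj n (W i) S -> iso_on tadj e2 S psi -> side_on tside side2 S psi ->
  finite_set G -> closed_in e2 n G (psi @` S) -> tf e2 n G -> walk_connected e2 G ->
  exists U psi', [/\ S `<=` U, finite_set U, closed_in tadj n (W i.+1) U,
      walk_connected tadj U & forall x, S x -> psi' x = psi x] /\
    [/\ iso_on tadj e2 U psi', psi' @` U = G & side_on tside side2 U psi'].
Proof.
move=> ei /finite_seqP[s0 Ss0] [xS SxS] cS ipsi spsi /finite_seqP[g0 Gg0] cG tG conG.
pose s := undup s0; have Ss : S = [set` s].
  by rewrite Ss0; apply/seteqP; split=> z /=; rewrite mem_undup.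
have sS z : z \in s -> S z by rewrite Ss.
have us : uniq s by exact: undup_uniq.
pose x0 := psi xS.
pose u := map psi s ++ [seq y <- undup g0 | y \notin map psi s].
have [SG cGS] := cG.
have uG y : y \in u <-> G y.
  rewrite mem_cat mem_filter mem_undup Gg0 /=; case: (boolP (y \in map psi s)) => //= ys.
  split=> // _; have /mapP[z zs yE] := ys.
  suff : G y by rewrite Gg0.
  by apply: SG; exists z; [exact: sS | rewrite yE].
have uu : uniq u.
  rewrite cat_uniq; apply/and3P; split.
  - rewrite map_inj_in_uniq // => x y xs ys; have [hi _] := ipsi.
    by apply: hi; exact: sS.
  - by apply/hasPn => y; rewrite mem_filter => /andP[].
  - by apply: filter_uniq; exact: undup_uniq.
pose m := size u.
have sm : size s <= m by rewrite /m size_cat size_map leq_addr.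
pose nu k := nth x0 u k.
have nuS k : k < size s -> nu k = psi (nth center s k).
  by move=> ks; rewrite /nu nth_cat size_map ks (nth_map center).
pose c : code := ([seq kl <- [seq (k, l) | k <- iota 0 m, l <- iota 0 m] |
  e2 (nu kl.1) (nu kl.2)], map side2 u).
have cm : size c.2 = m by rewrite size_map.
have cE k l : cadj c k l = [&& k < m, l < m & e2 (nu k) (nu l)].
  rewrite /cadj mem_filter /= andbC; apply/idP/idP => [/andP[/allpairsP[[a b]]]|].
    by rewrite !mem_iota /= !add0n => -[am bm [-> ->]] ->; rewrite am bm.
  by move=> /and3P[km lm ->]; rewrite andbT; apply/allpairsP; exists (k, l); rewrite !mem_iota.
have cvE k : cvert c k <-> k < m by rewrite /cvert /= cm.
have cs k : k < m -> cside c k = side2 (nu k).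
  by move=> km; rewrite /cside (nth_map x0).
have inu : iso_on (cadj c) e2 (cvert c) nu.
  split=> k l /cvE km /cvE lm; last by rewrite cE km lm.
  by move=> /eqP; rewrite nth_uniq // => /eqP.
have nuG : nu @` cvert c = G.
  apply/seteqP; split=> [_ [k /cvE km <-]|y /uG yu]; first by apply/uG; exact: mem_nth.
  by exists (index y u); [apply/cvE; rewrite index_mem | rewrite /nu nth_index].
have nuSS : nu @` [set k | k < size s] = psi @` S.
  apply/seteqP; split=> [_ [k ks <-]|_ [z Sz <-]].
    by rewrite nuS //; exists (nth center s k) => //; apply: sS; exact: mem_nth.
  have zs : z \in s by move: Sz; rewrite Ss.
  by exists (index z s); rewrite /= ?index_mem // nuS ?index_mem // nth_index.
have [mu [muK imu]] := iso_inv 0 inu.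
have sc : [set k | k < size s] `<=` cvert c.
  by move=> k /= ks; apply/cvE; exact: leq_trans ks sm.
rewrite nuG in imu.
have muG : mu @` G = cvert c by rewrite -nuG; exact: iso_image_cancel muK.
have ok : task i c s.
  split.
  - split.
    + move=> k l; rewrite cE => /and3P[km lm ekl]; split; [|exact/cvE|exact/cvE|].
        by rewrite cE km lm e2C.
      by rewrite !cs // e2_side.
    + by rewrite -muG; exact: (iso_tf imu).
    + by rewrite -muG; exact: (iso_connected imu).
    + rewrite -muG -(iso_image_cancel sc muK) nuSS; exact: (iso_closed imu).
  - rewrite us cm sm andbT; split=> //.
    by case: (s) Ss => // S0; move: SxS; rewrite S0.
  - by move=> x xs; have [SW _] := cS; apply: SW; exact: sS.
  - by rewrite -Ss.
  - move=> k l ks ls; have [_ he] := ipsi.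
    have Sk : S (nth center s k) by apply: sS; exact: mem_nth.
    have Sl : S (nth center s l) by apply: sS; exact: mem_nth.
    rewrite cE (leq_trans ks sm) (leq_trans ls sm) /= !nuS // he //; split=> //.
    by rewrite cs ?(leq_trans ks sm) // nuS // spsi.
have ip := ext_iso ei ok.
have [pi [piK ipi]] := iso_inv 0 ip.
have piU : pi @` piece i c s = cvert c by exact: iso_image_cancel piK.
exists (piece i c s), (fun z => nu (pi z)).
have SU : S `<=` piece i c s by move=> z; rewrite Ss => /(old_piece ok).
split; split=> //.
- exact: piece_finite.
- have -> : piece i c s = ext_on i S [set (c, s)].
    apply/seteqP; split=> [z pz|z [/SU//|[_ -> //]]].
    by right; exists (c, s).
  by apply: ext_on_closed => // _ ->; split=> // x; exact: sS.
- exact: piece_connected.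
- move=> x Sx; have xs : x \in s by move: Sx; rewrite Ss.
  have xk : extp i.+1 c s (index x s) = x.
    by rewrite extp_old ?index_mem // nth_index.
  have km : index x s < size s by rewrite index_mem.
  rewrite -[in pi x]xk piK ?nuS ?nth_index //.
  by apply/cvE; exact: leq_trans km sm.
- by apply: (iso_comp ipi); rewrite piU.
- apply/seteqP; split=> [_ [z Uz <-]|y].
    by rewrite -nuG -piU; exists (pi z) => //; exists z.
  by rewrite -nuG -piU => -[_ [z Uz <-] <-]; exists z.
- by move=> _ [k kc <-]; rewrite piK // (ext_side ok kc) cs //; exact/cvE.
Qed.

End Realize.

Definition tower : bigraph := BiGraph tadj_sym tadj_side.

Lemma tower_gonlike (D : bigraph) : gonlike n [set: D] ->
  @gonlike n tower tvert.
Proof.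
move=> [_ tD _ [c [ec cper cn]]].
split; [exact: tadj_vert | exact: tvert_tf | exact: tvert_diam |].
(* The 2n-cycle of the tower is a copy of one of [D], glued along the centre; since the centre has
   side [true], it must replace a vertex of that side. *)
have [j cj] : exists j, side (c j) = true.
  have := adj_side (ec 0); case E0 : (side (c 0)); first by exists 0.
  by case E1 : (side (c 1)) => // _; exists 1.
pose S : set T := [set center]; pose G := range c.
have tG : tf (@adj D) n G by apply: tfS tD.
have one (V : Type) (e : rel V) (P : set V) x : P x -> tf e n P -> closed_in e n P [set x].
  move=> Px tP; split=> [_ ->//|g L Ln bg /= g0 gL k kL].
  have [L0|L0] := posnP L; first by rewrite (_ : k = 0) //; lia.
  by case: (tP g L _ bg); [lia | rewrite g0 gL].
have psiS : (fun=> c j) @` S = [set c j].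
  by apply/seteqP; split=> [_ [_ _ <-]|_ ->] //; exists center.
have [|||||||||U [psi' [[_ _ _ _ _] [ipsi psiU _]]]] :=
  @realize _ (@adj D) (@side D) (@adj_sym D) (@adj_side D) 0 S G (fun=> c j) isT.
- exact: finite_set1.
- by exists center.
- by apply: one; [left | exact: stage_tf].
- split=> [_ _ -> ->//|_ _ -> ->].
  by apply/idP/idP => [/adj_side|/tadj_side]; rewrite eqxx.
- by move=> _ ->; rewrite cj tside_center.
- have -> : G = c @` `I_n.*2.
    apply/seteqP; split=> [_ [k _ <-]|_ [k _ <-]]; last by exists k.
    exists (k %% n.*2); first by rewrite /= ltn_pmod //; lia.
    exact: periodic_mod.
  by apply: finite_image; exact: finite_II.
- by rewrite psiS; apply: one => //; exists j.
- by [].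
- move=> _ _ [a _ <-] [b _ <-].
  exists (fun k => c (a + k)), (b + a * n.*2 - a); split.
  + by split=> [k _|k _]; [exists (a + k) | rewrite addnS].
  + by rewrite addn0.
  + rewrite subnKC; first exact: periodicM.
    apply: leq_trans (leq_addl _ _).
    by rewrite leq_pmulr //; lia.
have [g [gK ig]] := iso_inv center ipsi; have [gi ge] := ig.
have Gc k : (psi' @` U) (c k) by rewrite psiU; exists k.
exists (fun k => g (c k)); split=> k.
- by change (tadj (g (c k)) (g (c k.+1))); rewrite ge.
- by rewrite cper.
- by move=> /gi => /(_ (Gc _) (Gc _)) /cn.
Qed.

(** The image of a path vertex need not be the chosen one of its two descriptions, so it is rebuilt
    through [arcv]. *)
Definition renode (m : nat) (s : seq T) : T :=
  match (unpickle m : option tag), s with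
  | Some (i, inl (b, k)), [:: x; y] => arcv i b k x y
  | _, _ => GenTree.Node m s
  end.

Fixpoint act (f : K -> K) (t : T) : T :=
  match t with
  | GenTree.Leaf a => GenTree.Leaf (f a)
  | GenTree.Node m s => renode m (map (act f) s)
  end.

Lemma act_ext f i c k s :
  act f (node (i, inr (c, k)) s) = node (i, inr (c, k)) (map (act f) s).
Proof. by rewrite /node /= /renode pickleK. Qed.

Lemma act_center f : act f center = center.
Proof. by rewrite /center /node /= /renode pickleK. Qed.

Lemma act_arcv f i b k x y : k <= n.-1 ->
  act f (arcv i b k x y) = arcv i b k (act f x) (act f y).
Proof.
move=> kn; case: (arcvP i b k x y) => ->; rewrite /node /= /renode pickleK //.
by rewrite arcvC ?leq_subr // subKn.
Qed.

Lemma tside_act f t : tside (act f t) = tside t.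
Proof.
case: t => [//|m s]; rewrite /= /renode.
case U : (unpickle m : option tag) => [[i [[b k]|ck]]|] //=; rewrite ?U //.
case: (map (act f) s) => [|x [|y [|? ?]]] /=; rewrite ?U //.
by case: (arcvP i b k x y) => ->; rewrite tside_arc.
Qed.

Lemma act_arcp f i x y k : k <= n.-1 ->
  act f (arcp i x y k) = arcp i (act f x) (act f y) k.
Proof. by move=> kn; rewrite /arcp !(fun_if (act f)) act_arcv // tside_act. Qed.

Lemma act_extp f i c s k : act f (extp i c s k) = extp i c (map (act f) s) k.
Proof.
rewrite /extp size_map; case: ifP => ks; last exact: act_ext.
by rewrite (nth_map center).
Qed.

(* Off the tower a path vertex may carry the wrong one of its two descriptions,
   so the functor laws hold on the stages only. *)
Lemma stage_ind (P : T -> Prop) : P center -> (forall a, P (GenTree.Leaf a)) ->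
  (forall i x y k, k < n.-1 -> P x -> P y -> P (arcp i x y k)) ->
  (forall i c s k, (forall z, z \in s -> P z) -> P (extp i c s k)) ->
  forall z, tvert z -> P z.
Proof.
move=> Pc Pl Pa Pe z [i _]; elim: i z => [|i IH] z; first by case=> [->|[a ->]].
have [oi|ei] := boolP (odd i).
  have [Wz|nWz] := pselect (W i z); first by move=> _; exact: IH.
  move=> Wz; have [x [y [k [[Wx Wy _ _] kn ->]]]] := fstep_newP (arc_stage oi) Wz nWz.
  by apply: Pa; [lia | exact: IH..].
case/(ext_vert ei) => [/IH//|[c [s [k [[_ _ sW _ _] _ ->]]]]].
by apply: Pe => w /sW /IH.
Qed.

Lemma act_comp f g z : tvert z -> act f (act g z) = act (f \o g) z.
Proof.
move: z; apply: stage_ind.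
- by rewrite act_center act_center act_center.
- by [].
- by move=> i x y k kn xE yE; rewrite !act_arcp ?xE ?yE //; exact: ltnW.
- move=> i c s k sE; rewrite !act_extp -map_comp; congr extp.
  by apply/eq_in_map => z zs; exact: sE.
Qed.

Lemma act_id f z : (forall a, f a = a) -> tvert z -> act f z = z.
Proof.
move=> fE; move: z; apply: stage_ind.
- exact: act_center.
- by move=> a /=; rewrite fE.
- by move=> i x y k kn xE yE; rewrite act_arcp ?xE ?yE //; exact: ltnW.
- by move=> i c s k sE; rewrite act_extp map_id_in.
Qed.

(** The induction needs [f] and its inverse together: only then is [act f] an isomorphism of the
    stage, which preserves pairs at distance n + 1 and tasks. *)
Lemma act_stage i f g : cancel f g -> cancel g f ->
  (forall z, W i z -> W i (act f z)) /\
  (forall u v, E i u v -> E i (act f u) (act f v)).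
Proof.
elim: i f g => [|i IH] f g fg gf.
  split.
    by move=> z [->|[a ->]]; [left; exact: act_center | right; exists (f a)].
  move=> u v /star_edge[[-> [a ->]]|[-> [a ->]]]; apply/star_edge; rewrite act_center.
    by left; split=> //; exists (f a).
  by right; split=> //; exists (f a).
have [Wf Ef] := IH f g fg gf; have [Wg Eg] := IH g f gf fg.
have gK z : W i z -> act g (act f z) = z.
  by move=> Wz; rewrite act_comp ?act_id //; exists i.
have fK z : W i z -> act f (act g z) = z.
  by move=> Wz; rewrite act_comp ?act_id //; exists i.
have fi : iso_on (E i) (E i) (W i) (act f).
  split=> u v Wu Wv; first by move=> fE; rewrite -(gK u) // fE gK.
  by apply/idP/idP => [/Eg|/Ef//]; rewrite !gK.
have fim : act f @` W i = W i.
  apply/seteqP; split=> [_ [z Wz <-]|z Wz]; first exact: Wf.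
  by exists (act g z); [exact: Wg | exact: fK].
have farf x y : far (E i) n (W i) x y -> far (E i) n (W i) (act f x) (act f y).
  by move=> /(iso_far_half fi (@subset_refl _ _)); rewrite fim.
have okf c s : ext_ok (E i) (W i) c s -> ext_ok (E i) (W i) c (map (act f) s).
  move=> [ok1 [us ss] sW cs okE]; split.
  - by rewrite size_map.
  - rewrite size_map map_inj_in_uniq // => u v /sW Wu /sW Wv; exact: fi.1.
  - by move=> _ /mapP[z /sW Wz ->]; exact: Wf.
  - have -> : [set` map (act f) s] = act f @` [set` s].
      apply/seteqP; split=> [_ /mapP[z zs ->]|_ [z zs <-]]; first by exists z.
      by rewrite /= map_f.
    by rewrite -{1}fim; exact: (iso_closed fi).
  - move=> k l; rewrite size_map => ks ls; rewrite !(nth_map center) //.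
    rewrite tside_act fi.2; [exact: okE | apply: sW; exact: mem_nth..].
split.
  move=> z /=; case: ifP => _ [/Wf Wz|]; [by left | | by left |].
    move=> [x [y [k [fxy kn ->]]]]; right; exists (act f x), (act f y), k.
    by split=> //; [exact: farf | rewrite act_arcp //; lia].
  move=> [c [s [k [ok sk ->]]]]; right; exists c, (map (act f) s), k.
  by rewrite size_map act_extp; split=> //; exact: okf.
move=> u v /=; case: ifP => _ /asboolP[/Ef Euv|]; try by apply/asboolP; left.
  move=> [x [y [k [fxy kn -> ->]]]]; apply/asboolP; right.
  exists (act f x), (act f y), k; split=> //; first exact: farf.
    by rewrite act_arcp //; lia.
  by rewrite act_arcp.
move=> [c [s [k [l [ok kl -> ->]]]]]; apply/asboolP; right.
by exists c, (map (act f) s), k, l; rewrite !act_extp; split=> //; exact: okf.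
Qed.

Lemma act_vert f g z : cancel f g -> cancel g f -> tvert z -> tvert (act f z).
Proof.
by move=> fg gf [i _ Wz]; exists i => //; have [Wf _] := act_stage i fg gf; exact: Wf.
Qed.

Lemma act_image f g : cancel f g -> cancel g f -> act f @` tvert = tvert.
Proof.
move=> fg gf; apply/seteqP; split=> [_ [z Oz <-]|z Oz]; first exact: act_vert Oz.
exists (act g z); first exact: (act_vert gf fg).
by rewrite act_comp // act_id.
Qed.

Lemma act_iso f g : cancel f g -> cancel g f -> iso_on tadj tadj tvert (act f).
Proof.
move=> fg gf.
have gK z : tvert z -> act g (act f z) = z by move=> Oz; rewrite act_comp ?act_id.
split=> u v Ou Ov; first by move=> fE; rewrite -(gK u) // fE gK.
apply/asboolP/asboolP => -[i Euv]; exists i; last first.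
  by have [_ Ef] := act_stage i fg gf; exact: Ef.
by have [_ Eg] := act_stage i gf fg; rewrite -(gK u) // -(gK v) //; exact: Eg.
Qed.

Lemma leaf_vert a : tvert (GenTree.Leaf a).
Proof. by exists 0 => //; right; exists a. Qed.

End Tower.

(** * Free polygons and closed subsets *)

Lemma free_data n (D : bigraph) : 2 < n -> free_over_finite n D ->
  exists (F : nat -> set D) q, [/\ finite_set (F 0), walk_connected (@adj D) (F 0),
    forall j, fstep (@adj D) n (F j) (F j.+1) (q j) & \bigcup_j F j = setT].
Proof.
move=> n2 [G [fG cG _ [F [F0 Fs FT]]]]; subst G.
have /choice[q qP] j : exists q, fstep (@adj D) n (F j) (F j.+1) q.
  exact/free_stepP.
exists F, q; split=> // x y Fx Fy; have [p pp] := cG x y Fx Fy.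
have [g [wg g0 gL _]] := path_walk pp.
exists g, (size p); split=> //; case: p {pp} wg gL => [|z p] wg gL.
  by split=> // j; rewrite leqn0 => /eqP ->; rewrite g0.
exact/walk_induced.
Qed.

Lemma sub_closed_in (V : choiceType) (e : rel V) n P A B : closed_in e n P A ->
  B `<=` P -> closed_in e n B (A `&` B).
Proof.
move=> [AP cA] BP; split=> [z []//|g L Ln bg [A0 _] [AL _] k kL].
split; first exact: (cA _ _ Ln (nbwS BP bg)).
by have [[Bg _] _] := bg; apply: Bg.
Qed.

Section FreeOver.
Variables (n : nat) (D : bigraph).
Local Notation e := (@adj D).
Hypothesis n_gt2 : 2 < n.
Hypothesis gD : gonlike n [set: D].
Variables (F : nat -> set D) (q : nat -> D -> D -> nat -> D).
Hypothesis Fq : forall j, fstep e n (F j) (F j.+1) (q j).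
Hypothesis FT : \bigcup_j F j = setT.
Hypothesis conF : walk_connected e (F 0).
Variables (A X : set D) (C : nat -> set D) (p : nat -> D -> D -> nat -> D).
Hypothesis cA : closed_in e n setT A.
Hypothesis XA : X `<=` A `&` F 0.
Hypothesis Amin : forall B, closed_in e n setT B -> X `<=` B -> A `<=` B.
Hypothesis Cp : forall j, fstep e n (C j) (C j.+1) (p j).
Hypothesis CA : \bigcup_j C j = A.
Hypothesis AFC : A `&` F 0 `<=` C 0.
Hypothesis conC : walk_connected e (C 0).
Hypothesis CF : C 0 `&` F 0 !=set0.

Lemma union_connected : walk_connected e (C 0 `|` F 0).
Proof.
have [z [Cz Fz]] := CF.
apply: (connected_retract (@adj_sym D) _ conC) => [x|x]; first by left.
case=> [//|Fx] _; have [g [L [wg g0 gL]]] := conF Fx Fz.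
by exists g, L; rewrite gL; split=> //; apply: walkS wg => w; right.
Qed.

(** [A] is arcful for the stages of [D], since its generators lie in [F 0]; hence the lexicographic
    rank is tame. The chain that starts from the base is closed in the union and contains [F 0],
    which generates [D]. *)
Lemma free_union : exists Z z, [/\ Z 0 = C 0 `|` F 0,
  forall j, fstep e n (Z j) (Z j.+1) (z j) & \bigcup_j Z j = setT].
Proof.
have [eOm tD diam _] := gD; have eC := @adj_sym D; have eS := @adj_side D.
have Fm := stages_mono Fq; have Cm := stages_mono Cp.
have [rF] := ex_level Fm; rewrite FT => rFP; have {}rFP z k := rFP z k I.
have [rC] := ex_level Cm; rewrite CA => rCP.
have Ft k := fstep_tight n_gt2 eC (Fq k).
have Ct k := fstep_tight n_gt2 eC (Cp k).
have tF : tame e n setT rF (F 0).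
  have := @tame_levels _ e n n_gt2 F _ eC Ft rF _ 0; rewrite FT.
  move=> /(_ (fun _ _ _ => I) (fun z k _ => rFP z k)).
  by rewrite (_ : (fun z => rF z - 0) = rF) //; apply/funext => z; rewrite subn0.
have aA : arcful e n setT rF (F 0) A.
  exact: (closure_arcful eC n_gt2 eOm tF cA XA Amin).
have CsA k : C k `<=` A by move=> z Cz; rewrite -CA; exists k.
have tL := tame_lex eC n_gt2 Ft Ct rFP rCP CsA AFC aA.
pose B := C 0 `|` F 0.
have cB : closed_in e n B B by split=> // g L _ [[Bg _] _] _ _.
have BB : B `<=` B by [].
exists (chain e n setT B), (fun _ => geo e n setT); split=> //.
  exact: (chain_fstep eC eS n_gt2 eOm tD diam tL BB cB).
have hc := hull_closed eC eS n_gt2 eOm tD diam tL BB cB union_connected.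
apply/seteqP; split=> // z _.
have : hull e n setT B z.
  apply: (stages_min n_gt2 Fq hc) => //; last by rewrite FT.
  by move=> w Fw; exists 0; right.
by move=> [j Bz]; exists j.
Qed.

End FreeOver.

(** * Closed sets generated by a finite part of a stage *)

Section TowerHull.
Variables (K : choiceType) (n : nat).
Hypothesis n_gt2 : 2 < n.
Local Notation T := (GenTree.tree K).
Local Notation e := (@tadj K n).
Local Notation Om := (@tvert K n).
Local Notation W i := (@stage K n i).1.
Local Notation H V := (hull e n Om V).

Let eC : symmetric e := tadj_sym n_gt2.
Let eS := @tadj_side K n n_gt2.
Let eOm := @tadj_vert K n n_gt2.
Let tO := @tvert_tf K n n_gt2.
Let dO := @tvert_diam K n n_gt2.
Let Wm : forall i j, i <= j -> W i `<=` W j := @stage_mono K n.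

Section Hull.
Variables (i : nat) (V : set T).
Hypothesis fV : finite_set V.
Hypothesis conV : walk_connected e V.
Hypothesis cV : closed_in e n (W i) V.

Lemma stage_tame : exists r : T -> nat, (forall z k, Om z -> (W k z <-> r z <= k)) /\
  forall i, tame e n Om (fun z => r z - i) (W i).
Proof.
have [r rP] := ex_level Wm; exists r; split=> // j.
exact: (tame_levels n_gt2 eOm eC (stage_tight n_gt2) rP).
Qed.

Let VW : V `<=` W i. Proof. by case: cV. Qed.

Lemma tower_hull_fstep j : fstep e n (chain e n Om V j) (chain e n Om V j.+1) (geo e n Om).
Proof. by have [r [_ tW]] := stage_tame; exact: (chain_fstep eC eS n_gt2 eOm tO dO (tW i)). Qed.

Lemma tower_hull_closed : closed_in e n Om (H V).
Proof. by have [r [_ tW]] := stage_tame; exact: (hull_closed eC eS n_gt2 eOm tO dO (tW i)). Qed.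

Lemma tower_hull_connected : walk_connected e (H V).
Proof.
by have [r [_ tW]] := stage_tame; exact: (hull_connected eC eS n_gt2 eOm tO dO (tW i)).
Qed.

Lemma tower_hull_base : H V `&` W i `<=` V.
Proof. by have [r [_ tW]] := stage_tame; exact: (hull_base eC eS n_gt2 eOm tO dO (tW i)). Qed.

Lemma tower_hull_min C : closed_in e n Om C -> V `<=` C -> H V `<=` C.
Proof.
have [r [_ tW]] := stage_tame.
by move=> cC VC; apply: (hull_min eC eS n_gt2 eOm tO dO (tW i)).
Qed.

(** A vertex of the hull that appears at stage j + 1 lies on an arc whose ends are in the hull at
    stage j. Such an arc is determined by its ends, so finitely many vertices are added, all
    connected to the old ones. *)
Lemma tower_trace j : i <= j ->
  finite_set (H V `&` W j) /\ walk_connected e (H V `&` W j).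
Proof.
have [r [rP tW]] := stage_tame.
have base : H V `&` W i = V.
  apply/seteqP; split; first exact: tower_hull_base.
  by move=> z Vz; split; [exists 0 | exact: VW].
elim: j => [|j IH]; first by rewrite leqn0 => /eqP <-; rewrite base.
rewrite leq_eqVlt ltnS => /predU1P[<-|ij]; first by rewrite base.
have [fj cj] := IH ij.
have new z : H V z -> W j.+1 z -> ~ W j z -> exists g k,
    [/\ nbw e Om g n.-1, 0 < k < n.-1, g k = z, (H V `&` W j) (g 0) /\ (H V `&` W j) (g n.-1) &
    forall l, l <= n.-1 -> (H V `&` W j.+1) (g l)].
  move=> Hz Wz nWz; have nWi : ~ W i z by move=> /(Wm ij).
  have [g [k [ag kn gk Hg]]] := hull_arcful eC eS n_gt2 eOm tO dO (tW i) VW cV Hz nWi.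
  have [bg rg g0 gL _] := ag; have [[Og _] _] := bg.
  have Oz : Om z by exists j.+1.
  have rz : r z = j.+1.
    have := (rP z j.+1 Oz).1 Wz; have : ~ r z <= j by move/(rP z j Oz).
    by lia.
  have r1 : r (g 1) - i = r z - i by rewrite -(rg k kn) gk.
  rewrite !ltEnat /= in g0 gL.
  exists g, k; split=> //.
    by split; split; try exact: Hg; apply/rP; by [exact: Og | lia].
  move=> l ln; split; first exact: Hg.
  apply/rP; first exact: Og.
  have [->|l0] := posnP l; first by lia.
  have [->|ln'] : l = n.-1 \/ 0 < l < n.-1 by lia.
    by lia.
  by have := rg l ln'; lia.
have tr : H V `&` W j `<=` H V `&` W j.+1 by move=> z [Hz /(Wm (leqnSn j))].
split.
  pose f (t : T * T * nat) := geo e n Om t.1.1 t.1.2 t.2.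
  pose Y := H V `&` W j.
  apply: (@sub_finite_set _ _ (Y `|` f @` (Y `*` Y `*` `I_n))).
    move=> z [Hz Wz]; have [Wj|nWj] := pselect (W j z); [by left | right].
    have [g [k [bg kn gk [g0 gL] _]]] := new z Hz Wz nWj.
    exists (g 0, g n.-1, k); first by split=> //=; lia.
    by rewrite /f /= (geoE eC n_gt2 tO bg) //; lia.
  rewrite finite_setU; split=> //; apply: finite_image.
  by apply: finite_setX; [exact: finite_setX | exact: finite_II].
apply: (connected_retract eC tr cj) => z [Hz Wz] nW.
have nWj : ~ W j z by move=> Wj; apply: nW.
have [g [k [[[_ eg] _] kn gk [g0 _] gW]]] := new z Hz Wz nWj.
exists (wrev g k), k; rewrite /wrev subn0 subnn; split=> //.
by apply: (walk_rev eC); split=> l lk; [apply: gW | apply: eg]; lia.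
Qed.

End Hull.

Definition based i (V : set T) :=
  [/\ finite_set V, walk_connected e V, closed_in e n (W i) V & V !=set0].

(** Allows the generating set to be moved to any later stage, in particular to an even one as
    [realize] requires. *)
Lemma rebase i V j : based i V -> i <= j ->
  based j (H V `&` W j) /\ H (H V `&` W j) = H V.
Proof.
move=> [fV conV cV [x Vx]] ij; have [fj cj] := tower_trace fV conV cV ij.
have VW : V `<=` W i by case: cV.
have Vj : V `<=` H V `&` W j.
  by move=> z Vz; split; [exists 0 | exact: Wm ij _ (VW _ Vz)].
have cH := tower_hull_closed conV cV.
have bj : based j (H V `&` W j).
  split=> //; last by exists x; exact: Vj.
  by apply: sub_closed_in cH _ => z Wz; exists j.
split=> //; have [_ cj' ccj _] := bj.
apply/seteqP; split.
  by apply: (tower_hull_min ccj cH) => z [].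
apply: (tower_hull_min cV); first exact: (tower_hull_closed cj' ccj).
by move=> z /Vj Vz; exists 0.
Qed.

End TowerHull.

(** * Back and forth *)

Section LnGeneral.
Variable n : nat.
Implicit Types M N P : Ln_struct n.

Definition gen_by M (X A : set M) :=
  X `<=` A /\ forall C, Ln_closed C -> X `<=` C -> A `<=` C.

Lemma emb_comp M N P (A : set M) (B : set N) (h : M -> N) (k : N -> P) :
  emb A h -> emb B k -> h @` A `<=` B -> emb A (k \o h).
Proof.
move=> [hi hP hf] [ki kP kf] AB.
have Bh x : A x -> B (h x) by move=> Ax; apply: AB; exists x.
split=> [x y Ax Ay|x Ax|f x y Ax Ay] /=.
- by move=> /(ki _ _ (Bh _ Ax) (Bh _ Ay)) /(hi _ _ Ax Ay).
- by rewrite kP ?hP //; exact: Bh.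
- by rewrite hf // kf //; exact: Bh.
Qed.

Lemma emb_sub M N (A B : set M) (h : M -> N) : B `<=` A -> emb A h -> emb B h.
Proof.
move=> BA [hi hP hf]; split=> [x y /BA Ax /BA Ay|x /BA Ax|k x y /BA Ax /BA Ay].
- exact: hi.
- exact: hP.
- exact: hf.
Qed.

Lemma emb_aut M (g : Aut M) : emb setT g.
Proof.
have /asboolP[bg Pg fg] := autP g; split=> // x y _ _.
exact: bij_inj.
Qed.

Lemma emb_closed M N (A : set M) (h : M -> N) : emb A h -> Ln_closed A ->
  Ln_closed (h @` A).
Proof.
move=> [_ _ hf] Acl k _ _ [x Ax <-] [y Ay <-].
by exists (Ln_f k x y); [exact: Acl | rewrite hf].
Qed.

Lemma emb_preimage_closed M N (A : set M) (h : M -> N) C : emb A h ->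
  Ln_closed A -> Ln_closed C -> Ln_closed [set x | A x /\ C (h x)].
Proof.
move=> [_ _ hf] Acl Ccl k x y [Ax Cx] [Ay Cy]; split; first exact: Acl.
by rewrite hf //; exact: Ccl.
Qed.

Lemma emb_gen M N (A X : set M) (h : M -> N) : emb A h -> Ln_closed A ->
  gen_by X A -> gen_by (h @` X) (h @` A).
Proof.
move=> eh Acl [XA XC]; split; first exact: image_subset.
move=> C Ccl hXC _ [x Ax <-].
suff : A `<=` [set x | A x /\ C (h x)] by move=> /(_ x Ax)[].
apply: XC; first exact: emb_preimage_closed.
by move=> z Xz; split; [exact: XA | apply: hXC; exists z].
Qed.

Lemma emb_agree M N (A X : set M) (h h' : M -> N) : emb A h -> emb A h' ->
  Ln_closed A -> gen_by X A -> (forall x, X x -> h x = h' x) ->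
  forall x, A x -> h x = h' x.
Proof.
move=> [_ _ hf] [_ _ hf'] Acl [XA XC] hh x Ax.
suff : A `<=` [set x | A x /\ h x = h' x] by move=> /(_ x Ax)[].
apply: XC; last by move=> z Xz; split; [exact: XA | exact: hh].
move=> k u v [Au hu] [Av hv]; split; first exact: Acl.
by rewrite hf // hf' // hu hv.
Qed.

Lemma fin_gen_sub M (A X : set M) (Acl : Ln_closed A) : finite_set X ->
  gen_by X A -> fin_gen (sub_struct (Substructure Acl)).
Proof.
move=> fX [XA XC]; exists (set_val @^-1` X : set (set_type A)).
  by apply: finite_preimage fX => x y _ _; exact: val_inj.
move=> B XB Bcl; apply/seteqP; split=> // y _.
have CA : A `<=` set_val @` (B : set (set_type A)).
  apply: XC.
    move=> k _ _ [x Bx <-] [z Bz <-].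
    by exists (Ln_f k (x : sub_struct (Substructure Acl)) z) => //; exact: Bcl.
  move=> x Xx; have Ax := XA _ Xx; exists (SigSub (mem_set Ax)) => //.
  exact: XB.
have [b Bb bE] := CA _ (set_valP y).
by have -> : y = b by apply: val_inj; rewrite -bE.
Qed.

Lemma iso_sub_emb M N (A : set M) (Acl : Ln_closed A) (B : substructure N) :
  A !=set0 -> isomorphic (sub_struct (Substructure Acl)) (sub_struct B) ->
  exists h : M -> N, emb A h.
Proof.
move=> [a Aa] [h [bh hP hf]]; pose a0 : set_type A := SigSub (mem_set Aa).
pose i x : set_type A := insubd a0 x.
have iK x : A x -> set_val (i x) = x by move=> /mem_set Ax; exact: insubdK.
exists (fun x => set_val (h (i x))); split=> [x y Ax Ay E|x Ax|k x y Ax Ay].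
- have : h (i x) = h (i y) by apply: val_inj.
  by move=> /(bij_inj bh) ixy; rewrite -(iK x) // ixy iK.
- by rewrite -[in RHS](iK x) //; exact: hP.
- have -> : i (Ln_f k x y) = @sub_f n M (Substructure Acl) k (i x) (i y).
    apply: val_inj.
    change (set_val (i (Ln_f k x y)) = Ln_f k (set_val (i x)) (set_val (i y))).
    by rewrite (iK _ (Acl k x y Ax Ay)) !iK.
  by have := congr1 set_val (hf k (i x) (i y)).
Qed.

(** Homogeneity in the form used below: two embeddings of the same finitely generated set differ by
    an automorphism of the target. *)
Lemma homog_emb M N (A X : set M) (phi theta : M -> N) : homogeneous N ->
  Ln_closed A -> finite_set X -> gen_by X A -> emb A phi -> emb A theta ->
  exists g : Aut N, forall x, A x -> g (theta x) = phi x.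
Proof.
move=> hN Acl fX gX ephi eth.
have [pi pP pf] := ephi; have [ti tP tf] := eth.
pose B := Substructure (emb_closed eth Acl).
pose C := Substructure (emb_closed ephi Acl).
have /choice[a aP] (u : sub_struct B) : exists x, A x /\ theta x = set_val u.
  by have [x Ax xE] := set_valP u; exists x.
have /choice[b bP] (u : sub_struct C) : exists x, A x /\ phi x = set_val u.
  by have [x Ax xE] := set_valP u; exists x.
have inC u : (phi @` A) (phi (a u)) by exists (a u) => //; case: (aP u).
have inB u : (theta @` A) (theta (b u)) by exists (b u) => //; case: (bP u).
pose h (u : sub_struct B) : sub_struct C := SigSub (mem_set (inC u)).
pose h' (u : sub_struct C) : sub_struct B := SigSub (mem_set (inB u)).
have ih : Ln_iso h.
  split.
  - exists h' => u; apply: val_inj.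
      have [Aa aE] := aP u; have [Ab bE] := bP (h u).
      change (theta (b (h u)) = set_val u); rewrite -aE; congr theta.
      exact: (pi _ _ Ab Aa bE).
    have [Ab bE] := bP u; have [Aa aE] := aP (h' u).
    change (phi (a (h' u)) = set_val u); rewrite -bE; congr phi.
    exact: (ti _ _ Aa Ab aE).
  - move=> u; have [Aa aE] := aP u.
    change (Ln_P (phi (a u)) = Ln_P (set_val u)).
    by rewrite pP // -(tP _ Aa) aE.
  - move=> k u v; apply: val_inj.
    have [Au uE] := aP u; have [Av vE] := aP v; have [Aw wE] := aP (Ln_f k u v).
    change (phi (a (Ln_f k u v)) = Ln_f k (phi (a u)) (phi (a v))).
    rewrite -pf //; congr phi; apply: (ti _ _ Aw (Acl k _ _ Au Av)).
    by rewrite wE tf // uE vE.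
have [||g gE] := hN B C h _ _ ih.
- by apply: fin_gen_sub (emb_gen eth Acl gX); exact: finite_image.
- by apply: fin_gen_sub (emb_gen ephi Acl gX); exact: finite_image.
exists g => x Ax; have Bx : (theta @` A) (theta x) by exists x.
pose u : sub_struct B := SigSub (mem_set Bx).
have [Aa aE] := aP u; have := gE u.
change (g (theta x) = phi (a u) -> g (theta x) = phi x) => ->.
by congr phi; exact: (ti _ _ Aa Ax aE).
Qed.

Definition Ln_hull M (X : set M) := [set x | forall C, Ln_closed C -> X `<=` C -> C x].

Lemma Ln_hull_closed M (X : set M) : Ln_closed (Ln_hull X).
Proof. by move=> k x y Hx Hy C Ccl XC; apply: (Ccl); [exact: Hx | exact: Hy]. Qed.

Lemma Ln_hull_gen M (X : set M) : gen_by X (Ln_hull X).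
Proof. by split=> [x Xx C _|C Ccl XC x]; [exact | apply]. Qed.

Lemma isomorphic_refl M : isomorphic M M.
Proof. by exists id; split=> //; exists id. Qed.

End LnGeneral.

Lemma finite_chain (V : choiceType) (F : nat -> set V) (X : set V) :
  (forall i j, i <= j -> F i `<=` F j) -> finite_set X -> X `<=` \bigcup_j F j ->
  exists j, X `<=` F j.
Proof.
move=> Fm /finite_seqP[s ->] sF.
elim: s sF => [|x s IH] sF; first by exists 0.
have [|i si] := IH; first by move=> z zs; apply: sF; rewrite /= inE zs orbT.
have [|j _ Fj] := sF x; first by rewrite /= mem_head.
exists (maxn i j) => z; rewrite /= inE => /predU1P[->|/si Fz].
  exact: Fm (leq_maxr i j) _ Fj.
exact: Fm (leq_maxl i j) _ Fz.
Qed.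

Section BackForth.
Variable n : nat.
Hypothesis n_gt2 : 2 < n.
Variable Gamma : Ln_struct n.
Hypothesis hGamma : fraisse_limit (@class_C n) Gamma.
Variable K : choiceType.
Local Notation D0 := (tower K n_gt2).
Local Notation N := (Ln_of n D0).
Local Notation e := (@tadj K n).
Local Notation Om := (@tvert K n).
Local Notation W i := (@stage K n i).1.
Local Notation H V := (hull e n Om V).
Hypothesis gT : @gonlike n D0 Om.

Definition cyclic_on (A : set D0) := exists c : nat -> D0,
  [/\ forall i, adj (c i) (c i.+1), forall i, c (i + n.*2) = c i,
      forall i, c i <> c i.+2 & forall i, A (c i)].

Lemma univ_emb (M : Ln_struct n) (A X : set M) (Acl : Ln_closed A) : finite_set X ->
  gen_by X A -> A !=set0 -> class_C (sub_struct (Substructure Acl)) ->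
  exists phi : M -> Gamma, emb A phi.
Proof.
move=> fX gX A0 cA; have [_ _ age] := hGamma.
have [/(_ cA)[B iB] _] := age _ (fin_gen_sub Acl fX gX).
exact: iso_sub_emb A0 iB.
Qed.

Section Based.
Variables (i : nat) (V : set D0).
Hypothesis bV : based n i V.

Lemma based_closed : closed_in (@adj D0) n Om (H V).
Proof. by have [_ conV cV _] := bV; exact: (tower_hull_closed n_gt2 conV cV). Qed.

Lemma based_Ln_closed : @Ln_closed n N (H V).
Proof. exact: (closed_in_Ln n_gt2 gT based_closed). Qed.

Lemma based_gen : @gen_by n N V (H V).
Proof.
have [_ _ cV _] := bV; split=> [z Vz|C Ccl VC]; first by exists 0.
have OmOm : closed_in (@adj D0) n Om Om by split=> // g L _ [[Og _] _] _ _.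
have OmL := closed_in_Ln n_gt2 gT OmOm.
have CO : @Ln_closed n N (C `&` Om).
  by move=> k x y [Cx Ox] [Cy Oy]; split; [apply: (Ccl) | apply: (OmL)].
have CO' : closed_in (@adj D0) n Om (C `&` Om).
  by apply: (Ln_closed_in n_gt2 gT) => // z [].
have VW : V `<=` Om by move=> z Vz; exists i => //; case: cV => + _; apply.
suff : H V `<=` C `&` Om by move=> h z /h[].
by apply: (tower_hull_min n_gt2 cV CO') => z Vz; split; [exact: VC | exact: VW].
Qed.

Lemma based_class_C : cyclic_on (H V) ->
  class_C (sub_struct (Substructure based_Ln_closed)).
Proof.
have [fV conV cV _] := bV => cyc.
apply: (sub_class_C n_gt2 gT based_closed (tower_hull_connected n_gt2 conV cV) cyc
  (F := chain e n Om V) (q := fun=> geo e n Om)) => //.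
  exact: (tower_hull_fstep n_gt2 cV).
by apply/seteqP; split=> z [j]; exists j.
Qed.

Lemma based_emb : cyclic_on (H V) -> exists phi : N -> Gamma, emb (H V : set N) phi.
Proof.
move=> cyc; have [fV _ _ [x Vx]] := bV.
apply: (@univ_emb N (H V) V based_Ln_closed fV based_gen _ (based_class_C cyc)).
by exists x, 0.
Qed.

End Based.

(** The cycle ensures that the domain is a generalized polygon, so that its larger hulls belong to
    [class_C]. *)
Definition good_emb (A : set N) (phi : N -> Gamma) :=
  [/\ exists i V, based n i V /\ A = H V, cyclic_on A & emb A phi].

Lemma finite_stage (X : set D0) : finite_set X -> X `<=` Om -> exists i, X `<=` W i.
Proof. exact: (finite_chain (@stage_mono K n)). Qed.

Lemma based_cofinal (X : set D0) : finite_set X -> X !=set0 -> X `<=` Om ->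
  exists i V, based n i V /\ X `<=` V.
Proof.
move=> fX [x Xx] XO; have [i Xi] := finite_stage fX XO.
have [V [fV XV cV conV]] := cofinal n_gt2 fX Xi.
by exists i, V; split=> //; split=> //; exists x; exact: XV.
Qed.

Lemma cyclicS (A B : set D0) : A `<=` B -> cyclic_on A -> cyclic_on B.
Proof. by move=> AB [c [ec cper cn Ac]]; exists c; split=> // i; exact: AB. Qed.

Lemma good_start : exists A phi, good_emb A phi.
Proof.
have [eOm tO _ [c [ec cper cn]]] := gT.
have n2 : 0 < n.*2 by lia.
have Oc i : Om (c i) by apply: eOm (ec i).
have [|||i [V [bV cV]]] := @based_cofinal (c @` `I_n.*2).
- by apply: finite_image; exact: finite_II.
- by exists (c 0), 0.
- by move=> _ [k _ <-].
have cyc : cyclic_on (H V).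
  exists c; split=> // k; exists 0; apply: cV; exists (k %% n.*2).
    by rewrite /= ltn_pmod.
  exact: periodic_mod.
have [phi ephi] := based_emb bV cyc.
by exists (H V), phi; split=> //; exists i, V.
Qed.

(** Embed a larger hull into [Gamma] in any way and correct the result by an automorphism. *)
Lemma forth A phi m : good_emb A phi -> Om m -> exists A' phi',
  [/\ good_emb A' phi', A `<=` A', forall x, A x -> phi' x = phi x & A' m].
Proof.
move=> [[i [V [bV AE]]] cyc ephi] Om_m; subst A.
have [fV _ cV [x Vx]] := bV.
have [|||j [V' [bV' VV']]] := @based_cofinal (V `|` [set m]).
- by rewrite finite_setU; split.
- by exists x; left.
- by move=> z [Vz|->] //; exists i => //; case: cV => + _; apply.
have VA' : V `<=` H V' by move=> z Vz; exists 0; apply: VV'; left.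
have AA' : H V `<=` H V' by apply: (tower_hull_min n_gt2 cV) => //; exact: (based_closed bV').
have cyc' := cyclicS AA' cyc.
have [theta eth] := based_emb bV' cyc'.
have [_ hom _] := hGamma.
have [g gE] := homog_emb hom (based_Ln_closed bV) fV (based_gen bV) ephi
  (@emb_sub n N Gamma (H V') (H V) theta AA' eth).
exists (H V'), (fun x => g (theta x)); split=> //.
- split=> //; first by exists j, V'.
  exact: (emb_comp eth (emb_aut g)).
- by exists 0; apply: VV'; right.
Qed.

(** The image of [phi] and [y] generate a closed set [B], which embeds into a free polygon [D], not
    given inside [Gamma]. A copy of all of [D] is found in the tower over the domain of [phi]; then
    [D] is embedded into [Gamma] so that [B] returns to its place. *)
Lemma back A phi y : good_emb A phi -> exists A' phi',
  [/\ good_emb A' phi', A `<=` A', forall x, A x -> phi' x = phi x &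
      exists2 x, A' x & phi' x = y].
Proof.
move=> [[i [V [bV AE]]] cyc ephi]; subst A.
have [fV conV cV [x0 Vx0]] := bV.
have Acl := based_Ln_closed bV; have Agen := based_gen bV.
have cA := based_closed bV.
have [countG hom age] := hGamma.
(* A free polygon [D] containing the image of [phi] together with [y]. *)
pose XG : set Gamma := (phi @` V) `|` [set y].
have fXG : finite_set XG by rewrite finite_setU; split; [exact: finite_image|].
pose B : set Gamma := Ln_hull XG.
have Bcl : Ln_closed B by exact: Ln_hull_closed.
have Bgen : gen_by XG B by exact: Ln_hull_gen.
have cB : class_C (sub_struct (Substructure Bcl)).
  have [_] := age _ (fin_gen_sub Bcl fXG Bgen); apply.
  by exists (Substructure Bcl); exact: isomorphic_refl.
have [D [gonD freeD [B' iB]]] := cB.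
have [XB _] := Bgen.
have By : B y by apply: XB; right.
have [theta eth] : exists theta : Gamma -> Ln_of n D, emb B theta.
  by apply: iso_sub_emb iB; exists y.
have gD := gonlike_of_gon n_gt2 gonD.
have phiB : phi @` H V `<=` B.
  have [VA Amin] := emb_gen ephi Acl Agen.
  by apply: Amin; [exact: Ln_hull_closed | move=> z Vz; apply: XB; left].
pose eta := theta \o phi : N -> Ln_of n D.
have eeta : @emb n N (Ln_of n D) (H V) eta by exact: (emb_comp ephi eth).
pose AD : set D := eta @` H V.
have ADcl : @Ln_closed n (Ln_of n D) AD by exact: (emb_closed eeta Acl).
have cAD : closed_in (@adj D) n setT AD by exact: (Ln_closed_in n_gt2 gD).
have [ieta seta] := iso_emb n_gt2 gT gD cA (fun _ _ => I) eeta.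
have [F0 [q0 [fF0 conF0 Fq0 FT0]]] := free_data n_gt2 freeD.
have [k XGk] : exists k, (theta @` XG : set D) `<=` F0 k.
  apply: finite_chain; [exact: stages_mono Fq0 | exact: finite_image |].
  by rewrite FT0.
pose F j := F0 (k + j); pose q j := q0 (k + j).
have Fq j : fstep (@adj D) n (F j) (F j.+1) (q j) by rewrite /F addnS; exact: Fq0.
have fF : finite_set (F 0).
  by rewrite /F addn0; exact: (stages_finite n_gt2 Fq0).
have conF : walk_connected (@adj D) (F 0).
  by rewrite /F addn0; exact: (stages_connected (@adj_sym D) n_gt2 Fq0).
have FT : \bigcup_j F j = setT.
  apply/seteqP; split=> // z _; have [j _ Fz] : (\bigcup_j F0 j) z by rewrite FT0.
  by exists j => //; apply: stages_mono Fq0 _ _ _ _ Fz; exact: leq_addl.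
have etaVF : (eta @` V : set D) `<=` F 0.
  move=> _ [z Vz <-]; rewrite /F addn0; apply: XGk; exists (phi z) => //.
  by left; exists z.
(* The trace of [A] on a late stage carries everything [A] shares with [F 0]. *)
have [g [gK ig]] := iso_inv x0 ieta.
have fY : finite_set (g @` (AD `&` F 0)).
  by apply: finite_image; apply: sub_finite_set fF => z [].
have YA : g @` (AD `&` F 0) `<=` H V.
  by move=> _ [_ [[z Az <-] _] <-]; rewrite gK.
have AO : H V `<=` Om by case: cA.
have [j0 Yj0] := finite_stage fY (subset_trans YA AO).
(* Doubling makes the stage even, so that the next one glues extensions. *)
pose j := (maxn i j0).*2.
have ij : i <= j by rewrite /j; lia.
have j0j : j0 <= j by rewrite /j; lia.
have ej : ~~ odd j by rewrite /j odd_double.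
have [bS HS] := rebase n_gt2 bV ij.
pose S := H V `&` W j; rewrite -/S in bS HS.
have [fS conS cS [xS SxS]] := bS.
have VS : V `<=` S.
  move=> z Vz; split; first by exists 0.
  by apply: (stage_mono ij); case: cV => + _; apply.
have SA : S `<=` H V by move=> z [].
have ADFS : AD `&` F 0 `<=` eta @` S.
  move=> z [Az Fz]; have [w Aw wE] := Az; exists w => //; split=> //.
  apply: (stage_mono j0j); apply: Yj0; exists z => //.
  by rewrite -wE gK.
(* [D] is free over the finite graph [G]. *)
have CS t : chain e n Om S t `<=` H V by rewrite -HS => z Cz; exists t.
have /choice[p pP] t : exists p,
    fstep (@adj D) n (eta @` chain e n Om S t) (eta @` chain e n Om S t.+1) p.
  exact: (fstep_transport x0 n_gt2 ieta (CS t.+1) (tower_hull_fstep n_gt2 cS t)).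
have CA : \bigcup_t (eta @` chain e n Om S t) = AD.
  rewrite -image_bigcup; congr (_ @` _); rewrite -HS.
  by apply/seteqP; split=> z [t]; exists t.
have XAF : (eta @` V : set D) `<=` AD `&` F 0.
  by move=> z Vz; split; [case: Vz => w Vw <-; exists w => //; exists 0 | exact: etaVF].
have ADmin C : closed_in (@adj D) n setT C -> (eta @` V : set D) `<=` C -> AD `<=` C.
  move=> cC; have [_] := emb_gen eeta Acl Agen; apply.
  exact: (closed_in_Ln n_gt2 gD).
have conC : walk_connected (@adj D) (eta @` chain e n Om S 0).
  exact: (iso_connected ieta).
have CF0 : (eta @` chain e n Om S 0 : set D) `&` F 0 !=set0.
  by exists (eta x0); split; [exists x0 => //; exact: VS | apply: etaVF; exists x0].
have [Z [z [Z0 Zz ZT]]] := free_union n_gt2 gD Fq FT conF cAD XAF ADmin pP CA ADFS conC CF0.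
have conG := @union_connected D F conF (fun t => eta @` chain e n Om S t) conC CF0.
pose G : set D := eta @` S `|` F 0.
have cG : closed_in (@adj D) n G (eta @` S).
  have -> : eta @` S = AD `&` G.
    apply/seteqP; split=> [_ [w Sw <-]|w [Aw [//|Fw]]]; last exact: ADFS.
    by split; [exists w => //; exact: SA | left; exists w].
  exact: sub_closed_in cAD _.
have tG : tf (@adj D) n G by have [_ tD _ _] := gD; exact: tfS tD.
have fG : finite_set G by rewrite finite_setU; split=> //; exact: finite_image.
(* A copy [U] of [G] is glued over [S]. As [H U] is free over [U] and [D] over [G], the isomorphism
   between them extends to [H U] and [D]. *)
have [U [psi [[SU fU cU conU psiE] [ipsi psiU spsi]]]] :=
  realize n_gt2 (@adj_sym D) (@adj_side D) ej fS (ex_intro _ xS SxS) cS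
    (iso_onS SA ieta) (fun w Sw => seta w (SA w Sw)) fG cG tG conG.
have bU : based n j.+1 U by split=> //; exists xS; exact: SU.
have cU' := based_closed bU.
have [h [hU ih hT sh]] := chain_extend (@tadj_side K n n_gt2) (@adj_side D) n_gt2
  (tower_hull_fstep n_gt2 cU) Zz ipsi (etrans psiU (esym Z0)) spsi.
have HU : \bigcup_t chain e n Om U t = H U by apply/seteqP; split=> w [t]; exists t.
rewrite HU ZT in ih hT sh.
have eh : @emb n N (Ln_of n D) (H U) h.
  by apply: (emb_iso n_gt2 gT gD) => //; rewrite hT.
have AU : H V `<=` H U.
  rewrite -HS; apply: (tower_hull_min n_gt2 cS cU') => w /SU Uw.
  by exists 0.
have Sgen : @gen_by n N S (H V) by have := based_gen bS; rewrite HS.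
have hE w : H V w -> h w = eta w.
  apply: (emb_agree (@emb_sub n N (Ln_of n D) _ _ h AU eh) eeta Acl Sgen) => u Su.
  by rewrite hU ?psiE //; exact: SU.
have setTcl : @Ln_closed n (Ln_of n D) setT by [].
have Dgen : @gen_by n (Ln_of n D) (F 0) setT.
  split=> // C Ccl FC; rewrite -FT.
  exact: (stages_min n_gt2 Fq (Ln_closed_in n_gt2 gD (fun _ _ => I) Ccl)).
have cD : class_C (sub_struct (Substructure setTcl)).
  by exists D; split=> //; exists (Substructure setTcl); exact: isomorphic_refl.
have [|chi echi] := @univ_emb (Ln_of n D) setT (F 0) setTcl fF Dgen _ cD.
  by exists (theta y).
(* On [B] the automorphism [f] undoes [theta] followed by [chi]; this covers [y] and the image of
   [phi]. *)
have eid : emb B (@id Gamma) by split.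
have [f fE] := homog_emb hom Bcl fXG Bgen eid
  (emb_comp eth echi (fun _ _ => I)).
exists (H U), (fun w => f (chi (h w))); split.
- split; [by exists j.+1, U | exact: cyclicS cyc |].
  exact: (emb_comp eh (emb_comp echi (emb_aut f) (fun _ _ => I)) (fun _ _ => I)).
- exact: AU.
- by move=> w Aw; rewrite hE //; apply: fE; apply: phiB; exists w.
- have [w Uw wE] : (h @` H U) (theta y) by rewrite hT.
  by exists w => //; rewrite wE; apply: fE.
Qed.

End BackForth.

Section Union.
Variable n : nat.
Hypothesis n_gt2 : 2 < n.
Variable Gamma : Ln_struct n.
Hypothesis hGamma : fraisse_limit (@class_C n) Gamma.
Variable K : choiceType.
Local Notation D0 := (tower K n_gt2).
Local Notation N := (Ln_of n D0).
Local Notation Om := (@tvert K n).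
Hypothesis gT : @gonlike n D0 Om.
Hypothesis cK : countable [set: K].

Lemma countable_tree : exists r : D0 -> nat, injective r.
Proof.
have /countable_injP[r rI] := cK.
have rinj : injective r by move=> a b; apply: rI; rewrite in_setT.
pose f (x : nat + K) : nat + nat :=
  match x with inl k => inl k | inr a => inr (r a) end.
have finj : injective f by move=> [k|a] [l|b] //= [] => [->//|/rinj->].
exists (fun t => pickle (map f (GenTree.encode t))).
move=> s t /(pcan_inj pickleK) /(inj_map finj).
exact: (pcan_inj (GenTree.codeK _)).
Qed.

Lemma tower_emb : exists Phi : N -> Gamma,
  emb (Om : set N) Phi /\ Phi @` Om = setT.
Proof.
have [rT rTinj] := countable_tree.
have [/countable_injP[rG rGI] _ _] := hGamma.
have rGinj : injective rG by move=> a b; apply: rGI; rewrite in_setT.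
pose st := {s : set N * (N -> Gamma) | @good_emb n n_gt2 Gamma K s.1 s.2}.
pose dom (s : st) := (sval s).1; pose fn (s : st) := (sval s).2.
(* Round [k] treats the vertex of the tower and the point of [Gamma] that carry the number [k], if
   there are any. *)
pose next k (s s' : st) := [/\ dom s `<=` dom s',
  forall x, dom s x -> fn s' x = fn s x,
  forall m, Om m -> rT m = k -> dom s' m &
  forall y, rG y = k -> exists2 x, dom s' x & fn s' x = y].
have step (p : nat * st) : exists s', next p.1 p.2 s'.
  case: p => k [[A phi] /= good].
  have [s1 [A1 p1 m1]] : exists s1 : st, [/\ A `<=` dom s1,
      forall x, A x -> fn s1 x = phi x & forall m, Om m -> rT m = k -> dom s1 m].
    have [[m [Om_m mk]]|no] := pselect (exists m, Om m /\ rT m = k).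
      have [A' [phi' [g' AA' pp' A'm]]] := forth hGamma gT good Om_m.
      exists (exist _ (A', phi') g'); split=> // m' _ m'k.
      by rewrite (_ : m' = m) //; apply: rTinj; rewrite m'k.
    by exists (exist _ (A, phi) good); split=> // m Om_m mk; case: no; exists m.
  have [[y yk]|no] := pselect (exists y, rG y = k); last first.
    by exists s1; split=> // y yk; case: no; exists y.
  have [A' [phi' [g' AA' pp' A'y]]] := back hGamma gT y (svalP s1).
  exists (exist _ (A', phi') g'); split=> /=.
  - exact: subset_trans AA'.
  - by move=> x Ax; rewrite -[RHS](p1 x Ax); apply: pp'; exact: A1.
  - by move=> m Om_m mk; apply: AA'; exact: m1.
  - by move=> y' y'k; rewrite (_ : y' = y) //; apply: rGinj; rewrite y'k.
have /choice[nx nxP] := step.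
have [A0 [phi0 g0]] := good_start hGamma gT.
pose s := fix s k : st := if k is l.+1 then nx (l, s l) else exist _ (A0, phi0) g0.
have sP k : next k (s k) (s k.+1) := nxP (k, s k).
have mono k l : k <= l -> dom (s k) `<=` dom (s l) /\
    forall x, dom (s k) x -> fn (s l) x = fn (s k) x.
  move=> /subnK <-; elim: (l - k) => [|d [IH1 IH2]]; first by split.
  have [d1 d2 _ _] := sP (d + k).
  split=> [x /IH1/d1//|x kx]; rewrite addSn d2 ?IH2 //; exact: IH1.
have sO k : dom (s k) `<=` Om.
  have [[i [V [bV E]]] _ _] := svalP (s k).
  by rewrite /dom E; case: (based_closed bV).
have semb k : emb (dom (s k)) (fn (s k)) by have [] := svalP (s k).
have domT m : Om m -> dom (s (rT m).+1) m.
  by move=> Om_m; have [_ _ + _] := sP (rT m); apply.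
pose Phi m := fn (s (rT m).+1) m.
have PhiE k m : dom (s k) m -> Phi m = fn (s k) m.
  move=> km; have mm := domT _ (sO _ _ km).
  have [kl|lk] := leqP k (rT m).+1; first exact: (mono _ _ kl).2.
  by rewrite /Phi (mono _ _ (ltnW lk)).2.
have two x y : Om x -> Om y -> exists k, dom (s k) x /\ dom (s k) y.
  move=> Ox Oy; exists (maxn (rT x).+1 (rT y).+1).
  by split; [apply: (mono _ _ (leq_maxl _ _)).1 | apply: (mono _ _ (leq_maxr _ _)).1];
    exact: domT.
exists Phi; split; first split.
- move=> x y Ox Oy; have [k [kx ky]] := two _ _ Ox Oy.
  by rewrite !(PhiE k) //; have [+ _ _] := semb k; apply.
- by move=> x Ox; have [_ + _] := semb (rT x).+1; apply; exact: domT.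
- move=> f x y Ox Oy; have [k [kx ky]] := two _ _ Ox Oy.
  have [[i [V [bV E]]] _ _] := svalP (s k).
  have kcl : Ln_closed (dom (s k)) by rewrite /dom E; exact: (based_Ln_closed gT bV).
  rewrite !(PhiE k) //; last exact: kcl.
  by have [_ _ +] := semb k; apply.
- apply/seteqP; split=> // y _; have [_ _ _ /(_ y erefl)[x dx xy]] := sP (rG y).
  by exists x; [exact: sO dx | rewrite (PhiE (rG y).+1)].
Qed.

End Union.

Lemma countable_free n (D : bigraph) : 2 < n -> free_over_finite n D ->
  countable [set: D].
Proof.
move=> n_gt2 freeD; have [F [q [fF _ Fq <-]]] := free_data n_gt2 freeD.
apply: bigcup_countable => // j _; apply: finite_set_countable.
exact: (stages_finite n_gt2 Fq).
Qed.

(** * Embedding the automorphism group *)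

Lemma aut_nbhs_eval n (M : Ln_struct n) (a : Aut M) (x : M) :
  nbhs a [set b : Aut M | b x = a x].
Proof.
have c1 : continuous (@aut_fun n M : Aut M -> {ptws M -> discrete_topology M}).
  exact: initial_continuous.
have c2 := @proj_continuous M (fun=> discrete_topology M) x.
have := @continuous_comp _ _ _ _ _ a (c1 a) (c2 (aut_fun a)).
by move=> /(_ [set a x] (discrete_set1 _)).
Qed.

(** An automorphism is determined by its values on finitely many generators, and fixing these values
    is an open condition. *)
Lemma aut_discrete n (M : Ln_struct n) (X : set M) (a : Aut M) :
  finite_set X -> gen_by X setT -> nbhs a [set a].
Proof.
move=> /finite_seqP[s ->] gX.
have : nbhs a [set b : Aut M | forall x, x \in s -> b x = a x].
  elim: s {gX} => [|x s IH]; first exact: (filterS _ (@filterT _ (nbhs a) _)).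
  apply: filterS (filterI (aut_nbhs_eval a x) IH) => b [bx bs] y.
  by rewrite inE => /predU1P[->//|/bs].
apply: filterS => b bs; apply: aut_ext => x.
exact: (emb_agree (emb_aut b) (emb_aut a) _ gX bs).
Qed.

(** * Carrying the action over to the limit *)

Section Transfer.
Variables (n : nat) (K : choiceType) (n_gt2 : 2 < n) (Gamma : Ln_struct n).
Local Notation D0 := (tower K n_gt2).
Local Notation N := (Ln_of n D0).
Local Notation Om := (@tvert K n).
Hypothesis gT : @gonlike n D0 Om.
Variables (Phi : N -> Gamma) (Psi : Gamma -> N).
Hypothesis ePhi : emb (Om : set N) Phi.
Hypothesis OPsi : forall y, Om (Psi y).
Hypothesis PsiK : cancel Psi Phi.

Let PhiK x : Om x -> Psi (Phi x) = x.
Proof. by move=> Ox; have [+ _ _] := ePhi; apply. Qed.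

Definition transfer (f : K -> K) (y : Gamma) : Gamma := Phi (act n f (Psi y)).

(** The inverse of [g] guarantees that [act g] keeps the tower, on which the functor law is
    available. *)
Lemma transfer_comp f g g' : cancel g g' -> cancel g' g ->
  transfer (f \o g) =1 transfer f \o transfer g.
Proof.
move=> gK g'K y; rewrite /transfer /= PhiK ?act_comp //.
exact: (act_vert n_gt2 gK g'K).
Qed.

Lemma transferK f f' : cancel f f' -> cancel f' f ->
  cancel (transfer f) (transfer f').
Proof.
move=> fK f'K y; rewrite -[LHS]/((transfer f' \o transfer f) y).
by rewrite -(transfer_comp _ fK f'K) /transfer act_id.
Qed.

Lemma transfer_iso f f' : cancel f f' -> cancel f' f -> Ln_iso (transfer f).
Proof.
move=> fK f'K.
have OmOm : closed_in (@adj D0) n Om Om by split=> // g L _ [[Og _] _] _ _.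
have OmL : Ln_closed (Om : set N) by exact: (closed_in_Ln n_gt2 gT OmOm).
have [_ aP aF] : @emb n N N Om (act n f).
  apply: (emb_iso n_gt2 gT gT OmOm).
  - by rewrite (act_image n_gt2 fK f'K).
  - exact: (act_iso n_gt2 fK f'K).
  - by move=> x _; exact: tside_act.
have Oact x : Om x -> Om (act n f x) by exact: (act_vert n_gt2 fK f'K).
have [_ PP PF] := ePhi.
split.
- by exists (transfer f'); apply: transferK.
- move=> y; rewrite /transfer PP; last exact: Oact.
  by rewrite aP // -PP // PsiK.
- move=> k x y; rewrite /transfer -PF; try exact: Oact.
  rewrite -aF //; congr (Phi (act n f _)).
  by rewrite -[in LHS](PsiK x) -[in LHS](PsiK y) -PF // PhiK //; exact: OmL.
Qed.

Lemma transfer_leaf f a :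
  transfer f (Phi (GenTree.Leaf a)) = Phi (GenTree.Leaf (f a)).
Proof. by rewrite /transfer PhiK //; exact: leaf_vert. Qed.

Lemma transfer_inj f g : transfer f =1 transfer g -> f =1 g.
Proof.
move=> fg a; have := fg (Phi (GenTree.Leaf a)); rewrite !transfer_leaf.
have [inj _ _] := ePhi.
by move=> /inj - /(_ (leaf_vert _ _) (leaf_vert _ _)) [].
Qed.

End Transfer.

Section TransferHom.
Variables (n : nat) (Delta : bigraph) (n_gt2 : 2 < n) (Gamma : Ln_struct n).
Local Notation N := (Ln_of n (tower Delta n_gt2)).
Local Notation Om := (@tvert Delta n).
Hypothesis gT : @gonlike n (tower Delta n_gt2) Om.
Variables (Phi : N -> Gamma) (Psi : Gamma -> N).
Hypothesis ePhi : emb (Om : set N) Phi.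
Hypothesis OPsi : forall y, Om (Psi y).
Hypothesis PsiK : cancel Psi Phi.

Lemma transfer_aut_subproof (a : Aut (Ln_of n Delta)) :
  `[< Ln_iso (transfer Phi Psi a) >].
Proof.
apply/asboolP.
exact: (transfer_iso gT ePhi OPsi PsiK (@aut_invK _ _ a) (@aut_invKr _ _ a)).
Qed.

Definition transfer_aut a : Aut Gamma := MkAut (transfer_aut_subproof a).

Lemma transfer_autM : {morph transfer_aut : a b / (a * b)%g}.
Proof.
move=> a b; apply: aut_ext.
exact: (transfer_comp ePhi OPsi PsiK _ (@aut_invK _ _ b) (@aut_invKr _ _ b)).
Qed.

HB.instance Definition _ := isMultiplicative.Build _ _ transfer_aut transfer_autM.

Lemma transfer_aut_inj : injective transfer_aut.
Proof.
move=> a b ab; apply: aut_ext; apply: (transfer_inj ePhi OPsi PsiK).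
by move=> y; rewrite -[LHS]/(transfer_aut a y) ab.
Qed.

End TransferHom.

Theorem corollary5p7 (n : nat) (hn : 3 <= n)
    (Gamma : Ln_struct n) (hGamma : fraisse_limit (@class_C n) Gamma)
    (Delta : bigraph) (hDelta : generalized_gon n Delta)
    (hfree : free_over_finite n Delta) :
  exists phi : {multiplicative Aut (Ln_of n Delta) -> Aut Gamma},
    continuous phi /\ injective phi.
Proof.
have gD := gonlike_of_gon hn hDelta.
have gT := tower_gonlike Delta hn gD.
have [Phi [ePhi PhiT]] := tower_emb hGamma gT (countable_free hn hfree).
have /choice[Psi PsiP] : forall y : Gamma, exists x, tvert n x /\ Phi x = y.
  by move=> y; have [x Ox xy] : (Phi @` @tvert Delta n) y; [rewrite PhiT | exists x].
have OPsi y : tvert n (Psi y) by case: (PsiP y).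
have PsiK : cancel Psi Phi by move=> y; case: (PsiP y).
exists (transfer_aut gT ePhi OPsi PsiK); split; last exact: transfer_aut_inj.
(* Continuity at [a] is automatic because [a] is isolated; the finitely many generators are the
   vertices of [F 0]. *)
have [F [q [fF _ Fq FT]]] := free_data hn hfree.
move=> a B /nbhs_singleton Ba.
have gF : @gen_by n (Ln_of n Delta) (F 0) setT.
  split=> // C Ccl FC; rewrite -FT.
  exact: (stages_min hn Fq (Ln_closed_in hn gD (fun _ _ => I) Ccl)).
by apply: filterS (aut_discrete a fF gF) => _ ->.
Qed.
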